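(* Let $k\ge 2$, $m\ge1$, $\Delta\ge 3$ and $n\ge 2$ be integers, let $m^*=m-n(\Delta-2)$, and let $T$ be a caterpillar in $\mathbb{T}_k(m,\Delta,n)$. Then $\rho(T)\le \rho(C_k(m^*,\Delta,\lfloor n/2\rfloor,\lceil n/2\rceil))$, with equality if and only if $T\cong C_k(m^*,\Delta,\lfloor n/2\rfloor,\lceil n/2\rceil)$.
   Context: A hypergraph $G$ is $k$-uniform if every edge is a $k$-element subset of $V(G)$. The degree of a vertex is the number of edges containing it. A path from $u$ to $v$ is a sequence $(v_0,e_1,v_1,\dots,e_p,v_p)$ with $v_0=u$, $v_p=v$, $v_{i-1},v_i\in e_i$, $v_{i-1}\ne v_i$, all $v_i$ and $e_i$ distinct; its length is $p$. A cycle is such a sequence with at least two distinct edges, all $v_i,e_i$ distinct except $v_0=v_p$. A hypertree is a connected hypergraph with no cycles. $d_G(u,v)$ is the length of a shortest $u$–$v$ path, $D(G)=(d_G(u,v))$ is the distance matrix and $\rho(G)$, the distance spectral radius, is its largest eigenvalue. A $k$-uniform loose path $P^k_m=(u_0,e_1,u_1,\dots,u_{m-1},e_m,u_m)$ is a $k$-uniform hypertree with $m$ edges in which $u_1,\dots,u_{m-1}$ have degree $2$ and all other vertices have degree $1$. A $k$-uniform hyperstar $S^k_l$ is a $k$-uniform hypertree with $l$ edges sharing a common vertex (its center). A caterpillar is a $k$-uniform hypertree obtained from a loose path by choosing some vertices of the path and, at each chosen vertex, identifying a root vertex of a vertex-disjoint copy of a $k$-uniform hyperstar with that vertex. For integers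 $\Delta\ge 3$, $a,b\ge 0$ with $a+b<m$, $C_k(m,\Delta,a,b)$ is obtained from $P^k_m$ by attaching, for each $i$ with $1\le i\le a$ or $m-b\le i\le m-1$, a copy of $S^k_{\Delta-2}$ by identifying its center with $u_i$. $\mathbb{T}_k(m,\Delta,n)$ is the set of $k$-uniform hypertrees with $m$ edges, maximum degree $\Delta$, and exactly $n$ vertices of degree $\Delta$. *)

(* Defs.v *)
From mathcomp Require Import all_boot all_order all_algebra.
From mathcomp Require Import polyrcf reals.

Set Implicit Arguments.
Unset Strict Implicit.
Unset Printing Implicit Defensive.

Import GRing.Theory Num.Theory.

Section Hypergraph.
Variable V : finType.
Variable E : {set {set V}}.

Definition uniform (k : nat) : bool := [forall e in E, #|e| == k].

Definition deg (v : V) : nat := #|[set e in E | v \in e]|.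

Definition maxdeg : nat := \max_(v : V) deg v.

(* A path (v_0,e_1,v_1,...,e_p,v_p) from u to v, given as the vertex sequence
   vs = [v_0;...;v_p] and edge sequence es = [e_1;...;e_p]; its length is p. *)
Definition is_path (u v : V) (vs : seq V) (es : seq {set V}) : bool :=
  [&& size vs == (size es).+1,
      nth u vs 0 == u, last u vs == v,
      all (fun e => e \in E) es,
      uniq vs, uniq es &
      all (fun i => [&& nth u vs i \in nth set0 es i,
                        nth u vs i.+1 \in nth set0 es i &
                        nth u vs i != nth u vs i.+1])
          (iota 0 (size es))].

Definition is_cycle (vs : seq V) (es : seq {set V}) : bool :=
  [&& size vs == (size es).+1, 2 <= size es &
      match vs with
      | [::] => false
      | v0 :: vs' =>
          [&& last v0 vs' == v0,
              all (fun e => e \in E) es,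
              uniq vs', uniq es &
              all (fun i => [&& nth v0 vs i \in nth set0 es i,
                                nth v0 vs i.+1 \in nth set0 es i &
                                nth v0 vs i != nth v0 vs i.+1])
                  (iota 0 (size es))]
      end].

Definition connected : Prop :=
  forall u v : V, exists (vs : seq V) (es : seq {set V}), is_path u v vs es.

Definition acyclic : Prop :=
  forall (vs : seq V) (es : seq {set V}), ~~ is_cycle vs es.

Definition hypertree : Prop := connected /\ acyclic.

Definition has_path_len (u v : V) (p : nat) : bool :=
  [exists vs : (p.+1).-tuple V, exists es : p.-tuple {set V},
     is_path u v vs es].

(* d_G(u,v): the length of a shortest u-v path (every path has length
   < #|V| since its vertices are distinct; the default #|V| is never used
   for connected hypergraphs). *)
Definition dist (u v : V) : nat :=
  \big[minn/#|V|]_(p < #|V| | has_path_len u v p) p.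

Definition distmx (R : realType) : 'M[R]_#|V| :=
  \matrix_(i, j) ((dist (enum_val i) (enum_val j))%:R)%R.

End Hypergraph.

(* The largest eigenvalue of a square real matrix (the largest real root of
   its characteristic polynomial; [rootsR] is sorted increasingly). *)
Definition largest_eigenvalue (R : realType) (n : nat) (A : 'M[R]_n) : R :=
  last 0%R (rootsR (char_poly A)).

Definition rho (R : realType) (V : finType) (E : {set {set V}}) : R :=
  largest_eigenvalue (distmx E R).

Definition in_Tk (k m Delta n : nat) (V : finType) (E : {set {set V}}) : Prop :=
  [/\ uniform E k, hypertree E, #|E| = m, maxdeg E = Delta &
      #|[set v : V | deg E v == Delta]| = n].

Definition hiso (V W : finType) (E : {set {set V}}) (F : {set {set W}}) : Prop :=
  exists f : V -> W, bijective f /\ [set f @: e | e : {set V} in E] = F.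

(* Concrete constructions on vertex sets {0,...,N-1}: a "list hypergraph"   *)
(* is a pair (N, es) with es a list of edges given as lists of naturals.    *)
Definition lhg := (nat * seq (seq nat))%type.

Definition hg_of (N : nat) (es : seq (seq nat)) : {set {set 'I_N}} :=
  [set S : {set 'I_N} | has (fun e => S == [set x : 'I_N | val x \in e]) es].

Definition hg (g : lhg) : {set {set 'I_g.1}} := hg_of g.1 g.2.

(* the k-uniform loose path P^k_p with u_i = i*(k-1), vertices 0..p(k-1),
   e_i = {(i-1)(k-1), ..., i(k-1)} *)
Definition lpath (k p : nat) : lhg :=
  ((p * (k - 1)).+1, [seq iota ((i - 1) * (k - 1)) k | i <- iota 1 p]).

(* attach a vertex-disjoint copy of the hyperstar S^k_l, identifying its
   center with vertex v (the k-1 other vertices of each star edge are fresh) *)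
Definition attach_star (k : nat) (g : lhg) (v l : nat) : lhg :=
  (g.1 + l * (k - 1),
   g.2 ++ [seq v :: iota (g.1 + j * (k - 1)) (k - 1) | j <- iota 0 l]).

Definition cat_graph (k p : nat) (att : seq (nat * nat)) : lhg :=
  foldl (fun g a => attach_star k g a.1 a.2) (lpath k p) att.

Definition Ck (k m Delta a b : nat) : lhg :=
  cat_graph k m [seq (i * (k - 1), Delta - 2) |
                  i <- iota 1 (m - 1) & (i <= a) || (m - b <= i)].

Definition caterpillar (k : nat) (V : finType) (E : {set {set V}}) : Prop :=
  exists (p : nat) (att : seq (nat * nat)),
    [/\ uniq (map fst att),
        all (fun a => (a.1 <= p * (k - 1)) && (0 < a.2)) att &
        hiso E (hg (cat_graph k p att))].

(* Main.v *)
(** If [x] is the Perron vector of a hypertree and a set of pendant edges with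
    vertex set F is moved from [u] to [w], the quadratic form of the distance
    matrix changes by twice the mass of F times
    [\sum_(z notin F) x z * (d w z - d u z)]; when this is nonnegative the
    spectral radius strictly increases. Distances along the path are convex, so
    for a caterpillar one of two opposite moves is increasing as long as some
    star is attached inside a path edge, some degree lies strictly between 2
    and Delta, or a block of vertices of degree Delta is not at an end of the
    path. What remains are [a] full joints at one end and [b] at the other.
    If [a >= b + 2], moving the innermost star of the first group next to the
    second group is increasing: this is read off the resolvent of the tree with
    that star deleted, by a maximum principle for the antisymmetric part of a
    potential under the reflection exchanging the two attachment points. As
    there are finitely many hypergraphs on a given vertex set, every
    caterpillar in the class is either the balanced one or strictly worse. *)
Require Import Defs.
From mathcomp Require Import all_boot all_order all_algebra.
From mathcomp Require Import polyrcf reals.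
From mathcomp Require Import fingroup perm.
From mathcomp Require Import ring lra zify.
Set Implicit Arguments.
Unset Strict Implicit.
Unset Printing Implicit Defensive.
Import Order.TTheory GRing.Theory Num.Theory.

(** * Rayleigh quotients and Perron vectors *)

Section Spectral.
Local Open Scope ring_scope.
Variables (R : realType) (V : finType).
Implicit Types (d : V -> V -> R) (x y z : V -> R).

(** The sign of the relocation sum depends on the Perron vector [x], of which almost nothing is
    known. Two opposite destinations remove this dependence when some positive combination of the
    two sums is nonnegative: for joints this is plain convexity, while for a star inside an edge
    convexity fails at the two ends of the path and the defect must be paid for by bounds on [x].
    Which of the two moves gains is decided by [x], so no combinatorial measure of the caterpillar
    need decrease; this is why termination is based on the values of the radius. Balancing has no
    such pair, the opposite move leading away from balance; there [x] is abandoned outside the moved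
    star in favour of a vector adapted to the new place. Each move stays in the class: it either
    exchanges the degrees of two vertices or touches only degrees below [Delta]. All caterpillars
    with [m] edges are coded on one vertex set, so that their matrices can be compared entry by
    entry. *)

Definition app d y (u : V) : R := \sum_v d u v * y v.
Definition ip y z : R := \sum_v y v * z v.
Definition bil d y z : R := ip y (app d z).

Lemma ip_ge0 y : 0 <= ip y y.
Proof. by apply: sumr_ge0 => v _; rewrite -expr2 sqr_ge0. Qed.

Lemma ip_eq0 y : ip y y = 0 -> forall v, y v = 0.
Proof.
move=> h v; apply/eqP; rewrite -sqrf_eq0 expr2.
move/eqP: h; rewrite psumr_eq0 => [/allP/(_ v)|w _]; last by rewrite -expr2 sqr_ge0.
by rewrite mem_index_enum => /(_ isT).
Qed.

Lemma ip_gt0 y v : y v != 0 -> 0 < ip y y.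
Proof.
move=> yv; rewrite lt_neqAle ip_ge0 andbT eq_sym; apply: contra yv => /eqP h.
by rewrite (ip_eq0 h).
Qed.

Lemma ipC y z : ip y z = ip z y.
Proof. by apply: eq_bigr => v _; rewrite mulrC. Qed.

Lemma ipDr y z w : ip y (fun v => z v + w v) = ip y z + ip y w.
Proof. by rewrite -big_split; apply: eq_bigr => v _ /=; rewrite mulrDr. Qed.

Lemma ipZr y c z : ip y (fun v => c * z v) = c * ip y z.
Proof. by rewrite mulr_sumr; apply: eq_bigr => v _; rewrite mulrCA. Qed.

Lemma ipDl y z w : ip (fun v => y v + z v) w = ip y w + ip z w.
Proof. by rewrite ipC ipDr ![ip w _]ipC. Qed.

Lemma ipZl y c z : ip (fun v => c * y v) z = c * ip y z.
Proof. by rewrite ipC ipZr ipC. Qed.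

Lemma eq_ip y y' z z' : y =1 y' -> z =1 z' -> ip y z = ip y' z'.
Proof. by move=> e f; apply: eq_bigr => v _; rewrite e f. Qed.

Lemma appD d y z : app d (fun v => y v + z v) =1 (fun u => app d y u + app d z u).
Proof. by move=> u; rewrite -big_split; apply: eq_bigr => v _ /=; rewrite mulrDr. Qed.

Lemma appZ d c y : app d (fun v => c * y v) =1 (fun u => c * app d y u).
Proof. by move=> u; rewrite mulr_sumr; apply: eq_bigr => v _; rewrite mulrCA. Qed.

Lemma bilDr d y z w : bil d y (fun v => z v + w v) = bil d y z + bil d y w.
Proof. by rewrite -ipDr; apply: eq_ip => //; apply: appD. Qed.
Lemma bilZr d y c z : bil d y (fun v => c * z v) = c * bil d y z.
Proof. by rewrite -ipZr; apply: eq_ip => //; apply: appZ. Qed.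
Lemma bilDl d y z w : bil d (fun v => y v + z v) w = bil d y w + bil d z w.
Proof. exact: ipDl. Qed.
Lemma bilZl d y c z : bil d (fun v => c * y v) z = c * bil d y z.
Proof. exact: ipZl. Qed.

Lemma bilE d y z : bil d y z = \sum_u \sum_v d u v * (y u * z v).
Proof.
by apply: eq_bigr => u _; rewrite mulr_sumr; apply: eq_bigr => v _; rewrite mulrCA.
Qed.

Lemma bil_sym d y z : (forall u v, d u v = d v u) -> bil d y z = bil d z y.
Proof.
move=> ds; rewrite !bilE exchange_big; apply: eq_bigr => u _; apply: eq_bigr => v _.
by rewrite ds [y v * _]mulrC.
Qed.

Lemma bil_bound d : exists2 K : R, 0 < K & forall y, bil d y y <= K * ip y y.
Proof.
(* The 1 keeps the constant positive even for [d = 0]. *)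
exists (1 + \sum_u \sum_v `|d u v|).
  by apply: ltr_wpDr => //; apply: sumr_ge0 => u _; apply: sumr_ge0.
move=> y; rewrite bilE mulrDl mul1r; apply: ler_wpDl; first exact: ip_ge0.
rewrite mulr_suml; apply: ler_sum => u _; rewrite mulr_suml; apply: ler_sum => v _.
have le2 w : y w ^+ 2 <= ip y y.
  rewrite /ip (bigD1 w) //= -expr2 lerDl; apply: sumr_ge0 => t _.
  by rewrite -expr2 sqr_ge0.
apply: le_trans (ler_norm _) _; rewrite normrM; apply: ler_wpM2l => //.
rewrite normrM.
have := sqr_ge0 (`|y u| - `|y v|); rewrite sqrrB !real_normK ?num_real // => h.
have := le2 u; have := le2 v; lra.
Qed.

Definition kron (u v : V) : R := (u == v)%:R.

Lemma sum_kron (f : V -> R) u : \sum_v kron u v * f v = f u.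
Proof.
rewrite (bigD1 u) //= /kron eqxx mul1r big1 ?addr0 // => v vu.
by rewrite eq_sym (negPf vu) mul0r.
Qed.

Lemma sum_enum_val (f : V -> R) : \sum_v f v = \sum_(i < #|V|) f (enum_val i).
Proof. by rewrite -big_enum_val; apply: eq_bigl. Qed.

(** The alternative for square matrices, stated for kernels on [V]. It is used both ways: for the
    maximal eigenvalue the inverse is refuted, for the resolvent off a set of vertices the kernel
    is. *)
Lemma kernel_or_inverse d :
  (exists y, (exists v, y v != 0) /\ forall u, app d y u = 0) \/
  (exists N, forall y u, app d (app N y) u = y u).
Proof.
pose A : 'M[R]_#|V| := \matrix_(i, j) d (enum_val i) (enum_val j).
pose fn (w : 'cV[R]_#|V|) v := w (enum_rank v) 0.
have appA w v : app d (fn w) v = (A *m w) (enum_rank v) 0.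
  rewrite mxE /app sum_enum_val.
  by apply: eq_bigr => j _; rewrite mxE /fn enum_valK enum_rankK.
have [Au|Au] := boolP (A \in unitmx).
  right; exists (fun u v => invmx A (enum_rank u) (enum_rank v)) => y u.
  pose w : 'cV[R]_#|V| := \col_i y (enum_val i).
  transitivity (app d (fn (invmx A *m w)) u).
    apply: eq_bigr => v _; congr (_ * _); rewrite /fn mxE /app.
    rewrite sum_enum_val.
    by apply: eq_bigr => j _; rewrite mxE enum_valK.
  by rewrite appA mulKVmx // mxE enum_rankK.
left.
have : \det A^T == 0 by rewrite det_tr; move: Au; rewrite unitmxE unitfE negbK.
case/det0P => v v0 vA; exists (fn v^T); split.
  case/rV0Pn: v0 => j vj; exists (enum_val j); by rewrite /fn mxE enum_valK.
by move=> u; rewrite appA -[A]trmxK -trmx_mul vA trmx0 mxE.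
Qed.

Lemma app_shift d mu y u :
  app (fun u v => mu * kron u v - d u v) y u = mu * y u - app d y u.
Proof.
rewrite /app -(sum_kron y) mulr_sumr -sumrB; apply: eq_bigr => v _.
by rewrite mulrBl mulrA.
Qed.

Lemma bil_shift d mu y :
  bil (fun u v => mu * kron u v - d u v) y y = mu * ip y y - bil d y y.
Proof.
rewrite /bil -ipZr -mulN1r -ipZr -ipDr; apply: eq_ip => // u.
by rewrite app_shift mulN1r.
Qed.

(* If [sup - d] were invertible, completing the square against its inverse
   would bound it below by a positive multiple of the identity, contradicting
   the choice of the supremum. *)
Lemma rayleigh_max d (v0 : V) : (forall u v, d u v = d v u) ->
  exists mu, (forall y, bil d y y <= mu * ip y y) /\
    exists y, (exists v, y v != 0) /\ forall u, app d y u = mu * y u.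
Proof.
move=> ds; have [K K0 hK] := bil_bound d.
pose E := fun q : R => exists2 y, (exists v, y v != 0) & q * ip y y = bil d y y.
have Eub : classical_sets.ubound E K.
  move=> q [y [v yv] e]; have := hK y; rewrite -e ler_pM2r //; exact: ip_gt0 yv.
have Esup : classical_sets.has_sup E.
  split; last by exists K.
  pose y0 := fun _ : V => 1 : R.
  have p0 : 0 < ip y0 y0 by apply: (@ip_gt0 y0 v0); rewrite oner_eq0.
  exists (bil d y0 y0 / ip y0 y0); exists y0; first by exists v0; rewrite oner_eq0.
  by rewrite divfK // gt_eqF.
set mu := sup E.
have hmu y : bil d y y <= mu * ip y y.
  have [/existsP[v yv]|/existsPn h] := boolP [exists v, y v != 0].
    have p0 := ip_gt0 yv.
    rewrite -ler_pdivrMr //; apply: sup_upper_bound => //.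
    by exists y; [exists v | rewrite divfK // gt_eqF].
  have z v : y v = 0 by apply/eqP; move: (h v); rewrite negbK.
  by rewrite /bil /ip !big1 ?mulr0 // => v _; rewrite z mul0r.
exists mu; split=> //.
pose M u v := mu * kron u v - d u v.
have MA y u : app M y u = mu * y u - app d y u by exact: app_shift.
have MB y : bil M y y = mu * ip y y - bil d y y by exact: bil_shift.
have Ms u v : M u v = M v u by rewrite /M ds /kron eq_sym.
case: (kernel_or_inverse M) => [[y [y0 hy]]|[N hN]].
  by exists y; split=> // u; apply/eqP; rewrite eq_sym -subr_eq0 -MA hy.
exfalso; have [C C0 hC] := bil_bound N.
have Blow y : ip y y / C <= bil M y y.
  (* The form of [M] at [y - z / C] is the form at [y], minus [2 / C] times [ip y y], plus
     [bil N y y / C ^ 2]; the last term is at most [ip y y / C]. *)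
  pose z := app N y; pose w v := y v + - C^-1 * z v.
  have : 0 <= bil M w w by rewrite MB subr_ge0.
  rewrite /w bilDl !bilDr !bilZl !bilZr.
  have e1 : bil M y z = ip y y by apply: eq_ip => // u; rewrite hN.
  rewrite (bil_sym z y Ms) e1.
  have e2 : bil M z z = bil N y y by rewrite /bil ipC; apply: eq_ip => // u; rewrite hN.
  rewrite e2 => h; have h2 := hC y.
  have h3 : C^-1 * (C^-1 * bil N y y) <= C^-1 * ip y y.
    by rewrite ler_pM2l ?invr_gt0 // ler_pdivrMl.
  rewrite mulrC; lra.
have Cp : 0 < C^-1 by rewrite invr_gt0.
(* A Rayleigh quotient [q] within [C^-1] of the supremum makes [bil M y y], which is [mu - q] times
   [ip y y], smaller than [Blow] allows. *)
have [q [y yv e]] := sup_adherent (eps := C^-1) Cp Esup.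
rewrite -/mu => hq; have := Blow y; rewrite MB -e.
case: yv => v yv; have p0 := ip_gt0 yv.
rewrite -mulrBl mulrC ler_pM2r //; lra.
Qed.

(** First-order optimality made quantitative: a step of length [K^-1] along the residual
    [z = d y - mu y], with [K] bounding the form of [mu - d], would push the form above its bound
    unless [z] vanishes. *)
Lemma rayleigh_eq d mu y : (forall u v, d u v = d v u) ->
  (forall z, bil d z z <= mu * ip z z) -> mu * ip y y <= bil d y y ->
  forall u, app d y u = mu * y u.
Proof.
move=> ds hmu hy u; pose z v := app d y v + - mu * y v.
have [K K0 hK] := bil_bound (fun u v => mu * kron u v - d u v).
suff z0 : ip z z = 0.
  by have := ip_eq0 z0 u; rewrite /z => h; apply/eqP; rewrite -subr_eq0 -h mulNr.
apply/eqP; rewrite eq_le ip_ge0 andbT.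
have e1 : bil d z y = ip z z + mu * ip z y.
  have hz : ip z z = ip z (app d y) + - mu * ip z y by rewrite -ipZr -ipDr.
  by rewrite hz mulNr subrK.
clearbody z.
have := hmu (fun v => y v + K^-1 * z v).
rewrite bilDl !bilDr !bilZl !bilZr ipDl !ipDr !ipZl !ipZr (bil_sym y z ds) e1 (ipC y z).
have := hK z.
rewrite bil_shift.
move=> h1 h2.
have h3 : K^-1 * (K^-1 * (mu * ip z z - bil d z z)) <= K^-1 * ip z z.
  by rewrite ler_pM2l ?invr_gt0 // ler_pdivrMl.
have h4 : 0 < K^-1 by rewrite invr_gt0.
rewrite -(pmulr_rle0 _ h4). lra.
Qed.



(** The default 0 of [last] is never met, [mu] itself being a root; every root has a row
    eigenvector, whose Rayleigh quotient is at most [mu], and the list of roots is sorted. *)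
Lemma largest_eigenvalueE d mu : (forall u v, d u v = d v u) ->
  (forall z, bil d z z <= mu * ip z z) ->
  (exists y, (exists v, y v != 0) /\ forall u, app d y u = mu * y u) ->
  largest_eigenvalue (\matrix_(i < #|V|, j < #|V|) d (enum_val i) (enum_val j)) = mu.
Proof.
move=> ds hmu [y [[v0 yv0] hy]]; set A := \matrix_(i, j) _.
have p0 : char_poly A != 0 by rewrite monic_neq0 // char_poly_monic.
pose fn (w : 'rV[R]_#|V|) v := w 0 (enum_rank v).
have appA w v : app d (fn w) v = (w *m A) 0 (enum_rank v).
  rewrite mxE /app sum_enum_val.
  by apply: eq_bigr => j _; rewrite mxE /fn enum_valK enum_rankK ds mulrC.
have inr a : (a \in rootsR (char_poly A)) = eigenvalue A a.
  rewrite eigenvalue_root_char; have := roots_on_rootsR p0 => /(_ a) <-.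
  by rewrite inE.
have le_mu a : a \in rootsR (char_poly A) -> a <= mu.
  rewrite inr => /eigenvalueP[w wA w0].
  case/rV0Pn: w0 => j wj.
  have pw : 0 < ip (fn w) (fn w).
    by apply: (@ip_gt0 _ (enum_val j)); rewrite /fn enum_valK.
  rewrite -(ler_pM2r pw); apply: le_trans (hmu _).
  by rewrite /bil -ipZr le_eqVlt; apply/orP; left; apply/eqP/eq_ip => // v; rewrite appA wA mxE.
have mu_in : mu \in rootsR (char_poly A).
  rewrite inr; apply/eigenvalueP; pose w : 'rV[R]_#|V| := \row_j y (enum_val j).
  exists w; last by apply/rV0Pn; exists (enum_rank v0); rewrite mxE enum_rankK.
  apply/rowP => j; rewrite -[j]enum_valK -appA mxE [w 0 _]mxE enum_rankK -hy.
  by apply: eq_bigr => v _; rewrite /fn mxE enum_rankK.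
have srt : sorted <=%R (rootsR (char_poly A)).
  by apply: sub_sorted (sorted_roots _ _ _) => a b; exact: ltW.
rewrite /largest_eigenvalue; move: mu_in le_mu srt.
case: (rootsR _) => //= a s; case/lastP: s => [|s b].
  by rewrite inE => /eqP-> .
rewrite last_rcons => mi le srt; apply/le_anti/andP; split.
  by apply: le; rewrite inE mem_rcons mem_head orbT.
move: mi; rewrite -rcons_cons mem_rcons inE => /orP[/eqP-> //|mi].
move: srt; rewrite -[path _ _ _]/(sorted <=%R (rcons (a :: s) b)).
by rewrite (sorted_pairwise le_trans) pairwise_rcons => /andP[/allP/(_ _ mi)].
Qed.

End Spectral.

Section Perron.
Local Open Scope ring_scope.
Variables (R : realType) (V : finType).
Implicit Types (d : V -> V -> nat) (x y z : V -> R).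

Definition nat_metric d := (forall u v, d u v = d v u) /\ forall u v, (d u v == 0%N) = (u == v).

Definition toR d (u v : V) : R := (d u v)%:R.

(** All that is used of the largest eigenvalue; such pairs are compared and carried along bijections
    without returning to characteristic polynomials. *)
Record perron_pair d mu x : Prop := PerronPair {
  perron_gt0 : 0 < mu;
  perron_pos : forall v, 0 < x v;
  perron_eq : forall u, app (toR d) x u = mu * x u;
  perron_max : forall y, bil (toR d) y y <= mu * ip y y }.

Lemma toR_sym d u v : nat_metric d -> toR d u v = toR d v u.
Proof. by case=> ds _; rewrite /toR ds. Qed.

Lemma toR_gt0 d u v : nat_metric d -> u != v -> 0 < toR d u v.
Proof. by case=> _ dp uv; rewrite ltr0n lt0n dp. Qed.

Lemma bil_abs d y : bil (toR d) y y <= bil (toR d) (fun v => `|y v|) (fun v => `|y v|).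
Proof.
rewrite !bilE; apply: ler_sum => u _; apply: ler_sum => v _.
by apply: ler_wpM2l; [exact: ler0n | rewrite -normrM ler_norm].
Qed.

Lemma ip_abs y : ip (fun v => `|y v|) (fun v => `|y v|) = ip y y.
Proof. by apply: eq_bigr => v _; rewrite -normrM -expr2 ger0_norm ?sqr_ge0. Qed.

(** Since distances are nonnegative, passing to absolute values keeps the norm and does not lower
    the form, so [|y|] is again a maximiser. *)
Lemma abs_eigen d mu y : nat_metric d ->
  (forall z, bil (toR d) z z <= mu * ip z z) -> mu * ip y y <= bil (toR d) y y ->
  forall u, app (toR d) (fun v => `|y v|) u = mu * `|y u|.
Proof.
move=> dm hmu hy; apply: (rayleigh_eq _ hmu); first by move=> u v; exact: toR_sym.
by rewrite ip_abs; apply: le_trans hy _; exact: bil_abs.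
Qed.

(** Off-diagonal distances are positive, so one nonzero coordinate makes all others positive; a
    second vertex, provided by [1 < #|V|], then does the same for the first. *)
Lemma abs_eigen_pos d mu y : nat_metric d -> (1 < #|V|)%N ->
  (forall u, app (toR d) (fun v => `|y v|) u = mu * `|y u|) ->
  (exists v, y v != 0) -> forall u, 0 < mu * `|y u|.
Proof.
move=> dm V1 he [v yv].
have pos u w : u != w -> y w != 0 -> 0 < mu * `|y u|.
  move=> uw yw; rewrite -he /app (bigD1 w) //=; apply: ltr_pwDl.
    by apply: mulr_gt0; [exact: toR_gt0 | rewrite normr_gt0].
  by apply: sumr_ge0 => t _; apply: mulr_ge0 => //; exact: ler0n.
move=> u; have [uv|uv] := eqVneq u v; last exact: pos yv.
have [a av] : exists a, a != v.
  apply/existsP; rewrite -negb_forall; apply/negP => /forallP h.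
  have : (#|V| <= #|pred1 v|)%N by apply: subset_leq_card; apply/subsetP => t _; exact: h.
  by rewrite card1 leqNgt V1.
have pa := pos _ _ av yv; rewrite uv; apply: (pos v a); first by rewrite eq_sym.
by apply/eqP => ya; move: pa; rewrite ya normr0 mulr0 ltxx.
Qed.

Lemma perron_exists d : nat_metric d -> (1 < #|V|)%N -> exists mu x, perron_pair d mu x.
Proof.
move=> dm V1; have [v0 _] : exists v0 : V, v0 \in V by apply/card_gt0P; apply: ltnW.
have ds u v : toR d u v = toR d v u by exact: toR_sym.
have [mu [hmu [y [[v yv] hy]]]] := rayleigh_max v0 ds.
have he : forall u, app (toR d) (fun v => `|y v|) u = mu * `|y u|.
  apply: abs_eigen => //; rewrite /bil -ipZr le_eqVlt; apply/orP; left.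
  by apply/eqP/eq_ip => // u; rewrite hy.
have hp u : 0 < mu * `|y u| by apply: (abs_eigen_pos dm V1 he); exists v.
have mu0 : 0 < mu.
  by have := hp v; rewrite pmulr_lgt0 // normr_gt0.
exists mu, (fun v => `|y v|); split=> // u.
by have := hp u; rewrite pmulr_rgt0.
Qed.

Lemma perron_rhoE E d mu x : (1 < #|V|)%N -> nat_metric d -> (forall u v, dist E u v = d u v) ->
  perron_pair d mu x -> rho R E = mu.
Proof.
move=> V1 dm de [mu0 xp xe xm].
have [v _] : exists v0 : V, v0 \in V by apply/card_gt0P; apply: ltnW.
rewrite /rho -(largest_eigenvalueE _ xm).
- congr largest_eigenvalue; apply/matrixP => i j.
  by rewrite !mxE de.
- by move=> u w; exact: toR_sym.
- by exists x; split=> //; exists v; rewrite gt_eqF.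
Qed.

Lemma perron_ip_gt0 d mu x : (1 < #|V|)%N -> perron_pair d mu x -> 0 < ip x x.
Proof.
move=> V1 [_ xp _ _].
have [v _] : exists v0 : V, v0 \in V by apply/card_gt0P; apply: ltnW.
by apply: (@ip_gt0 _ _ _ v); rewrite gt_eqF.
Qed.

Lemma perron_bil d mu x : perron_pair d mu x -> bil (toR d) x x = mu * ip x x.
Proof. by case=> _ _ xe _; rewrite /bil -ipZr; apply: eq_ip => // u; rewrite xe. Qed.

(** Testing [d'] with [x] gives [mu <= mu']. Equality would make [x] an eigenvector of [d'] for the
    same value, which one coordinate [u] with different images excludes. *)
Lemma perron_lt d d' mu mu' x x' u : (1 < #|V|)%N -> nat_metric d' ->
  perron_pair d mu x -> perron_pair d' mu' x' ->
  bil (toR d) x x <= bil (toR d') x x -> app (toR d') x u != app (toR d) x u -> mu < mu'.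
Proof.
move=> V1 dm' P P' hb hu; have xx := perron_ip_gt0 V1 P.
have hle : mu <= mu'.
  by rewrite -(ler_pM2r xx) -(perron_bil P); apply: le_trans hb _; exact: (perron_max P').
rewrite lt_neqAle hle andbT; apply: contra hu => /eqP e.
have := rayleigh_eq (fun u v => toR_sym u v dm') (perron_max P') (y := x).
rewrite -e -(perron_bil P) => /(_ hb u) ->.
by rewrite (perron_eq P) e.
Qed.

End Perron.

(** * Relocating a set of pendant vertices *)

Section Relocation.
Local Open Scope ring_scope.
Variables (R : realType) (V : finType) (d d' : V -> V -> nat) (F : {set V}) (u w : V).

(* [F] consists of pendant vertices hanging from [u] in [d] and from [w] in [d']. *)
Record relocation : Prop := Relocation {
  reloc_u : u \notin F;
  reloc_w : w \notin F;
  reloc_neq : u != w;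
  reloc_in : forall a b, a \in F -> b \in F -> d' a b = d a b;
  reloc_out : forall a b, a \notin F -> b \notin F -> d' a b = d a b;
  reloc_d : forall a b, a \in F -> b \notin F -> d a b = (d u b).+1;
  reloc_d' : forall a b, a \in F -> b \notin F -> d' a b = (d w b).+1 }.

Hypotheses (rel : relocation) (dm : nat_metric d) (dm' : nat_metric d').
Variables (mu mu' : R) (x x' : V -> R).
Hypotheses (P : perron_pair d mu x) (P' : perron_pair d' mu' x').
Variable f0 : V.
Hypothesis Ff0 : f0 \in F.

Let f (v : V) : R := (v \in F)%:R.
Let h (v : V) : R := (v \notin F)%:R.
Let delta z := toR R d w z - toR R d u z.

Let h1 v : v \notin F -> h v = 1. Proof. by rewrite /h => ->. Qed.
Let h0 v : v \in F -> h v = 0. Proof. by rewrite /h => ->. Qed.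
Let f1 v : v \in F -> f v = 1. Proof. by rewrite /f => ->. Qed.
Let f0_ v : v \notin F -> f v = 0. Proof. by rewrite /f => /negPf->. Qed.
Let ffh v : f v + h v = 1.
Proof. by rewrite /f /h; case: (v \in F); rewrite ?addr0 ?add0r. Qed.
Let V1 : (1 < #|V|)%N.
Proof.
rewrite -cardsT; apply: leq_trans (subset_leq_card (subsetT [set u; w])).
by rewrite cards2 (reloc_neq rel).
Qed.

(** A symmetric perturbation of rank at most two: only pairs with exactly one member in [F] change,
    by an amount depending on the other member alone. *)
Let d'E a b : toR R d' a b = toR R d a b + (f a * (h b * delta b) + f b * (h a * delta a)).
Proof.
have [aF|aF] := boolP (a \in F); have [bF|bF] := boolP (b \in F).
- by rewrite (h0 aF) (h0 bF) !mul0r !mulr0 !addr0 /toR (reloc_in rel).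
- rewrite (f1 aF) (h1 bF) (h0 aF) /toR (reloc_d' rel aF bF) (reloc_d rel aF bF) /delta /toR.
  by rewrite -!natr1; ring.
- rewrite (f1 bF) (h1 aF) (h0 bF) (toR_sym _ a b dm') (toR_sym _ a b dm).
  rewrite /toR (reloc_d' rel bF aF) (reloc_d rel bF aF) /delta /toR.
  by rewrite -!natr1; ring.
- by rewrite (f0_ aF) (f0_ bF) !mul0r !addr0 /toR (reloc_out rel).
Qed.

Let bil_d' y : bil (toR R d') y y = bil (toR R d) y y + 2 * ((\sum_v f v * y v) * \sum_v h v * delta v * y v).
Proof.
have e2 (g1 g2 : V -> R) : \sum_a \sum_b (g1 a * y a * (g2 b * y b)) = (\sum_v g1 v * y v) * \sum_v g2 v * y v.
  by rewrite mulr_suml; apply: eq_bigr => a _; rewrite mulr_sumr.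
have -> : forall a b : R, 2 * (a * b) = a * b + b * a by move=> a b; ring.
rewrite -(e2 f (fun v => h v * delta v)) -(e2 (fun v => h v * delta v) f) !bilE.
rewrite -!big_split /=; apply: eq_bigr => a _.
by rewrite -!big_split /=; apply: eq_bigr => b _; rewrite d'E; ring.
Qed.

Let mass := \sum_v f v * x v.

Let mass_gt0 : 0 < mass.
Proof.
rewrite /mass (bigD1 f0) //= f1 // mul1r; apply: ltr_pwDl; first exact: (perron_pos P).
by apply: sumr_ge0 => v _; apply: mulr_ge0; rewrite ?ler0n // ltW // (perron_pos P).
Qed.

Let duw : 0 < toR R d w u.
Proof. by apply: toR_gt0 => //; rewrite eq_sym (reloc_neq rel). Qed.

Let duu a : toR R d a a = 0.
Proof. by case: dm => _ /(_ a a); rewrite eqxx /toR => /eqP->. Qed.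

Lemma relocation_lt :
  0 <= \sum_(z | z \notin F) x z * ((d w z)%:R - (d u z)%:R) -> mu < mu'.
Proof.
move=> hs; apply: (perron_lt (u := u) V1 dm' P P').
  rewrite bil_d' lerDl; apply: mulr_ge0 => //; apply: mulr_ge0; first exact: ltW.
  rewrite big_mkcond /= in hs; apply: le_trans hs _; apply: ler_sum => v _.
  by rewrite /h /delta; case: (v \in F); rewrite ?mul0r //= mul1r mulrC.
(* Strictness is seen in row [u]: there the matrices differ exactly on [F], by the distance from [w]
   to [u]. *)
rewrite -subr_eq0 /app -sumrB.
have -> : \sum_v (toR R d' u v * x v - toR R d u v * x v) = toR R d w u * mass.
  rewrite /mass mulr_sumr; apply: eq_bigr => v _; rewrite d'E.
  rewrite (f0_ (reloc_u rel)) (h1 (reloc_u rel)) {2}/delta duu; ring.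
by apply: mulf_neq0; rewrite gt_eqF.
Qed.

(** The distance from [z] outside [F] to a vertex of [F] when [F] hangs from [a]. *)
Let r a z : R := 1 + toR R d a z.

(** A maximiser has no zero coordinate, but [n] vanishes on the nonempty set [F]. This yields both
    the solvability of the resolvent equation and the sign of its solution. *)
Let neg_zero (n : V -> R) : (forall v, v \in F -> n v = 0) -> mu * ip n n <= bil (toR R d) n n ->
  forall v, n v = 0.
Proof.
move=> nF hn v; apply/eqP/negPn/negP => nv.
have he := abs_eigen dm (perron_max P) hn.
have := abs_eigen_pos dm V1 he (ex_intro _ v nv) f0.
by rewrite nF // normr0 mulr0 ltxx.
Qed.

(** The factors [h] restrict [d] to the complement of [F]; a kernel vector of [M] would vanish on
    [F] and yet attain the maximum [mu]. *)
Let solve : exists y2 : V -> R, forall z,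
  mu * y2 z = h z * app (toR R d) (fun v => h v * y2 v) z + mass * (h z * r w z).
Proof.
pose M a b := mu * kron R a b - h a * h b * toR R d a b.
have MA y z : app M y z = mu * y z - h z * app (toR R d) (fun v => h v * y v) z.
  rewrite /M app_shift; congr (_ - _); rewrite /app mulr_sumr; apply: eq_bigr => b _; ring.
case: (kernel_or_inverse M) => [[y [[v yv] hy]]|[N hN]]; last first.
  exists (app N (fun z => mass * (h z * r w z))) => z.
  have := hN (fun z => mass * (h z * r w z)) z.
  rewrite MA => <-; ring.
have hy' z : mu * y z = h z * app (toR R d) (fun v => h v * y v) z.
  by apply/eqP; rewrite -subr_eq0 -MA hy.
have mu0 : mu != 0 by rewrite gt_eqF // (perron_gt0 P).
have yF z : z \in F -> y z = 0.
  by move=> zF; apply: (mulfI mu0); rewrite hy' h0 // mul0r mulr0.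
have hyy z : h z * y z = y z.
  by have [zF|zF] := boolP (z \in F); rewrite ?(h1 zF) ?mul1r // yF ?mulr0.
suff : y v = 0 by move/eqP; rewrite (negPf yv).
apply: neg_zero => //.
rewrite /bil -ipZr le_eqVlt; apply/orP; left; apply/eqP; apply: eq_bigr => z _.
rewrite hy' mulrA [y z * h z]mulrC hyy; congr (_ * _).
by apply: eq_bigr => a _; rewrite hyy.
Qed.

(* The test vector for [d'] solves [(mu - D) y2 = mass * r_w] off [F]. Its
   Rayleigh excess over [mu] is, up to a positive factor, the difference of
   [y] at [w] and at [u], where [y] is the potential created by placing the
   mass of [F] at both [u] and [w]. *)
Lemma relocation_resolvent_lt :
  (forall y b, 0 < b -> (forall z, z \in F -> y z = 0) -> (forall z, z \notin F -> 0 < y z) ->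
    (forall z, z \notin F ->
       mu * y z = \sum_v (d z v)%:R * y v + b * (2 + (d u z)%:R + (d w z)%:R)) ->
    y u < y w) ->
  mu < mu'.
Proof.
move=> hyp; have [y2 hy2] := solve; have mu0 := perron_gt0 P.
have mun0 : mu != 0 by rewrite gt_eqF.
have y2F z : z \in F -> y2 z = 0.
  by move=> zF; apply: (mulfI mun0); rewrite hy2 h0 // !mul0r !mulr0 addr0.
have hyy z : h z * y2 z = y2 z.
  by have [zF|zF] := boolP (z \in F); rewrite ?(h1 zF) ?mul1r // y2F ?mulr0.
have {}hy2 z : mu * y2 z = h z * app (toR R d) y2 z + mass * (h z * r w z).
  by rewrite hy2; congr (_ * _ + _); apply: eq_bigr => a _; rewrite hyy.
have r_gt0 a z : 0 < r a z by apply: ltr_pwDl => //; exact: ler0n.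
have ip_y2 (g : V -> R) : ip y2 (fun z => h z * g z) = ip y2 g.
  by apply: eq_bigr => z _; rewrite mulrA [y2 z * h z]mulrC hyy.
(* Pair the equation with the negative part [n] of [y2]: the terms with the positive part and with
   [r w] are nonnegative, so the form at [n] is at least [mu * ip n n]. *)
have y2ge z : 0 <= y2 z.
  pose n z := Num.max (- y2 z) 0; pose q z := Num.max (y2 z) 0.
  have y2E v : y2 v = q v + -1 * n v.
    rewrite /q /n; case: (leP (y2 v) 0) => e1; case: (leP (- y2 v) 0) => e2; lra.
  have n0 v : 0 <= n v by rewrite /n le_max lexx orbT.
  have q0 v : 0 <= q v by rewrite /q le_max lexx orbT.
  have nq v : n v * q v = 0.
    by rewrite /q /n; case: (leP (y2 v) 0) => e1; case: (leP (- y2 v) 0) => e2; nra.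
  have nF v : v \in F -> n v = 0 by move=> vF; rewrite /n y2F // oppr0 maxxx.
  suff nz : n z = 0 by rewrite y2E nz mulr0 addr0.
  apply: (neg_zero nF).
  have e1 : mu * ip n y2 = bil (toR R d) n y2 + mass * ip n (r w).
    rewrite -!ipZr -ipDr; apply: eq_bigr => v _; rewrite hy2.
    have [vF|vF] := boolP (v \in F); first by rewrite nF // !mul0r.
    by rewrite h1 // !mul1r.
  have e2 : ip n y2 = - ip n n.
    rewrite (eq_ip (frefl n) y2E) ipDr ipZr mulN1r.
    by rewrite {1}/ip big1 ?add0r.
  have e3 : bil (toR R d) n y2 = bil (toR R d) n q - bil (toR R d) n n.
    rewrite -mulN1r -bilZr -bilDr; apply: eq_ip => // v.
    by apply: eq_bigr => a _; rewrite y2E.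
  have e4 : 0 <= bil (toR R d) n q.
    rewrite bilE; apply: sumr_ge0 => a _; apply: sumr_ge0 => b _.
    by rewrite mulr_ge0 ?ler0n // mulr_ge0.
  have e5 : 0 <= mass * ip n (r w).
    apply: mulr_ge0; first exact: ltW.
    by apply: sumr_ge0 => a _; rewrite mulr_ge0 // ltW.
  move: e1; rewrite e2 e3; lra.
have y2gt z : z \notin F -> 0 < y2 z.
  move=> zF; rewrite -(pmulr_rgt0 _ mu0) hy2 h1 // !mul1r.
  apply: ltr_wpDl; last by rewrite mulr_gt0.
  by apply: sumr_ge0 => a _; rewrite mulr_ge0 ?ler0n.
(* Off [F] the Perron vector solves the same equation with source [r u] instead of [r w]; hence [y]
   is the potential of both sources together. *)
pose x0 v := h v * x v; pose fx v := f v * x v; pose y v := x0 v + y2 v.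
have x0F z : z \in F -> x0 z = 0 by move=> zF; rewrite /x0 h0 // mul0r.
have xE v : x v = fx v + x0 v by rewrite /fx /x0 -mulrDl ffh mul1r.
have app_fx z : z \notin F -> app (toR R d) fx z = mass * r u z.
  move=> zF; rewrite /app /mass mulr_suml; apply: eq_bigr => v _; rewrite /fx.
  have [vF|vF] := boolP (v \in F); last by rewrite (f0_ vF) !(mul0r, mulr0).
  rewrite (toR_sym _ z v dm) /toR (reloc_d rel vF zF) /r /toR -natr1; ring.
have hx0 z : z \notin F -> mu * x0 z = app (toR R d) x0 z + mass * r u z.
  move=> zF; rewrite -(app_fx _ zF) /x0 h1 // mul1r -(perron_eq P).
  rewrite addrC -[RHS]appD; by apply: eq_bigr => v _; rewrite -xE.
have ip_fx (g : V -> R) : (forall v, v \in F -> g v = 0) -> ip fx g = 0.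
  move=> gF; rewrite /ip big1 // => v _; rewrite /fx.
  have [vF|vF] := boolP (v \in F); first by rewrite gF ?mulr0.
  by rewrite (f0_ vF) !mul0r.
have bil_fx (g : V -> R) : (forall v, v \in F -> g v = 0) ->
    bil (toR R d) fx g = mass * ip (r u) g.
  move=> gF; rewrite bil_sym; last by move=> a b; exact: toR_sym.
  rewrite /bil ipC -ipZl; apply: eq_bigr => v _.
  have [vF|vF] := boolP (v \in F); first by rewrite gF ?mulr0.
  by rewrite app_fx.
have b22 : bil (toR R d) y2 y2 = mu * ip y2 y2 - mass * ip (r w) y2.
  apply/eqP; rewrite eq_sym subr_eq; apply/eqP; rewrite [ip (r w) _]ipC -!ipZr.
  rewrite /bil -ipDr; apply: eq_bigr => v _.
  have [vF|vF] := boolP (v \in F); first by rewrite y2F // !mul0r.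
  by rewrite hy2 h1 // !mul1r.
have bxx : bil (toR R d) fx fx = mu * ip fx fx - mass * ip (r u) x0.
  have e1 : bil (toR R d) fx x = mu * ip fx x by rewrite -(ipZr fx); apply: eq_ip => // v; rewrite (perron_eq P).
  have e2 : bil (toR R d) fx x = bil (toR R d) fx fx + mass * ip (r u) x0.
    rewrite -bil_fx // -bilDr; apply: eq_ip => // v.
    by apply: eq_bigr => a _; rewrite -xE.
  have e3 : ip fx x = ip fx fx.
    by rewrite (eq_ip (frefl fx) xE) ipDr [ip fx x0]ip_fx // addr0.
  by rewrite -e3 -e1 e2 addrK.
(* Reciprocity: the resolvent is symmetric, so source and observer may be exchanged. *)
have cross : ip (r w) x0 = ip (r u) y2.
  have e1 : mu * ip x0 y2 = bil (toR R d) x0 y2 + mass * ip (r w) x0.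
    rewrite [ip (r w) _]ipC -!ipZr -ipDr; apply: eq_bigr => v _; rewrite hy2.
    have [vF|vF] := boolP (v \in F); first by rewrite x0F // !mul0r.
    by rewrite h1 // !mul1r.
  have e2 : mu * ip y2 x0 = bil (toR R d) y2 x0 + mass * ip (r u) y2.
    rewrite [ip (r u) _]ipC -!ipZr -ipDr; apply: eq_bigr => v _.
    have [vF|vF] := boolP (v \in F); first by rewrite y2F // !mul0r.
    by rewrite hx0.
  apply: (mulfI (x := mass)); first by rewrite gt_eqF.
  move: e1 e2; rewrite (ipC y2) (bil_sym y2 x0) => [-> /addrI //|a b].
  exact: toR_sym.
have hyeq z : z \notin F -> mu * y z = app (toR R d) y z + mass * (r u z + r w z).
  move=> zF; rewrite /y mulrDr hx0 // hy2 h1 // !mul1r appD; ring.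
have yF z : z \in F -> y z = 0 by move=> zF; rewrite /y x0F // y2F // addr0.
have yuw : y u < y w.
  apply: (hyp y mass) => // z zF.
    rewrite /y; apply: ltr_wpDl; last exact: y2gt.
    by rewrite /x0 h1 // mul1r ltW // (perron_pos P).
  rewrite hyeq // /app /r /toR; congr (_ + _ * _); ring.
(* In the equations for [y] at [w] and at [u] the source terms agree because [d] is symmetric, and
   [cross] cancels the mixed products. *)
have dif : mu * (y w - y u) = ip (r w) y2 - ip (r u) x0.
  have e1 : app (toR R d) y w + ip (fun=> 1) y = ip (r w) y.
    by rewrite addrC -ipDl.
  have e2 : app (toR R d) y u + ip (fun=> 1) y = ip (r u) y.
    by rewrite addrC -ipDl.
  have e3 : ip (r w) y = ip (r w) x0 + ip (r w) y2 by rewrite -ipDr.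
  have e4 : ip (r u) y = ip (r u) x0 + ip (r u) y2 by rewrite -ipDr.
  rewrite mulrBr !hyeq ?(reloc_u rel) ?(reloc_w rel) // /r !duu (toR_sym _ u w dm) -/(r _ _).
  move: e1 e2; rewrite e3 e4 cross => e1 e2.
  have -> : ip (r w) y2 = app (toR R d) y w + ip (fun=> 1) y - ip (r u) y2 by rewrite e1 addrC addKr.
  have -> : ip (r u) x0 = app (toR R d) y u + ip (fun=> 1) y - ip (r u) y2 by rewrite e2 addrK.
  ring.
(* Keeping the Perron values on [F] keeps its mass; the excess of the form of [d'] over
   [mu * ip Y Y] then collapses to [mass * mu] times [y w - y u]. *)
pose Y v := y2 v + fx v.
have ipY : ip Y Y = ip y2 y2 + ip fx fx.
  rewrite /Y ipDl !ipDr [ip fx y2]ip_fx // [ip y2 fx]ipC ip_fx //; ring.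
have bilY : bil (toR R d) Y Y = bil (toR R d) y2 y2 + 2 * (mass * ip (r u) y2) + bil (toR R d) fx fx.
  rewrite /Y bilDl !bilDr (bil_sym y2 fx); last by move=> a b; exact: toR_sym.
  rewrite bil_fx //; ring.
have mY : \sum_v f v * Y v = mass.
  apply: eq_bigr => v _; rewrite /Y /fx.
  by have [vF|vF] := boolP (v \in F); rewrite ?(f0_ vF) ?(f1 vF) ?(y2F _ vF); ring.
have dY : \sum_v h v * delta v * Y v = ip (r w) y2 - ip (r u) y2.
  rewrite -mulN1r -ipZl -ipDl; apply: eq_bigr => v _; rewrite /Y /fx /r /delta.
  by have [vF|vF] := boolP (v \in F); rewrite ?(f0_ vF) ?(h0 vF) ?(h1 vF) ?(y2F _ vF); ring.
have pY : 0 < ip Y Y.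
  apply: (@ip_gt0 _ _ _ u); rewrite /Y /fx (f0_ (reloc_u rel)) mul0r addr0 gt_eqF //.
  by rewrite y2gt // (reloc_u rel).
rewrite -(ltr_pM2r pY); apply: lt_le_trans (perron_max P' Y).
have : 0 < mass * (mu * (y w - y u)) by rewrite !mulr_gt0 // subr_gt0.
rewrite dif bil_d' mY dY bilY b22 bxx ipY; lra.
Qed.

End Relocation.

(** * Distances and isomorphisms of hypergraphs *)

Section Dist.
Variable V : finType.
Implicit Types (E : {set {set V}}) (u v : V).

Lemma bigmin_le (I : eqType) (r : seq I) (P : pred I) (F : I -> nat) n i :
  i \in r -> P i -> \big[minn/n]_(j <- r | P j) F j <= F i.
Proof.
elim: r => // a r IH; rewrite inE big_cons => /orP[/eqP<- ->|ir Pi].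
  exact: geq_minl.
by case: (P a); [apply: leq_trans (geq_minr _ _) _|]; exact: IH.
Qed.

Lemma path_size_lt E u v vs es : is_path E u v vs es -> size es < #|V|.
Proof.
case/and5P => /eqP s _ _ _ /and3P[vsu _ _].
by rewrite -s -(card_uniqP vsu) max_card.
Qed.

Lemma has_path_lenP E u v p :
  reflect (exists vs es, is_path E u v vs es /\ size es = p) (has_path_len E u v p).
Proof.
apply: (iffP existsP) => [[vs /existsP[es h]]|[vs [es [h s]]]].
  by exists vs, es; rewrite size_tuple.
have sv : size vs == p.+1 by case/andP: h => /eqP-> _; rewrite s.
exists (Tuple sv); apply/existsP; move/eqP: s => s; by exists (Tuple s).
Qed.

(** The default [#|V|] of the minimum is harmless: the vertices of a path are distinct, so its
    length is below [#|V|]. *)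
Lemma dist_eq E u v p :
  (exists vs es, is_path E u v vs es /\ size es = p) ->
  (forall vs es, is_path E u v vs es -> p <= size es) -> dist E u v = p.
Proof.
move=> [vs [es [h s]]] low; have lt := path_size_lt h; apply/eqP; rewrite eqn_leq.
rewrite s in lt; apply/andP; split.
  apply: (@bigmin_le _ _ _ (fun q : 'I__ => q : nat) _ (Ordinal lt)).
    by rewrite mem_index_enum.
  by apply/has_path_lenP; exists vs, es.
apply: (big_ind (fun q => p <= q)) => [|a b pa pb|i].
- exact: ltnW.
- by rewrite leq_min pa pb.
- by case/has_path_lenP => vs' [es' [h' <-]]; exact: low h'.
Qed.

Lemma path_nil E u : is_path E u u [:: u] [::].
Proof. by rewrite /is_path /= !eqxx. Qed.

Lemma path_cons E u u' v vs es e : is_path E u' v vs es ->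
  e \in E -> u \in e -> u' \in e -> u \notin vs -> e \notin es ->
  is_path E u v (u :: vs) (e :: es).
Proof.
case/and5P => /eqP s /eqP n0 /eqP l al /and3P[vsu esu /allP st] eE ue u'e uvs ees.
have u'vs : u' \in vs by rewrite -n0 mem_nth // s.
rewrite /is_path /= s !eqxx eE al uvs vsu ees esu /=.
case: vs s l n0 u'vs uvs {vsu} st => //= a vs [s] l n0 u'vs uvs st.
rewrite l eqxx n0 ue u'e /=; subst a; apply/andP; split.
  by apply: contra uvs => /eqP->; rewrite inE eqxx.
apply/allP => i; rewrite mem_iota => /andP[i1 i2]; case: i i1 i2 => // i _ i2.
have ilt : i < size es by lia.
have := st i; rewrite mem_iota /= => /(_ ilt).
rewrite [nth u (u' :: vs) i](set_nth_default u') /=; last by rewrite s; lia.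
by rewrite [nth u vs i](set_nth_default u') // s.
Qed.

Lemma path_rcons E u v v' vs es e : is_path E u v' vs es ->
  e \in E -> v \in e -> v' \in e -> v \notin vs -> e \notin es ->
  is_path E u v (rcons vs v) (rcons es e).
Proof.
case/and5P => /eqP s /eqP n0 /eqP l al /and3P[vsu esu /allP st] eE ve v'e vvs ees.
rewrite /is_path !size_rcons s eqxx last_rcons eqxx all_rcons eE al !rcons_uniq.
rewrite vvs vsu ees esu nth_rcons s n0 !eqxx !andTb.
apply/allP => i; rewrite mem_iota add0n => /andP[_]; rewrite ltnS leq_eqVlt => /orP[/eqP->|ilt].
  rewrite !nth_rcons s ltnSn eqxx !ltnn.
  have -> : nth u vs (size es) = v' by rewrite -l -nth_last s; apply: set_nth_default; rewrite s.
  rewrite eqxx v'e ve; apply: contra vvs => /eqP <-.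
  by rewrite -l; case: (vs) s => // a w _; rewrite [last _ _]/= mem_last.
rewrite !nth_rcons s ltnS (ltnW ilt) ltnS ilt.
by apply: st; rewrite mem_iota.
Qed.

(** A function changing by at most one along each edge bounds path lengths from below; taken as the
    candidate distance to a fixed vertex it yields the lower bound for [dist]. *)
Lemma path_step E u v vs es (f : V -> nat) : is_path E u v vs es ->
  (forall e a b, e \in E -> a \in e -> b \in e -> f a <= (f b).+1) ->
  f v <= f u + size es.
Proof.
case/and5P => /eqP s /eqP n0 /eqP l /allP al /and3P[_ _ /allP st] lip.
have h i : i <= size es -> f (nth u vs i) <= f u + i.
  elim: i => [|i IH] hi; first by rewrite n0 addn0.
  have := st i; rewrite mem_iota => /(_ hi) /and3P[a b _].
  apply: leq_trans (lip _ _ _ _ b a) _; first by apply: al; rewrite mem_nth.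
  by rewrite addnS ltnS IH // ltnW.
by rewrite -l -nth_last s; exact: h.
Qed.

End Dist.

Section Hiso.
Variables (V W : finType).

Lemma hiso_path (f : V -> W) (E : {set {set V}}) (F : {set {set W}}) u v vs es :
  injective f -> [set f @: e | e : {set V} in E] = F ->
  is_path E u v vs es -> is_path F (f u) (f v) (map f vs) (map (fun e : {set V} => f @: e) es).
Proof.
move=> fi <- /and5P[/eqP s /eqP n0 /eqP l /allP al /and3P[vsu esu /allP st]].
have si : injective (fun e : {set V} => f @: e) by exact: imset_inj.
rewrite /is_path !size_map s eqxx last_map l eqxx (map_inj_uniq fi) vsu (map_inj_uniq si) esu.
rewrite (nth_map u) ?s // n0 eqxx /=; apply/andP; split.
  by apply/allP => _ /mapP[e ee ->]; apply: imset_f; exact: al.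
apply/allP => i iin; have := st i iin; move: iin; rewrite mem_iota add0n => /andP[_ ilt].
rewrite !(nth_map u) ?s // 1?ltnW // (nth_map set0) // !(mem_imset _ _ fi).
by rewrite (inj_eq fi).
Qed.

End Hiso.

Section HisoInvariants.
Variables (V W : finType).

Lemma hiso_dist (f : V -> W) (g : W -> V) (E : {set {set V}}) (F : {set {set W}}) u v :
  cancel f g -> cancel g f -> [set f @: e | e : {set V} in E] = F ->
  dist F (f u) (f v) = dist E u v.
Proof.
move=> fK gK EF.
have c := esym (bij_eq_card (Bijective fK gK)).
have GE : [set g @: e | e : {set W} in F] = E.
  rewrite -EF -imset_comp -[RHS]imset_id; apply: eq_imset => e /=.
  by rewrite -imset_comp -[RHS]imset_id; apply: eq_imset => x /=; rewrite fK.
rewrite /dist c; apply: eq_bigl => p; apply/has_path_lenP/has_path_lenP => -[vs [es [h s]]].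
  have := hiso_path (can_inj gK) GE h; rewrite !fK => h'.
  by do 2!eexists; split; first exact: h'; rewrite size_map.
have h' := hiso_path (can_inj fK) EF h.
by do 2!eexists; split; first exact: h'; rewrite size_map.
Qed.

Lemma hiso_deg (f : V -> W) (E : {set {set V}}) (F : {set {set W}}) v :
  injective f -> [set f @: e | e : {set V} in E] = F -> deg F (f v) = deg E v.
Proof.
move=> fi <-; rewrite /deg.
have si : injective (fun e : {set V} => f @: e) by exact: imset_inj.
rewrite -(card_imset _ si); apply: eq_card => e; rewrite !inE.
apply/andP/imsetP => [[/imsetP[a aE ->]]|[a]].
  by rewrite (mem_imset _ _ fi) => va; exists a; rewrite // inE aE.
by rewrite inE => /andP[aE va] ->; rewrite imset_f // mem_imset.
Qed.

End HisoInvariants.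

Lemma hiso_refl (V : finType) (E : {set {set V}}) : hiso E E.
Proof.
exists id; split; first by exists id.
rewrite -[RHS]imset_id; apply: eq_imset => e; exact: imset_id.
Qed.

Lemma hiso_sym (V W : finType) (E : {set {set V}}) (F : {set {set W}}) : hiso E F -> hiso F E.
Proof.
move=> [f [[g fK gK] <-]]; exists g; split; first by exists f.
rewrite -imset_comp -[RHS]imset_id; apply: eq_imset => e /=.
by rewrite -imset_comp -[RHS]imset_id; apply: eq_imset => x /=; rewrite fK.
Qed.

Lemma hiso_trans (V W X : finType) (E : {set {set V}}) (F : {set {set W}}) (G : {set {set X}}) :
  hiso E F -> hiso F G -> hiso E G.
Proof.
move=> [f [fb <-]] [g [gb <-]]; exists (g \o f); split; first exact: bij_comp.
rewrite -imset_comp; apply: eq_imset => e /=.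
by rewrite -imset_comp.
Qed.

(** For [n > 0] this amounts to [maxdeg E = Delta] with [n] vertices attaining it, in a form that is
    checked vertex by vertex. *)
Definition deg_profile (V : finType) (E : {set {set V}}) (Delta n : nat) : Prop :=
  (forall v, deg E v <= Delta) /\ #|[set v : V | deg E v == Delta]| = n.

Lemma hiso_deg_profile (V W : finType) (E : {set {set V}}) (F : {set {set W}}) Delta n :
  hiso E F -> deg_profile E Delta n -> deg_profile F Delta n.
Proof.
move=> [f [[g fK gK] EF]] [h1 h2]; have fi := can_inj fK; split=> [w|].
  by rewrite -(gK w) (hiso_deg _ fi EF).
rewrite -h2 -(card_imset _ fi); apply: eq_card => w; rewrite !inE.
rewrite -{2}(gK w) mem_imset // inE -(hiso_deg _ fi EF) gK //.
Qed.

(** A Perron pair is carried along the bijection, which avoids a permutation similarity between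
    matrices indexed by two unrelated enumerations. *)
Lemma rho_hiso (R : realType) (V W : finType) (E : {set {set V}}) (F : {set {set W}}) :
  1 < #|V| -> nat_metric (dist E) -> hiso E F -> rho R E = rho R F.
Proof.
move=> V1 dm [f [[g fK gK] EF]].
have dE w w' : dist F w w' = dist E (g w) (g w').
  by rewrite -{1}(gK w) -{1}(gK w') (hiso_dist _ _ fK gK EF).
have c := esym (bij_eq_card (Bijective fK gK)).
have [mu [x P]] := perron_exists R dm V1.
have gsum (h : V -> R) : (\sum_(w : W) h (g w) = \sum_v h v)%R.
  by rewrite [RHS](reindex g) //; exists f => y _; rewrite ?gK ?fK.
have fsum (h : W -> R) : (\sum_(w : W) h w = \sum_v h (f v))%R.
  by rewrite (reindex f) //; exists g => y _; rewrite ?gK ?fK.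
rewrite (perron_rhoE V1 dm (fun _ _ => erefl) P); symmetry.
apply: (@perron_rhoE _ _ _ (dist F) _ (x \o g)); rewrite ?c //.
- case: dm => d1 d2; split=> u v; rewrite !dE //.
  by rewrite d2; apply: inj_eq; exact: can_inj gK.
- case: P => mu0 xp xe xm; split=> //.
  + by move=> w; exact: xp.
  + by move=> u; apply: etrans (xe (g u)); rewrite /app -(gsum (fun v => toR R (dist E) (g u) v * x v)%R); apply: eq_bigr => w _; rewrite /toR dE.
  + move=> y; have := xm (y \o f).
    rewrite /bil /ip !fsum /=; congr (_ <= _)%R; apply: eq_bigr => v _; congr (_ * _)%R.
    by rewrite /app fsum; apply: eq_bigr => w _; rewrite /toR dE !fK.
Qed.

(** * Hypertrees given by attachment points *)

Section Tree.
Variables (K m : nat) (par : nat -> nat).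

(* The vertices are 0..mK; edge [i] consists of the block [iK+1..(i+1)K]
   of new vertices and of the older vertex [par i]. *)
Definition in_block (i x : nat) : bool := i * K < x <= i.+1 * K.

Definition edge_mem (i x : nat) : bool := (x == par i) || in_block i x.

Definition tree_edge (i : nat) : {set 'I_(m * K).+1} := [set x : 'I__ | edge_mem i x].

Definition tree : {set {set 'I_(m * K).+1}} := [set tree_edge i | i : 'I_m].

Definition par_ok := forall i, i < m -> par i <= i * K.

Hypotheses (K0 : 0 < K) (pok : par_ok).

Local Notation N := (m * K).+1.

Lemma blockP (x : nat) : 0 < x -> in_block (x.-1 %/ K) x.
Proof.
move=> x0; rewrite /in_block -[X in _ < X](prednK x0) ltnS leq_divM /=.
by have := ltn_ceil x.-1 K0; rewrite prednK.
Qed.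

Lemma in_block_eq i x : in_block i x -> x.-1 %/ K = i.
Proof.
rewrite /in_block => /andP[a b]; apply/eqP; rewrite eqn_leq -ltnS ltn_divLR // leq_divRL //.
by apply/andP; split; lia.
Qed.

Lemma in_block_lt i x : in_block i x -> x <= m * K -> i < m.
Proof.
rewrite /in_block => /andP[a b] c; rewrite -(ltn_pmul2r K0); exact: leq_trans a c.
Qed.

Lemma leq_blocks i j : i <= j -> i * K <= j * K.
Proof. by move=> ij; rewrite leq_mul2r ij orbT. Qed.

Lemma edge_le i x : i < m -> edge_mem i x -> x <= i.+1 * K.
Proof.
move=> im /orP[/eqP->|/andP[]//]; apply: leq_trans (pok im) _; exact: leq_blocks.
Qed.

Lemma tree_edge_in i : i < m -> tree_edge i \in tree.
Proof. by move=> im; apply/imsetP; exists (Ordinal im). Qed.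

Lemma tree_edge_neq i j : i < j -> j < m -> tree_edge i != tree_edge j.
Proof.
move=> ij jm; apply/eqP => /setP e.
have jN : j.+1 * K < N by rewrite ltnS; exact: leq_blocks.
have := e (Ordinal jN); rewrite !inE /=.
have -> : edge_mem j (j.+1 * K).
  by rewrite /edge_mem /in_block leqnn ltn_pmul2r // ltnSn orbT.
move=> h; have := @edge_le i _ (ltn_trans ij jm) h.
by rewrite leq_pmul2r // ltnS leqNgt ij.
Qed.

Lemma tree_edge_inj (i j : nat) : i < m -> j < m -> tree_edge i = tree_edge j -> i = j.
Proof.
move=> im jm e; case: (ltngtP i j) => // h.
  by have := tree_edge_neq h jm; rewrite e eqxx.
by have := tree_edge_neq h im; rewrite e eqxx.
Qed.

Lemma card_tree : #|tree| = m.
Proof.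
rewrite card_imset ?card_ord // => i j e; apply: val_inj; exact: tree_edge_inj e.
Qed.

Lemma card_tree_edge i : i < m -> #|tree_edge i| = K.+1.
Proof.
move=> im; have pN : par i < N by rewrite ltnS (leq_trans (pok im)) // leq_blocks // ltnW.
pose b (j : 'I_K) : 'I_N := inord ((i * K).+1 + j).
have bE j : b j = (i * K).+1 + j :> nat.
  rewrite inordK // ltnS addSn -addnS; apply: leq_trans (leq_blocks im).
  by rewrite mulSn addnC leq_add2r.
clearbody b.
have -> : tree_edge i = Ordinal pN |: [set b j | j : 'I_K].
  apply/setP => x; rewrite !inE /edge_mem; congr (_ || _).
  apply/andP/imsetP => [[h1 h2]|[j _ ->]]; last first.
    by rewrite bE; have := ltn_ord j; split; lia.
  have hj : x - (i * K).+1 < K by move: h2; rewrite mulSn; lia.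
  by exists (Ordinal hj) => //; apply: val_inj; rewrite /= bE /=; lia.
rewrite cardsU1 card_imset ?card_ord; last first.
  by move=> j j' /(congr1 val); rewrite /= !bE => /addnI/val_inj.
suff -> : Ordinal pN \notin [set b j | j : 'I_K] by [].
apply/imsetP => -[j _ /(congr1 val)]; rewrite /= bE => e.
by have := pok im; rewrite e addSn; lia.
Qed.

Lemma deg_tree (x : 'I_N) : deg tree x = (0 < x) + count (fun i => par i == x) (iota 0 m).
Proof.
have -> : deg tree x = \sum_(i < m) (edge_mem i x).
  have -> : deg tree x = #|[set tree_edge i | i : 'I_m in [pred i : 'I_m | edge_mem i x]]|.
    apply: eq_card => e; rewrite !inE; apply/andP/imsetP => [[/imsetP[i _ ->]]|[i ix ->]].
      by rewrite inE => ix; exists i.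
    by rewrite tree_edge_in // inE.
  rewrite card_imset => [|i j e]; last by apply: val_inj; exact: tree_edge_inj e.
  by rewrite -sum1_card big_mkcond; apply: eq_bigr => i _; rewrite inE; case: edge_mem.
have -> : \sum_(i < m) edge_mem i x = \sum_(i < m) (in_block i x + (par i == x)).
  apply: eq_bigr => i _; rewrite /edge_mem eq_sym /in_block; case: eqP => [e|_] /=.
    by rewrite -e ltnNge (pok (ltn_ord i)).
  by rewrite addn0.
rewrite big_split /=; congr (_ + _).
  case: (posnP x) => [->|x0]; first by rewrite big1.
  have bx := blockP x0; have lt := in_block_lt bx (ltn_ord x).
  rewrite (bigD1 (Ordinal lt)) //= bx big1 ?addn0 // => i ne.
  apply/eqP; rewrite eqb0; apply: contra ne => /in_block_eq e.
  by apply/eqP/val_inj; rewrite /= e.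
by rewrite -sum1_count -(big_mkord predT (fun i => nat_of_bool (par i == x))) /index_iota subn0 -big_mkcond.
Qed.

(** These rules determine [d] block by block: a new vertex reaches every older one through the
    attachment point of its block. They can be checked on a closed formula without any talk of
    shortest paths. *)
Record tree_metric (d : nat -> nat -> nat) : Prop := TreeMetric {
  tm_sym : forall x y, d x y = d y x;
  tm_diag : forall x, d x x = 0;
  tm_block : forall i x y, i < m -> in_block i x -> in_block i y -> x != y -> d x y = 1;
  tm_rec : forall i x y, i < m -> in_block i x -> y <= i * K -> d x y = (d (par i) y).+1 }.

Variable d : nat -> nat -> nat.
Hypothesis dm : tree_metric d.

(** A vertex [w] younger than edge [i] is reached through the attachment point of its own block at
    the same cost from [u] and [v], so induction on [w] leaves only the vertices no younger than the
    edge. *)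
Let lip i u v w : i < m -> edge_mem i u -> edge_mem i v -> w <= m * K -> d u w <= (d v w).+1.
Proof.
move=> im ui vi; elim/ltn_ind: w => w IH wN.
have [wi|wi] := leqP w (i * K).
  have e a : edge_mem i a -> d (par i) w <= d a w <= (d (par i) w).+1.
    case/orP => [/eqP->|ai]; first by rewrite leqnn leqnSn.
    by rewrite (tm_rec dm im ai wi) leqnSn leqnn.
  have /andP[_ h1] := e _ ui; have /andP[h2 _] := e _ vi.
  by apply: leq_trans h1 _; rewrite ltnS.
have w0 : 0 < w by apply: leq_ltn_trans wi.
have bw := blockP w0; set j := w.-1 %/ K in bw.
have jm := in_block_lt bw wN.
have [wi2|wi2] := leqP w (i.+1 * K).
  suff : d u w <= 1 by move=> h; apply: leq_trans h _.
  have bi : in_block i w by rewrite /in_block wi.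
  case/orP: ui => [/eqP->|ui].
    by rewrite (tm_sym dm) (tm_rec dm im bi (pok im)) (tm_diag dm).
  by have [->|uw] := eqVneq u w; [rewrite (tm_diag dm) | rewrite (tm_block dm im ui bi)].
have ij : i.+1 * K <= j * K.
  apply: leq_blocks; rewrite -ltnS -(ltn_pmul2r K0); apply: leq_trans wi2 _.
  by case/andP: bw.
have f a : edge_mem i a -> d a w = (d a (par j)).+1.
  move=> ai; rewrite (tm_sym dm) (tm_rec dm jm bw) ?[d _ a](tm_sym dm) //.
  exact: leq_trans (edge_le im ai) ij.
rewrite !f // ltnS; apply: IH.
  by apply: leq_ltn_trans (pok jm) _; case/andP: bw.
by apply: leq_trans (pok jm) _; apply: leq_blocks; exact: ltnW.
Qed.

(** The last two clauses confine the path to the first [b] blocks, so that a vertex or edge of the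
    next block is new and no repetition can arise. *)
Let path_exists b : b <= m -> forall x y : 'I_N, x <= b * K -> y <= b * K ->
  exists vs es, [/\ is_path tree x y vs es, size es = d x y,
    forall v, v \in vs -> v <= b * K & forall e, e \in es -> exists2 j, j < b & e = tree_edge j].
Proof.
elim: b => [|b IH] bm x y xb yb.
  have exy : x = y by apply: val_inj; move: xb yb; rewrite mul0n !leqn0 /= => /eqP-> /eqP->.
  exists [:: x], [::]; rewrite exy (tm_diag dm); split=> //; first exact: path_nil.
  by move=> v; rewrite inE => /eqP->.
have {}IH := IH (ltnW bm).
have bE := tree_edge_in bm.
have pN : par b < N by rewrite ltnS (leq_trans (pok bm)) // leq_blocks // ltnW.
have pb : Ordinal pN \in tree_edge b by rewrite inE /edge_mem eqxx.
have blk (z : 'I_N) : z <= b.+1 * K -> b * K < z -> in_block b z by rewrite /in_block => -> ->.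
have ein (z : 'I_N) : in_block b z -> z \in tree_edge b by rewrite inE /edge_mem orbC => ->.
have bb := leq_blocks (leqnSn b).
have fresh (es : seq {set 'I_N}) : (forall e, e \in es -> exists2 j, j < b & e = tree_edge j) -> tree_edge b \notin es.
  move=> h; apply/negP => /h[j jb e].
  by have := tree_edge_neq jb bm; rewrite e eqxx.
have weakE (es : seq {set 'I_N}) : (forall e, e \in es -> exists2 j, j < b & e = tree_edge j) ->
   forall e, e \in es -> exists2 j, j < b.+1 & e = tree_edge j.
  by move=> h e /h[j jb ->]; exists j => //; exact: ltnW.
have [xb'|xb'] := leqP x (b * K); have [yb'|yb'] := leqP y (b * K).
- have [vs [es [h1 h2 h3 h4]]] := IH x y xb' yb'; exists vs, es; split=> //.
    by move=> v /h3 h; apply: leq_trans h bb.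
  exact: weakE.
- have bly := blk y yb yb'.
  have [vs [es [h1 h2 h3 h4]]] := IH x (Ordinal pN) xb' (pok bm).
  exists (rcons vs y), (rcons es (tree_edge b)); split.
  + apply: (path_rcons h1) => //; [exact: ein| |exact: fresh].
    by apply/negP => /h3; rewrite leqNgt yb'.
  + by rewrite size_rcons h2 [RHS](tm_sym dm) (tm_rec dm bm bly xb') [X in _ = X.+1](tm_sym dm).
  + by move=> v; rewrite mem_rcons inE => /orP[/eqP-> //|/h3 h]; apply: leq_trans h bb.
  + move=> e; rewrite mem_rcons inE => /orP[/eqP->|]; [by exists b | exact: weakE].
- have blx := blk x xb xb'.
  have [vs [es [h1 h2 h3 h4]]] := IH (Ordinal pN) y (pok bm) yb'.
  exists (x :: vs), (tree_edge b :: es); split.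
  + apply: (path_cons h1) => //; [exact: ein| |exact: fresh].
    by apply/negP => /h3; rewrite leqNgt xb'.
  + by rewrite /= h2 (tm_rec dm bm blx yb').
  + by move=> v; rewrite inE => /orP[/eqP-> //|/h3 h]; apply: leq_trans h bb.
  + move=> e; rewrite inE => /orP[/eqP->|]; [by exists b | exact: weakE].
have blx := blk x xb xb'; have bly := blk y yb yb'.
have [<-|xy] := eqVneq x y.
  exists [:: x], [::]; rewrite (tm_diag dm); split=> //; first exact: path_nil.
  by move=> v; rewrite inE => /eqP->.
exists [:: x; y], [:: tree_edge b]; split=> /=.
- apply: (path_cons (path_nil _ _)) => //; try exact: ein.
  by rewrite inE.
- by rewrite (tm_block dm bm blx bly).
- by move=> v; rewrite !inE => /orP[]/eqP->.
- by move=> e; rewrite inE => /eqP->; exists b.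
Qed.

Lemma dist_tree (x y : 'I_N) : dist tree x y = d x y.
Proof.
apply: dist_eq.
  have [vs [es [h1 h2 _ _]]] := @path_exists m (leqnn m) x y (ltn_ord x) (ltn_ord y).
  by exists vs, es.
move=> vs es h; have := path_step (f := fun v : 'I_N => d v x) h.
rewrite (tm_diag dm) (tm_sym dm) add0n; apply=> e a b /imsetP[i _ ->]; rewrite !inE => ai bi.
by apply: (lip (ltn_ord i) ai bi); exact: (ltn_ord x).
Qed.

End Tree.

(** One inclusion per edge suffices, because both sides have [m] edges with [K + 1] vertices
    each. *)
Lemma hiso_tree (K m : nat) (par par' f g : nat -> nat) :
  0 < K -> par_ok K m par -> par_ok K m par' ->
  (forall x, x <= m * K -> f x <= m * K) ->
  (forall x y, x <= m * K -> y <= m * K -> f x = f y -> x = y) ->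
  (forall i, i < m -> g i < m) ->
  (forall i x, i < m -> x <= m * K -> edge_mem K par i x -> edge_mem K par' (g i) (f x)) ->
  hiso (tree K m par) (tree K m par').
Proof.
move=> K0 pok pok' fN finj gm fg.
pose F (x : 'I_(m * K).+1) : 'I_(m * K).+1 := inord (f x).
have FE x : F x = f x :> nat by rewrite inordK // ltnS; apply: fN; exact: (ltn_ord x).
have Finj : injective F.
  by move=> x y /(congr1 val); rewrite /= !FE => /finj e; apply: val_inj; apply: e; rewrite -ltnS.
exists F; split; first exact: injF_bij.
apply/eqP; rewrite eqEcard (card_imset _ (imset_inj Finj)).
rewrite !card_tree // leqnn andbT; apply/subsetP => _ /imsetP[_ /imsetP[i _ ->] ->].
have gi := gm i (ltn_ord i).
suff -> : F @: tree_edge K m par i = tree_edge K m par' (g i) by exact: tree_edge_in.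
apply/eqP; rewrite eqEcard card_imset // !card_tree_edge // leqnn andbT.
apply/subsetP => _ /imsetP[x xi ->]; rewrite !inE in xi *; rewrite FE.
by apply: fg => //; exact: (ltn_ord x).
Qed.

(** * Caterpillar codes *)

Section Codes.
Variables (K : nat).
Hypothesis K0 : 0 < K.

(* A code [(p, A)]: the first [p] edges form the loose path on 0..pK, and
   [A] lists the path vertices at which the remaining edges are pendant. *)
Definition cpar (p : nat) (A : seq nat) (i : nat) : nat :=
  if i < p then i * K else nth 0 A (i - p).

Definition code_ok m p A := p + size A = m /\ forall a, a \in A -> a <= p * K.

Definition cgraph m p A := tree K m (cpar p A).

(* The position [x] lies between the joints [lo x] and [hi x] of the path,
   which coincide exactly when [x] is itself a joint. *)
Definition lo x := x %/ K.
Definition hi x := (x + K.-1) %/ K.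
Definition leaf p x := p * K < x.
Definition blk x := x.-1 %/ K.
(** A pendant vertex is represented by the path vertex from which its edge hangs. *)
Definition pos p (A : seq nat) x := if leaf p x then nth 0 A (blk x - p) else x.
(** Number of path edges between two positions. Truncated subtraction lets the maximum select the
    right order, and two distinct vertices inside one edge get 1. *)
Definition pd i j := if i == j then 0 else maxn (hi i - lo j) (hi j - lo i).
Definition cdist p A x y : nat :=
  if x == y then 0 else if [&& leaf p x, leaf p y & blk x == blk y] then 1
  else pd (pos p A x) (pos p A y) + leaf p x + leaf p y.

Lemma lo_mul t : lo (t * K) = t. Proof. exact: mulnK. Qed.
Lemma hi_mul t : hi (t * K) = t.
Proof. by rewrite /hi divnMDl // divn_small ?addn0 // prednK. Qed.
Lemma hi_leq y i : y <= i * K -> hi y <= i.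
Proof. by move=> h; rewrite /hi -ltnS ltn_divLR // mulSn; lia. Qed.
Lemma hi_geq y i : i * K < y -> i < hi y.
Proof. by move=> h; rewrite /hi leq_divRL // mulSn; lia. Qed.
Lemma lo_geq y i : i * K <= y -> i <= lo y.
Proof. by move=> h; rewrite /lo leq_divRL. Qed.
Lemma lo_leq y i : y < i.+1 * K -> lo y <= i.
Proof. by move=> h; rewrite /lo -ltnS ltn_divLR. Qed.
Lemma lo_mulr y : lo y * K <= y. Proof. exact: leq_divM. Qed.
Lemma hi_mulr y : y <= hi y * K.
Proof. by have := ltn_ceil (y + K.-1) K0; rewrite -/(hi y) mulSn; lia. Qed.
Lemma lo_hi y : lo y <= hi y <= (lo y).+1.
Proof.
rewrite leq_div2r ?leq_addr //=; apply: hi_leq.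
by apply: ltnW; exact: ltn_ceil.
Qed.

Lemma pdC i j : pd i j = pd j i.
Proof. by rewrite /pd eq_sym maxnC. Qed.

Lemma pd_eq0 i j : (pd i j == 0) = (i == j).
Proof.
have [->|ne] := eqVneq i j; first by rewrite /pd eqxx.
rewrite /pd (negPf ne); apply/negP => h; move/eqP: ne; apply.
have [h1 h2] : hi i <= lo j /\ hi j <= lo i by lia.
apply/eqP; rewrite eqn_leq; apply/andP; split.
  apply: leq_trans (hi_mulr i) _; apply: leq_trans _ (lo_mulr j); by rewrite leq_mul2r h1 orbT.
apply: leq_trans (hi_mulr j) _; apply: leq_trans _ (lo_mulr i); by rewrite leq_mul2r h2 orbT.
Qed.

Lemma pdii i : pd i i = 0. Proof. by rewrite /pd eqxx. Qed.

Lemma cdistC p A x y : cdist p A x y = cdist p A y x.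
Proof.
by rewrite /cdist [y == x]eq_sym [pd (pos p A y) _]pdC [blk y == _]eq_sym andbCA addnAC.
Qed.

Lemma cdist_eq0 p A x y : (cdist p A x y == 0) = (x == y).
Proof.
rewrite /cdist; have [//|ne] := eqVneq x y; case: ifP => // h.
apply/negP; rewrite !addn_eq0 pd_eq0 !eqb0 => /andP[/andP[e lx] ly].
by move: e; rewrite /pos (negPf lx) (negPf ly) (negPf ne).
Qed.

Lemma cdist_spine p A u z : u <= p * K -> cdist p A u z = pd u (pos p A z) + leaf p z.
Proof.
move=> up; rewrite /cdist /leaf ltnNge up /=; case: eqVneq => [<-|_].
  by rewrite /pos /leaf ltnNge up /= pdii.
by rewrite [pos p A u]/pos /leaf ltnNge up addn0.
Qed.

Lemma cpar_ok m p A : code_ok m p A -> par_ok K m (cpar p A).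
Proof.
move=> [s h] i im; rewrite /cpar; case: ltnP => // pi.
apply: leq_trans (h _ _) _; first by rewrite mem_nth //; lia.
by rewrite leq_mul2r pi orbT.
Qed.

Lemma code_metric m p A : code_ok m p A -> tree_metric K m (cpar p A) (cdist p A).
Proof.
move=> ok; have [s h] := ok.
have leafE i x : in_block K i x -> leaf p x = (p <= i).
  rewrite /leaf /in_block => /andP[a b]; apply/idP/idP => c.
    by rewrite -ltnS -(ltn_pmul2r K0); apply: leq_trans c b.
  by apply: leq_ltn_trans _ a; rewrite leq_mul2r c orbT.
have blkE i x : in_block K i x -> blk x = i by exact: in_block_eq.
split=> [x y|x|i x y im bx by_ xy|i x y im bx yi].
- exact: cdistC.
- by rewrite /cdist eqxx.
- rewrite /cdist (negPf xy) !(leafE _ _ bx) !(leafE _ _ by_) (blkE _ _ bx) (blkE _ _ by_) eqxx.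
  case: leqP => //= ip; rewrite !addn0.
  rewrite /pos !(leafE _ _ bx) !(leafE _ _ by_) leqNgt ip /= /pd (negPf xy).
  case/andP: bx => a1 a2; case/andP: by_ => b1 b2.
  have e1 := hi_leq a2; have e2 := hi_leq b2; have e3 := hi_geq a1; have e4 := hi_geq b1.
  have e5 := lo_geq (ltnW a1); have e6 := lo_geq (ltnW b1).
  (* Only the last vertex of block [i] has [lo] equal to [i + 1], and [x] and [y] are not both that
     vertex. *)
  have [e7|e7] : lo x <= i \/ lo y <= i.
    move: xy; rewrite neq_ltn => /orP[c|c]; [left|right]; apply: lo_leq.
      exact: leq_trans c b2.
    exact: leq_trans c a2.
  + lia.
  + lia.
- have xy : x != y by case/andP: bx => a _; lia.
  have [ip|pi] := ltnP i p.
    have px : leaf p x = false by rewrite (leafE _ _ bx) leqNgt ip.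
    have yp : y <= p * K by apply: leq_trans yi _; rewrite leq_mul2r ltnW ?orbT.
    have py : leaf p y = false by rewrite /leaf ltnNge yp.
    rewrite /cpar ip (@cdist_spine p A (i * K)); last by rewrite leq_mul2r ltnW ?orbT.
    rewrite /cdist (negPf xy) px py /= !addn0 /pos px py /pd (negPf xy).
    case/andP: bx => a1 a2.
    have e1 := hi_leq a2; have e2 := hi_leq yi; have e3 := hi_geq a1; have e4 := lo_geq (ltnW a1).
    have e5 := lo_hi y; rewrite lo_mul hi_mul.
    case: eqVneq => [e|_]; last by lia.
    by move: e2 e5; rewrite -e lo_mul hi_mul; lia.
  have px : leaf p x by rewrite (leafE _ _ bx).
  have ap : nth 0 A (i - p) <= p * K by apply: h; rewrite mem_nth //; lia.
  rewrite /cpar ltnNge pi /= (@cdist_spine p A (nth 0 A (i - p))) // /cdist (negPf xy) px /= (blkE _ _ bx).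
  have -> : leaf p y && (i == blk y) = false.
    apply/negP => /andP[ly /eqP e]; have y0 : 0 < y by apply: leq_ltn_trans ly.
    have := blockP K0 y0; rewrite -/(blk y) -e /in_block; lia.
  by rewrite {1}/pos px (blkE _ _ bx); lia.
Qed.

Lemma dist_cgraph m p A (x y : 'I_(m * K).+1) : code_ok m p A ->
  dist (cgraph m p A) x y = cdist p A x y.
Proof. by move=> ok; apply: dist_tree => //; [exact: cpar_ok|exact: code_metric]. Qed.

Definition cd m p A (x y : 'I_(m * K).+1) : nat := cdist p A x y.
Arguments cd : clear implicits.

Lemma cd_metric m p A : nat_metric (cd m p A).
Proof. by split=> u v; [exact: cdistC | exact: cdist_eq0]. Qed.

Lemma dist_cgraph_metric m p A : code_ok m p A -> nat_metric (dist (cgraph m p A)).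
Proof.
move=> ok; split=> u v; first by rewrite (dist_cgraph u v ok) (dist_cgraph v u ok) cdistC.
by rewrite (dist_cgraph u v ok) cdist_eq0.
Qed.

Lemma card_gt1 m : 0 < m -> 1 < #|'I_(m * K).+1|.
Proof. by move=> m0; rewrite card_ord ltnS muln_gt0 m0. Qed.

Lemma code_perron (R : realType) m p A : 0 < m -> code_ok m p A ->
  exists x : 'I_(m * K).+1 -> R, perron_pair (cd m p A) (rho R (cgraph m p A)) x.
Proof.
move=> m0 ok; have V1 := card_gt1 m0; have dm := cd_metric m p A.
have [mu [x P]] := perron_exists R dm V1; exists x.
have -> // : rho R (cgraph m p A) = mu.
by apply: (perron_rhoE V1 dm _ P) => u v; exact: dist_cgraph.
Qed.

Lemma rho_hiso_code (R : realType) m p A (W : finType) (G : {set {set W}}) :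
  0 < m -> code_ok m p A -> hiso (cgraph m p A) G -> rho R (cgraph m p A) = rho R G.
Proof.
move=> m0 ok; apply: rho_hiso; first exact: card_gt1.
exact: dist_cgraph_metric.
Qed.

(** The degree in the bare loose path for a vertex on it, and 1 for a pendant vertex. *)
Definition base p x := (0 < x) + count (fun i => i * K == x) (iota 0 p).

Lemma deg_code m p A (x : 'I_(m * K).+1) : code_ok m p A ->
  deg (cgraph m p A) x = base p x + count_mem (x : nat) A.
Proof.
move=> ok; rewrite deg_tree //; last exact: cpar_ok.
have [e h] := ok; rewrite /base -addnA; congr (_ + _).
have -> : iota 0 m = iota 0 (p + size A) by rewrite e.
rewrite iotaD count_cat; congr (_ + _).
  by apply: eq_in_count => i; rewrite mem_iota /cpar => /andP[_ ->].
rewrite -[X in iota X]addn0 iotaDl count_map -[in RHS](mkseq_nth 0 A) count_map add0n.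
by apply: eq_count => i; rewrite /= /cpar ltnNge leq_addr /= addKn.
Qed.

Lemma count_mulK p t : count (fun i => i * K == t * K) (iota 0 p) = (t < p).
Proof.
have -> : count (fun i => i * K == t * K) (iota 0 p) = count_mem t (iota 0 p).
  by apply: eq_count => i /=; rewrite eqn_pmul2r.
by rewrite count_uniq_mem ?iota_uniq // mem_iota.
Qed.

Lemma base_mul p t : base p (t * K) = (0 < t) + (t < p).
Proof. by rewrite /base count_mulK muln_gt0 K0 andbT. Qed.

Lemma base0 p : 0 < p -> base p 0 = 1.
Proof. by move=> p0; have := base_mul p 0; rewrite mul0n p0. Qed.

Lemma base_inner p t o : 0 < o < K -> base p (t * K + o) = 1.
Proof.
move=> /andP[o1 o2]; rewrite /base addn_gt0 o1 orbT (@eq_count _ _ pred0) ?count_pred0 // => i /=.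
apply/negP => /eqP /(congr1 (modn^~ K)); rewrite modnMl modnMDl modn_small //; lia.
Qed.

Definition code_lhg p (A : seq nat) : lhg :=
  (((p + size A) * K).+1, [seq cpar p A i :: iota (i * K).+1 K | i <- iota 0 (p + size A)]).

Lemma hg_code p A : hg (code_lhg p A) = cgraph (p + size A) p A.
Proof.
have e i y : (y < (i * K).+1 + K) = (y <= i.+1 * K) by rewrite mulSn addSn ltnS addnC.
apply/setP => S; rewrite inE /hg_of /= has_map; apply/hasP/imsetP => [[i]|[i _ ->]].
  rewrite mem_iota add0n => /andP[_ im] /= /eqP->; exists (Ordinal im) => //.
  apply/setP => x; rewrite !inE mem_iota /edge_mem /in_block /=; by rewrite e.
exists (i : nat); first by rewrite mem_iota add0n ltn_ord.
apply/eqP/setP => x; rewrite !inE mem_iota /edge_mem /in_block /=; by rewrite e.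
Qed.

(** [attach_star] numbers its fresh vertices consecutively, just as [code_lhg] numbers blocks, so
    the two are equal and not merely isomorphic. *)
Lemma attach_code p A v l : attach_star K.+1 (code_lhg p A) v l = code_lhg p (A ++ nseq l v).
Proof.
rewrite /attach_star /code_lhg /= subSS subn0 size_cat size_nseq; congr (_, _).
  by rewrite addSn addnA -mulnDl.
rewrite addnA [in RHS]iotaD map_cat; congr (_ ++ _).
  apply/eq_in_map => i; rewrite mem_iota => /andP[_ im]; congr (_ :: _).
  rewrite /cpar; case: ltnP => // pi; rewrite nth_cat; case: ltnP => //; lia.
have -> : iota (0 + (p + size A)) l = map (addn (p + size A)) (iota 0 l).
  by rewrite -iotaDl addn0.
rewrite -map_comp; apply/eq_in_map => j.
rewrite mem_iota add0n => /andP[_ jl] /=; congr (_ :: iota _ _).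
  rewrite /cpar ltnNge -addnA leq_addr /= addKn nth_cat ltnNge leq_addr /= addKn nth_nseq.
  by rewrite jl.
by rewrite addSn -mulnDl.
Qed.

Lemma cat_graphE p att :
  cat_graph K.+1 p att = code_lhg p (flatten [seq nseq a.2 a.1 | a <- att]).
Proof.
have e0 : lpath K.+1 p = code_lhg p [::].
  rewrite /lpath /code_lhg /= subSS subn0 addn0; congr (_, _).
  rewrite -[X in iota X]addn0 iotaDl -map_comp; apply/eq_in_map => i.
  by rewrite mem_iota => /andP[_ ip] /=; rewrite addKn /cpar ip.
rewrite /cat_graph e0 -[flatten _]cat0s; elim: att [::] => [|a att IH] B /=.
  by rewrite cats0.
by rewrite attach_code IH catA.
Qed.

End Codes.

(** * Normal form of codes *)

Section Isomorphisms.
Variables (K m : nat).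
Hypothesis K0 : 0 < K.

Lemma code_ok_perm p (A B : seq nat) : perm_eq A B -> code_ok K m p A -> code_ok K m p B.
Proof.
move=> AB [s h]; split; first by rewrite -(perm_size AB).
by move=> a; rewrite -(perm_mem AB); exact: h.
Qed.

(** The permutation [Is] acts on the pendant blocks; [f] moves each block as a whole, keeping
    offsets, and fixes the path. *)
Lemma hiso_perm p (A B : seq nat) : code_ok K m p A -> perm_eq A B ->
  hiso (cgraph K m p A) (cgraph K m p B).
Proof.
move=> ok AB; have okB := code_ok_perm AB ok; have [s h] := ok; have [sB _] := okB.
have /(perm_iotaP 0)[Is pI AE] := AB.
have sI : size Is = size B by rewrite (perm_size pI) size_iota.
have uI : uniq Is by rewrite (perm_uniq pI) iota_uniq.
have mI j : j < size B -> nth 0 Is j < size B.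
  by move=> jB; have := mem_nth 0 (s := Is) (n := j); rewrite sI (perm_mem pI) mem_iota => /(_ jB).
pose g i := if i < p then i else p + nth 0 Is (i - p).
pose f (x : nat) := if x == 0 then 0 else g (blk K x) * K + (x.-1 %% K).+1.
have gm i : i < m -> g i < m.
  move=> im; rewrite /g; case: (ltnP i p) => // pi; rewrite -sB ltn_add2l; apply: mI; by rewrite ltn_subLR // sB.
have ginj i j : i < m -> j < m -> g i = g j -> i = j.
  move=> im jm; rewrite /g; case: (ltnP i p) => ip; case: (ltnP j p) => jp; try lia.
  move/addnI/eqP; rewrite nth_uniq ?sI ?ltn_subLR ?sB // => /eqP; lia.
have fblk x : 0 < x -> in_block K (g (blk K x)) (f x).
  move=> x0; rewrite /f gtn_eqF // /in_block mulSn.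
  by have := ltn_pmod x.-1 K0; set r := _ %% K; set y := _ * K; lia.
have bm x : 0 < x -> x <= m * K -> blk K x < m.
  by move=> x0; apply: in_block_lt => //; exact: blockP.
have fid x : x <= p * K -> f x = x.
  case: (posnP x) => [-> //|x0] xp; rewrite /f gtn_eqF //.
  have -> : g (blk K x) = blk K x.
    by rewrite /g (in_block_lt K0 (blockP K0 x0) xp).
  by rewrite addnS -divn_eq prednK.
have fpos x : 0 < x -> 0 < f x by move=> /fblk; rewrite /in_block; lia.
apply: (@hiso_tree K m _ _ f g) => //; try exact: cpar_ok.
- move=> x xm; case: (posnP x) => [->|x0]; first by rewrite /f.
  have /andP[_ h1] := fblk _ x0; apply: leq_trans h1 _.
  by rewrite leq_mul2r gm ?orbT // bm.
- move=> x y xm ym; case: (posnP x) => [->|x0]; case: (posnP y) => [->|y0] //.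
  + by have := fpos _ y0; rewrite {2}/f /=; lia.
  + by have := fpos _ x0; rewrite {3}/f /=; lia.
  move=> e; have e1 := in_block_eq K0 (fblk _ x0); have e2 := in_block_eq K0 (fblk _ y0).
  rewrite e in e1; rewrite e1 in e2.
  have e3 : blk K x = blk K y by apply: ginj => //; exact: bm.
  move: e; rewrite /f !gtn_eqF // e3 => /addnI [] e4.
  have := divn_eq x.-1 K; have := divn_eq y.-1 K; rewrite -/(blk K x) -/(blk K y) e3 e4; lia.
- move=> i x im xm; rewrite /edge_mem => /orP[/eqP->|bx]; last first.
    by rewrite -(in_block_eq K0 bx) fblk ?orbT //; case/andP: bx => b _; lia.
  apply/orP; left; apply/eqP; rewrite /cpar /g; case: ltnP => ip.
    by rewrite fid ?ip // leq_mul2r ltnW ?orbT.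
  rewrite ltnNge leq_addr /= addKn fid; last by apply: h; rewrite mem_nth //; lia.
  by rewrite {1}AE (nth_map 0) // sI ltn_subLR ?sB.
Qed.

Lemma hiso_reflect p (A : seq nat) : code_ok K m p A ->
  code_ok K m p [seq p * K - a | a <- A] /\
  hiso (cgraph K m p A) (cgraph K m p [seq p * K - a | a <- A]).
Proof.
move=> ok; have [s h] := ok.
have okB : code_ok K m p [seq p * K - a | a <- A].
  by split; [rewrite size_map | move=> _ /mapP[a _ ->]; exact: leq_subr].
have pm : p * K <= m * K by rewrite leq_mul2r; apply/orP; right; lia.
split=> //; apply: (@hiso_tree K m _ _ (fun x => if x <= p * K then p * K - x else x)
  (fun i => if i < p then p - i.+1 else i)) => //; try exact: cpar_ok.
- by move=> x xm; case: (leqP x (p * K)) => _; lia.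
- by move=> x y xm ym; case: (leqP x (p * K)) => a; case: (leqP y (p * K)) => b; lia.
- by move=> i im; case: (ltnP i p) => _; lia.
- move=> i x im xm; rewrite /edge_mem /cpar /in_block; case: (ltnP i p) => ip.
    have e1 : i.+1 * K <= p * K by rewrite leq_mul2r ip orbT.
    have e2 : p - i.+1 < p by lia.
    rewrite e2 mulnBl; have e3 : (p - i.+1).+1 * K = p * K - i * K by rewrite -mulnBl; congr (_ * _); lia.
    rewrite e3 mulSn in e1 *; case: (leqP x (p * K)); lia.
  rewrite (ltnNge i p) ip /=; case/orP => [/eqP->|bx].
    have ap : nth 0 A (i - p) <= p * K by apply: h; rewrite mem_nth //; lia.
    by rewrite ap (nth_map 0) ?ltn_subLR ?s ?eqxx.
  have e1 : p * K <= i * K by rewrite leq_mul2r ip orbT.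
  by rewrite leqNgt (leq_ltn_trans e1) ?bx ?orbT //; case/andP: bx.
Qed.

(** For [j < K] the vertices 0 and [j] lie in no path edge but the first, so they are
    interchangeable. *)
Definition swap0 j a := if a == 0 then j else if a == j then 0 else a.

Lemma swap0_leq j a b : j <= b -> a <= b -> swap0 j a <= b.
Proof. by rewrite /swap0; case: ifP => // _; case: ifP => // _; lia. Qed.

Lemma hiso_swap p (A : seq nat) j : 0 < p -> j < K -> code_ok K m p A ->
  code_ok K m p (map (swap0 j) A) /\
  hiso (cgraph K m p A) (cgraph K m p (map (swap0 j) A)).
Proof.
move=> p0 jK ok; have [s h] := ok.
have Kp : K <= p * K by rewrite leq_pmull.
have jp : j <= p * K by apply: leq_trans (ltnW jK) Kp.
have okB : code_ok K m p (map (swap0 j) A).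
  split; first by rewrite size_map.
  by move=> _ /mapP[a aA ->]; apply: swap0_leq => //; exact: h.
have pm : p * K <= m * K by rewrite leq_mul2r; apply/orP; right; lia.
split=> //; apply: (@hiso_tree K m _ _ (swap0 j) id) => //; try exact: cpar_ok.
- by move=> x xm; apply: swap0_leq => //; lia.
- by move=> x y _ _; rewrite /swap0; repeat (case: eqP); lia.
- move=> i x im xm; rewrite /edge_mem /cpar /in_block; case: (ltnP i p) => ip.
    case: (posnP i) => [->|i0].
      by rewrite mul0n mul1n /swap0; repeat case: eqP; lia.
    have : K <= i * K by rewrite leq_pmull.
    by rewrite mulSn /swap0; repeat case: eqP; lia.
  case/orP => [/eqP->|bx]; first by rewrite (nth_map 0) ?ltn_subLR ?s ?eqxx.
  have e1 : p * K <= i * K by rewrite leq_mul2r ip orbT.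
  have -> : swap0 j x = x by rewrite /swap0; case: eqP; [lia|]; case: eqP; lia.
  by rewrite bx orbT.
Qed.

(** A pendant edge at the end 0 prolongs the path: its block becomes the new beginning and the old
    path is shifted by [K]. *)
Lemma hiso_rotate p (A : seq nat) : code_ok K m p (0 :: A) ->
  code_ok K m p.+1 [seq K + a | a <- A] /\
  hiso (cgraph K m p (0 :: A)) (cgraph K m p.+1 [seq K + a | a <- A]).
Proof.
move=> ok; have [s h] := ok; rewrite /= in s.
have hA a : a \in A -> a <= p * K by move=> aA; apply: h; rewrite inE aA orbT.
have okB : code_ok K m p.+1 [seq K + a | a <- A].
  split; first by rewrite size_map; lia.
  by move=> _ /mapP[a aA ->]; rewrite mulSn leq_add2l hA.
have pm : p.+1 * K <= m * K by rewrite leq_mul2r; apply/orP; right; lia.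
split=> //; apply: (@hiso_tree K m _ _
  (fun x => if x <= p * K then K + x else if x <= p.+1 * K then x - (p * K).+1 else x)
  (fun i => if i < p then i.+1 else if i == p then 0 else i)) => //; try exact: cpar_ok.
- by move=> x xm; rewrite mulSn in pm *; case: (leqP x (p * K)) => a; last case: (leqP x (K + p * K)) => b; lia.
- by move=> x y xm ym; rewrite mulSn; case: (leqP x (p * K)); case: (leqP y (p * K));
  case: (leqP x (K + p * K)); case: (leqP y (K + p * K)); lia.
- by move=> i im; case: (ltnP i p) => a; last case: eqP => b; lia.
- move=> i x im xm; rewrite /edge_mem /cpar /in_block; case: (ltnP i p) => ip.
    have e1 : i.+1 * K <= p * K by rewrite leq_mul2r ip orbT.
    rewrite ltnS ip !mulSn in e1 *; case: (leqP x (p * K)) => a; lia.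
  case: (eqVneq i p) => [->|ne].
    rewrite subnn /= mul0n mul1n !mulSn; case: (leqP x (p * K)) => a; last case: (leqP x (K + p * K)) => b; lia.
  have ip' : p < i by lia.
  rewrite (ltnNge i p.+1) ip' /=; have -> : i - p = (i - p.+1).+1 by lia.
  have e1 : p.+1 * K <= i * K by rewrite leq_mul2r ip' orbT.
  case/orP => [/eqP->|bx] /=.
    have lt : i - p.+1 < size A by lia.
    by rewrite hA ?mem_nth // (nth_map 0) // eqxx.
  have -> : x <= p * K = false by move: e1 bx; rewrite mulSn; lia.
  by have -> : x <= p.+1 * K = false; [lia | rewrite bx orbT].
Qed.

Definition inner_anchors p (A : seq nat) := forall a, a \in A -> K <= a <= p.-1 * K.

(** A pendant edge hanging before the first joint or after the last one can be absorbed into the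
    path, and [p] is bounded by [m]. Afterwards both ends are free to receive a star, and an anchor
    inside an edge has a path edge on either side. *)
Lemma normal_form p (A : seq nat) : code_ok K m p A -> 0 < m ->
  exists p' A', [/\ code_ok K m p' A', 0 < p', hiso (cgraph K m p A) (cgraph K m p' A') &
    inner_anchors p' A'].
Proof.
have [q] := ubnP (m - p); elim: q p A => // q IH p A pq ok m0; have [s h] := ok.
have ext B : code_ok K m p B -> hiso (cgraph K m p A) (cgraph K m p B) -> 0 \in B ->
    exists p' A', [/\ code_ok K m p' A', 0 < p', hiso (cgraph K m p A) (cgraph K m p' A') &
    inner_anchors p' A'].
  move=> okB isB B0; have pB := perm_to_rem B0.
  have [ok2 iso2] := hiso_rotate (code_ok_perm pB okB).
  have sB : 0 < size B by case: (B) B0.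
  have [] := IH _ _ _ ok2 m0; first by case: okB => e _; lia.
  move=> p' [A' [k1 k2 k3 k4]]; exists p', A'; split=> //.
  apply: hiso_trans isB _; apply: hiso_trans (hiso_perm okB pB) _.
  exact: hiso_trans iso2 k3.
have extl B a : code_ok K m p B -> hiso (cgraph K m p A) (cgraph K m p B) -> a \in B -> 0 < p ->
    a < K -> exists p' A', [/\ code_ok K m p' A', 0 < p', hiso (cgraph K m p A) (cgraph K m p' A') &
    inner_anchors p' A'].
  move=> okB isB aB p0 aK; have [okC isC] := hiso_swap p0 aK okB.
  apply: (ext _ okC); first exact: hiso_trans isB isC.
  by apply/mapP; exists a => //; rewrite /swap0 eqxx; case: eqP.
(* On a path without edges every anchor is 0, and there is one because [m > 0]. *)
case: (posnP p) => [p0|p0].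
  apply: (ext A) => //; first exact: hiso_refl.
  case: (A) s h => [|a B] /=; first by lia.
  by move=> _ /(_ a); rewrite inE eqxx p0 mul0n leqn0 => /(_ isT)/eqP->; rewrite inE.
have [/hasP[a aA]|/hasPn h1] := boolP (has (fun a => a < K) A).
  by apply: (extl A) => //; exact: hiso_refl.
have [/hasP[a aA ha]|/hasPn h2] := boolP (has (fun a => p.-1 * K < a) A).
  have [okC isC] := hiso_reflect ok.
  apply: (extl _ (p * K - a) okC isC) => //; first by apply: map_f.
  by move: ha; rewrite -{2}(prednK p0) mulSn; lia.
exists p, A; split=> //; first exact: hiso_refl.
by move=> a aA; have := h1 a aA; have := h2 a aA; lia.
Qed.

End Isomorphisms.

(** * Moves that increase the spectral radius *)

Section Moves.
Variables (R : realType) (K m : nat).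
Hypotheses (K0 : 0 < K) (m0 : 0 < m).
Local Notation N := (m * K).+1.
Local Notation cd := (@cd K m).
Local Notation hi := (hi K).
Local Notation lo := (lo K).
Local Notation pd := (pd K).
Local Notation pos := (pos K).
Local Notation leaf := (leaf K).
Local Notation blk := (blk K).
Local Notation code_ok := (code_ok K m).
Local Notation rho_code p A := (rho R (cgraph K m p A)).

Implicit Types A B : seq nat.

Definition pidx p z := blk z - p.

Definition vtx (x : nat) : 'I_N := inord x.

Lemma spine_leq p A : code_ok p A -> p * K <= m * K.
Proof. by case=> <- _; rewrite leq_mul2r leq_addr orbT. Qed.

Lemma vtxE p A x : code_ok p A -> x <= p * K -> vtx x = x :> nat.
Proof. by move=> ok xp; rewrite inordK // ltnS (leq_trans xp) // (spine_leq ok). Qed.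

Lemma leafN p x : x <= p * K -> leaf p x = false.
Proof. by rewrite /leaf ltnNge => ->. Qed.

Lemma posN p A x : x <= p * K -> pos p A x = x.
Proof. by move=> h; rewrite /pos leafN. Qed.

Lemma leaf_index p A (z : 'I_N) : code_ok p A -> leaf p z -> p <= blk z /\ pidx p z < size A.
Proof.
move=> [s _] lz; have z0 : 0 < z by apply: leq_ltn_trans lz.
have bz := blockP K0 z0; have bm := in_block_lt K0 bz (ltn_ord z).
have pb : p <= blk z.
  rewrite -ltnS -(ltn_pmul2r K0); apply: leq_trans lz _; by case/andP: bz.
by split=> //; rewrite /pidx ltn_subLR // s.
Qed.

Lemma pos_leq p A (z : 'I_N) : code_ok p A -> pos p A z <= p * K.
Proof.
move=> ok; rewrite /pos; case: ifP => [lz|/negbT]; last by rewrite /leaf -leqNgt.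
by case: ok (leaf_index ok lz) => _ h [_ i]; apply: h; exact: mem_nth.
Qed.

Lemma pos_leaf_mem p A (z : 'I_N) : code_ok p A -> leaf p z -> pos p A z \in A.
Proof. by move=> ok lz; have [_ h] := leaf_index ok lz; rewrite /pos lz; exact: mem_nth. Qed.

Lemma lo_pos p A (z : 'I_N) : code_ok p A -> lo (pos p A z) <= p.
Proof. by move=> ok; have := pos_leq z ok; move/(leq_div2r K); rewrite mulnK. Qed.

Lemma hi_pos p A (z : 'I_N) : code_ok p A -> hi (pos p A z) <= p.
Proof. by move=> ok; apply: hi_leq => //; exact: pos_leq. Qed.

Lemma pd_joint t q : pd (t * K) q = maxn (t - lo q) (hi q - t).
Proof.
rewrite /pd; case: eqVneq => [<-|_]; last by rewrite lo_mul // hi_mul // maxnC.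
by rewrite lo_mul // hi_mul // subnn.
Qed.

Lemma cd_spine p A u (z : 'I_N) : code_ok p A -> u <= p * K ->
  cd p A (vtx u) z = pd u (pos p A z) + leaf p z.
Proof. by move=> ok up; rewrite /cd (vtxE ok up) cdist_spine. Qed.

Lemma cd_joint p A t (z : 'I_N) : code_ok p A -> t <= p ->
  cd p A (vtx (t * K)) z = maxn (t - lo (pos p A z)) (hi (pos p A z) - t) + leaf p z.
Proof. by move=> ok tp; rewrite cd_spine ?pd_joint // leq_mul2r tp orbT. Qed.

(** Selecting pendant edges by their index allows moving one of several edges at [u] as well as all
    of them. *)
Lemma code_relocation p A A' (P : pred nat) u w :
  code_ok p A -> code_ok p A' -> u <= p * K -> w <= p * K -> u != w ->
  (forall j, j < size A -> P j -> nth 0 A j = u /\ nth 0 A' j = w) ->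
  (forall j, j < size A -> ~~ P j -> nth 0 A' j = nth 0 A j) ->
  relocation (cd p A) (cd p A') [set z : 'I_N | leaf p z && P (pidx p z)] (vtx u) (vtx w).
Proof.
move=> ok ok' up wp uw h1 h2; set F := [set z | _].
have spF x : x <= p * K -> vtx x \notin F by move=> xp; rewrite inE (vtxE ok xp) leafN.
have posF z : z \in F -> [/\ leaf p z, pos p A z = u & pos p A' z = w].
  rewrite inE => /andP[lz Pz]; have [_ jA] := leaf_index ok lz.
  by have [e1 e2] := h1 _ jA Pz; rewrite /pos lz.
have posNF z : z \notin F -> pos p A' z = pos p A z.
  rewrite inE negb_and /pos; case: ifP => // lz /= nP; have [_ jA] := leaf_index ok lz.
  exact: h2.
have cross B a b : a \in F -> b \notin F -> code_ok p B -> cd p B a b =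
    (cd p B (vtx (pos p B a)) b).+1.
  move=> aF bF okB; have [la _ _] := posF _ aF.
  rewrite cd_spine //; last exact: pos_leq.
  rewrite /cd /cdist la; case: eqP => [e|_]; first by move: bF; rewrite -(val_inj e) aF.
  have -> : leaf p b && (blk a == blk b) = false.
    by apply/negP => /andP[lb /eqP e]; move: aF bF; rewrite !inE /pidx la lb e => /= ->.
  by rewrite /= addn1 addSn.
split.
- exact: spF.
- exact: spF.
- by apply: contra uw => /eqP /(congr1 val); rewrite /= (vtxE ok up) (vtxE ok wp) => ->.
- move=> a b aF bF; have [la e1 e2] := posF _ aF; have [lb e3 e4] := posF _ bF.
  by rewrite /cd /cdist e1 e2 e3 e4 !pdii.
- by move=> a b aF bF; rewrite /cd /cdist !posNF.
- by move=> a b aF bF; rewrite cross //; have [_ -> _] := posF _ aF.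
- move=> a b aF bF; rewrite cross //; have [_ _ ->] := posF _ aF.
  by rewrite !cd_spine // posNF.
Qed.

Lemma leaf_vtx p A j : code_ok p A -> j < size A -> exists z : 'I_N, leaf p z /\ pidx p z = j.
Proof.
move=> [s _] jA; have b : in_block K (p + j) ((p + j) * K).+1.
  by rewrite /in_block ltnS leqnn mulSn; lia.
have zN : ((p + j) * K).+1 < N.
  rewrite ltnS; case/andP: b => _ b; apply: leq_trans b _; by rewrite leq_mul2r -s -addnS leq_add2l jA orbT.
exists (Ordinal zN); rewrite /pidx /= /blk (in_block_eq K0 b) addKn; split=> //.
by rewrite /leaf ltnS leq_mul2r leq_addr orbT.
Qed.

Section Perron.
Variables (p : nat) (A : seq nat).
Hypothesis ok : code_ok p A.
Variable x : 'I_N -> R.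
Hypothesis P : perron_pair (cd p A) (rho_code p A) x.

Lemma code_move_keep A' (Pj : pred nat) u w j0 :
  code_ok p A' -> u <= p * K -> w <= p * K -> u != w ->
  (forall j, j < size A -> Pj j -> nth 0 A j = u /\ nth 0 A' j = w) ->
  (forall j, j < size A -> ~~ Pj j -> nth 0 A' j = nth 0 A j) ->
  j0 < size A -> Pj j0 ->
  (rho_code p A < rho_code p A')%R \/
  (\sum_(z : 'I_N | ~~ (leaf p z && Pj (pidx p z)))
      x z * ((cd p A (vtx w) z)%:R - (cd p A (vtx u) z)%:R) < 0)%R.
Proof.
move=> ok' up wp uw h1 h2 j0A Pj0.
have rel := code_relocation ok ok' up wp uw h1 h2.
have [x' P'] := code_perron K0 R m0 ok'.
have [f0 [lf bf]] := leaf_vtx ok j0A.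
case: (ltP 0%R (rho_code p A' - rho_code p A)%R) => [|h]; first by rewrite subr_gt0; left.
right; rewrite ltNge; apply/negP => hs; move: h; rewrite leNgt subr_gt0 => /negP; apply.
apply: (relocation_lt rel (cd_metric K0 _ _ _) (cd_metric K0 _ _ _) P P' (f0 := f0)) => //.
  by rewrite inE lf bf.
by rewrite (eq_bigl (fun z : 'I_N => ~~ (leaf p z && Pj (pidx p z)))) // => z; rewrite inE.
Qed.

Lemma joint_leq t : t <= p -> t * K <= p * K.
Proof. by move=> tp; rewrite leq_mul2r tp orbT. Qed.

End Perron.

(** By convexity of distances along the path, the sums for the ends 0 and [p], weighted by [p - t]
    and [t], add up to something nonnegative, so they are not both negative. *)
Lemma move_single p t B : code_ok p (t * K :: B) -> 0 < t < p ->
  (rho_code p ((t * K)%N :: B) < rho_code p (0%N :: B))%R \/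
  (rho_code p ((t * K)%N :: B) < rho_code p ((p * K)%N :: B))%R.
Proof.
move=> ok /andP[t0 tp]; have [s h] := ok; have [x P] := code_perron K0 R m0 ok.
set A := t * K :: B in ok P *.
have okw w : w <= p * K -> code_ok p (w :: B).
  move=> wp; split=> // a; rewrite inE => /orP[/eqP-> //|aB].
  by apply: h; rewrite inE aB orbT.
have tpK : t * K <= p * K by apply: joint_leq; exact: ltnW.
have mv w (wp : w <= p * K) (ne : t * K != w) :=
  @code_move_keep p A ok x P (w :: B) (pred1 0) (t * K) w 0 (okw w wp) tpK wp ne
  (fun j _ => ltac:(by move/eqP->)) (fun j => ltac:(by case: j)) isT isT.
have ne1 : t * K != 0 by rewrite -lt0n muln_gt0 t0.
have ne2 : t * K != p * K by rewrite eqn_pmul2r // neq_ltn tp.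
case: (mv 0 (leq0n _) ne1) => [|s1]; first by left.
case: (mv (p * K) (leqnn _) ne2) => [|s2]; first by right.
exfalso.
have : (0 <= (p - t)%N%:R * (\sum_(z : 'I_N | ~~ (leaf p z && (pidx p z == 0)%N))
      x z * ((cd p A (vtx 0) z)%:R - (cd p A (vtx (t * K)%N) z)%:R)) +
   t%:R * \sum_(z : 'I_N | ~~ (leaf p z && (pidx p z == 0)%N))
      x z * ((cd p A (vtx (p * K)%N) z)%:R - (cd p A (vtx (t * K)%N) z)%:R))%R.
  rewrite !mulr_sumr -big_split /=; apply: sumr_ge0 => z _.
  have e : p * cd p A (vtx (t * K)) z <= (p - t) * cd p A (vtx 0) z + t * cd p A (vtx (p * K)) z.
    rewrite -{1}[0](mul0n K) !cd_joint //; last exact: ltnW.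
    have h1 := lo_pos z ok; have h2 := hi_pos z ok; have h3 := lo_hi K0 (pos p A z).
    move: (lo _) (hi _) (leaf p z : nat) h1 h2 h3 => l h' e' h1 h2 h3.
    have [-> ->] : maxn (0 - l) (h' - 0) = h' /\ maxn (p - l) (h' - p) = p - l by lia.
    have [r pe] : exists r, p = t + r by exists (p - t); lia.
    have [l' le] : exists l', p = l + l' by exists (p - l); lia.
    have -> : p - t = r by lia.
    have -> : p - l = l' by lia.
    case/orP: (leq_total (t - l) (h' - t)) => c; [rewrite (maxn_idPr c)|rewrite (maxn_idPl c)].
      case/orP: (leq_total h' t) => c2; first by have -> : h' - t = 0; lia.
      have [b be] : exists b, h' = t + b by exists (h' - t); lia.
      have -> : h' - t = b by lia.
      have le2 : l' >= r - b by lia.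
      nia.
    case/orP: (leq_total t l) => c2; first by have -> : t - l = 0; lia.
    have [b be] : exists b, t = l + b by exists (t - l); lia.
    have -> : t - l = b by lia.
    nia.
  rewrite mulrCA [(t%:R * _)%R]mulrCA -mulrDr; apply: mulr_ge0; first exact/ltW/(perron_pos P).
  have := e; rewrite -(ler_nat R) natrD !natrM natrB; last exact: ltnW.
  by move=> e'; lra.
have tr : (0 < t%:R :> R)%R by rewrite ltr0n.
have ptr : (0 < (p - t)%N%:R :> R)%R by rewrite ltr0n subn_gt0.
move=> hge; move: s1 s2; rewrite -(pmulr_rlt0 _ ptr) => s1; rewrite -(pmulr_rlt0 _ tr) => s2; move: hge; rewrite leNgt => /negP; apply; rewrite -[ltRHS]addr0.
exact: ltrD.
Qed.


Definition mv (u w : nat) (A : seq nat) := [seq (if a == u then w else a) | a <- A].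

Lemma code_ok_mv p A u w : code_ok p A -> w <= p * K -> code_ok p (mv u w A).
Proof.
move=> [s h] wp; split; first by rewrite size_map.
by move=> _ /mapP[a aA ->]; case: ifP => // _; exact: h.
Qed.

Definition bag (p : nat) (A : seq nat) (u : nat) : {set 'I_N} := [set z : 'I_N | leaf p z && (pos p A z == u)].

Lemma bag_relocation p A u w : code_ok p A -> u <= p * K -> w <= p * K -> u != w ->
  relocation (cd p A) (cd p (mv u w A)) (bag p A u) (vtx u) (vtx w).
Proof.
move=> ok up wp uw.
have -> : bag p A u = [set z : 'I_N | leaf p z && (nth 0 A (pidx p z) == u)].
  by apply/setP => z; rewrite !inE /pos; case: ifP.
apply: (@code_relocation p A (mv u w A) (fun j => nth 0 A j == u)) => //.
- exact: code_ok_mv.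
- by move=> j jA e; rewrite (nth_map 0) // e (eqP e).
- by move=> j jA e; rewrite (nth_map 0) // (negPf e).
Qed.

Lemma bag_nonempty p A u : code_ok p A -> u \in A -> exists z, z \in bag p A u.
Proof.
move=> ok uA; have jA : index u A < size A by rewrite index_mem.
have [z [lz e]] := leaf_vtx ok jA; exists z.
by rewrite inE lz /pos lz -/(pidx p z) e nth_index /=.
Qed.

Lemma move_bag p A (x : 'I_N -> R) u w :
  code_ok p A -> perron_pair (cd p A) (rho_code p A) x ->
  u \in A -> w <= p * K -> u != w ->
  (rho_code p A < rho_code p (mv u w A))%R \/
  (\sum_(z : 'I_N | z \notin bag p A u)
      x z * ((cd p A (vtx w) z)%:R - (cd p A (vtx u) z)%:R) < 0)%R.
Proof.
move=> ok P uA wp uw; have up : u <= p * K by case: ok => _; apply.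
have ok' := code_ok_mv u ok wp.
have rel := bag_relocation ok up wp uw.
have [x' P'] := code_perron K0 R m0 ok'.
have [f0 ff] := bag_nonempty ok uA.
case: (ltP 0%R (rho_code p (mv u w A) - rho_code p A)%R) => [|h]; first by rewrite subr_gt0; left.
right; rewrite ltNge; apply/negP => hs; move: h; rewrite leNgt subr_gt0 => /negP; apply.
exact: (relocation_lt rel (cd_metric K0 _ _ _) (cd_metric K0 _ _ _) P P' ff).
Qed.

(** For [z] outside both stars the two changes are outward increments of a convex function at
    [i <= j], with nonnegative sum; a star left out of one sum contributes a nonnegative increment
    to the other. The joints between [i] and [j] are arbitrary. *)
Lemma move_outward p A i j : code_ok p A -> 1 < i -> i <= j -> j.+1 < p ->
  i * K \in A -> j * K \in A ->
  (rho_code p A < rho_code p (mv (i * K) (i.-1 * K) A))%R \/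
  (rho_code p A < rho_code p (mv (j * K) (j.+1 * K) A))%R.
Proof.
move=> ok i1 ij jp iA jA; have [x P] := code_perron K0 R m0 ok.
have w1 : i.-1 * K <= p * K by apply: joint_leq; lia.
have w2 : j.+1 * K <= p * K by apply: joint_leq; lia.
have n1 : i * K != i.-1 * K by rewrite eqn_pmul2r //; lia.
have n2 : j * K != j.+1 * K by rewrite eqn_pmul2r //; lia.
case: (move_bag ok P iA w1 n1) => [|s1]; first by left.
case: (move_bag ok P jA w2 n2) => [|s2]; first by right.
exfalso; have := ltrD s1 s2; rewrite addr0 ltNge => /negP; apply.
rewrite big_mkcond [X in (_ + X)%R]big_mkcond -big_split /=; apply: sumr_ge0 => z _.
have xz := perron_pos P z.
have h3 := lo_hi K0 (pos p A z).
rewrite !inE !cd_joint //; try lia.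
case: (boolP (leaf p z && (pos p A z == i * K))) => /= [/andP[_ /eqP e]|_];
  case: (boolP (leaf p z && (pos p A z == j * K))) => /= [/andP[_ /eqP e']|_];
  rewrite ?addr0 ?add0r //.
- apply: mulr_ge0; first exact: ltW.
  rewrite subr_ge0 ler_nat leq_add2r e lo_mul // hi_mul //; lia.
- apply: mulr_ge0; first exact: ltW.
  rewrite subr_ge0 ler_nat leq_add2r e' lo_mul // hi_mul //; lia.
rewrite -mulrDr; apply: mulr_ge0; first exact: ltW.
rewrite addrACA -opprD subr_ge0 -!natrD ler_nat; lia.
Qed.

Lemma pd_max u q : u != q -> pd u q = maxn (hi u - lo q) (hi q - lo u).
Proof. by rewrite /pd => /negPf->. Qed.

(** The inner vertex lies between joints [t] and [t + 1] of a path of length [t + r + 1], and [z]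
    between [l] and [h] to its left. Weighted convexity fails only at the end 0, by [r], and has
    slack [r] at joint 1. *)
Lemma left_coef (t r l h : nat) : 0 < r -> h <= t -> l <= h ->
  (r + t) * (t.+1 - l) + r * (l + h == 2) <= r * h + t * (t + r + 1 - l) + r * (h == 0).
Proof.
move=> r0 ht lh; have [d td] : exists d, t = l + d by exists (t - l); lia.
have -> : t.+1 - l = d.+1 by lia.
have -> : t + r + 1 - l = d + r + 1 by lia.
suff : r * (1 + (l + h == 2)) <= r * (h + l + (h == 0)) by subst; nia.
by rewrite leq_mul2l; lia.
Qed.
Lemma inner_coef (t r l h : nat) : 0 < t -> 0 < r -> l <= h -> h <= l.+1 -> h <= t + r + 1 ->
  (r + t) * maxn (t.+1 - l) (h - t) + r * (l + h == 2) + t * (l + h == 2 * (t + r)) <=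
  r * h + t * (t + r + 1 - l) + r * (h == 0) + t * (l == t + r + 1).
Proof.
move=> t0 r0 lh hl ht; have [c|c] := leqP h t.
  have -> : maxn (t.+1 - l) (h - t) = t.+1 - l by lia.
  have -> : (l == t + r + 1) = false by lia.
  have -> : (l + h == 2 * (t + r)) = false by lia.
  by rewrite muln0 !addn0; exact: left_coef.
have [e|ne] := eqVneq l t.
  have -> : h = t.+1 by lia.
  have -> : (l + t.+1 == 2) = false by lia.
  have -> : (l + t.+1 == 2 * (t + r)) = false by lia.
  have -> : maxn (t.+1 - l) (t.+1 - t) = 1 by lia.
  have -> : t + r + 1 - l = r.+1 by lia.
  nia.
have -> : maxn (t.+1 - l) (h - t) = r.+1 - (t + r + 1 - h) by lia.
have -> : (h == 0) = false by lia.
have -> : (l + h == 2) = false by lia.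
have h1 : t + r + 1 - l <= r by lia.
have h2 : t + r + 1 - h <= t + r + 1 - l by lia.
(* Positions right of the edge follow by reflecting the path, which exchanges [t] and [r], and the
   joints 1 and [t + r]. *)
have := left_coef t0 h1 h2.
have -> : r + t + 1 - (t + r + 1 - h) = h by lia.
have -> : (t + r + 1 - h + (t + r + 1 - l) == 2) = (l + h == 2 * (t + r)) by lia.
have -> : (t + r + 1 - l == 0) = (l == t + r + 1) by lia.
by rewrite !muln0 !addn0 [t + r]addnC; lia.
Qed.

Lemma lo_inner t o : 0 < o < K -> lo (t * K + o) = t.
Proof. by move=> /andP[o0 oK]; rewrite /lo divnMDl // divn_small // addn0. Qed.

Lemma hi_inner t o : 0 < o < K -> hi (t * K + o) = t.+1.
Proof.
move=> /andP[o0 oK]; rewrite /hi -addnA divnMDl // -[in RHS]addn1; congr (_ + _).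
apply/eqP; rewrite eqn_leq -ltnS ltn_divLR // leq_divRL //; apply/andP; split; lia.
Qed.

Lemma lohi_joint q s : lo q = s -> hi q = s -> q = s * K.
Proof.
move=> l h; apply/eqP; rewrite eqn_leq; apply/andP; split.
  by rewrite -{1}h; exact: hi_mulr.
by rewrite -{1}l; exact: lo_mulr.
Qed.

Lemma combine_leq (r t M e h P b1 b2 j1 j2 b3 b4 j3 j4 : nat) :
  b1 <= j1 -> b2 <= j2 -> b3 <= j3 -> b4 <= j4 ->
  (r + t) * M + j1 + j2 <= r * h + t * P + b3 + b4 ->
  (r + t) * (M + e) + b1 + b2 <= r * (h + e) + t * (P + e) + j3 + j4.
Proof. rewrite !mulnDr [(r + t) * e]mulnDl; lia. Qed.

(** The slack pays for the defects. From [2 * xu <= S] and [S <= mu * xu + xu] follows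
    [S <= 2 * mu * xu], so the value at an end exceeds that at the next joint by at most [2 * xu];
    and [2 * r * t + r + t] is at least twice [r + t]. *)
Lemma inner_arith (r t : nat) (mu S x0 xp c1 c2 xu B0 Bp : R) :
  0 < t -> 0 < r -> (0 < mu)%R ->
  (r%:R * c1 + t%:R * c2 + (2 * r * t + r + t)%N%:R * xu <=
     r%:R * B0 + t%:R * Bp + r%:R * x0 + t%:R * xp)%R ->
  (mu * x0 <= mu * c1 + S)%R -> (mu * xp <= mu * c2 + S)%R ->
  (2 * xu <= S)%R -> (S <= mu * xu + xu)%R -> (B0 < 0)%R -> (Bp < 0)%R -> (0 < xu)%R -> False.
Proof.
move=> t0 r0 mu0 main e0 ep Su eu s1 s2 xu0.
have [rp tp] : (0 < r%:R :> R)%R /\ (0 < t%:R :> R)%R by rewrite !ltr0n.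
have rt2 : (r%:R + t%:R <= (2 * r * t)%N%:R :> R)%R.
  rewrite -natrD ler_nat -mulnA mul2n -addnn; apply: leq_add; first by rewrite leq_pmulr.
  by rewrite leq_pmull.
move: main; rewrite -addnA !natrD.
set C : R := ((2 * r * t)%N%:R)%R in rt2 *; move: rp tp; set r' : R := (r%:R)%R; set t' : R := (t%:R)%R => rp tp main.
have b1 : (r' * B0 < 0)%R by rewrite pmulr_rlt0.
have b2 : (t' * Bp < 0)%R by rewrite pmulr_rlt0.
have m1 : (mu * (r' * c1 + t' * c2 + (C + (r' + t')) * xu) < mu * (r' * x0 + t' * xp))%R.
  by rewrite ltr_pM2l //; lra.
have f1 : (r' * (mu * x0) <= r' * (mu * c1 + S))%R by rewrite ler_pM2l.
have f2 : (t' * (mu * xp) <= t' * (mu * c2 + S))%R by rewrite ler_pM2l.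
have g0 : (0 < mu * xu)%R by rewrite mulr_gt0.
have g1 : (0 <= 2 * (mu * xu) - S)%R by lra.
have g2 : (0 <= (r' + t') * (2 * (mu * xu) - S))%R by apply: mulr_ge0; lra.
have g3 : (0 <= (C - (r' + t')) * (mu * xu))%R by apply: mulr_ge0; [lra | exact: ltW].
clear -m1 f1 f2 g2 g3; lra.
Qed.

Lemma move_inner p A t o : code_ok p A -> inner_anchors K p A ->
  0 < o < K -> 0 < t -> t.+1 < p -> t * K + o \in A ->
  (rho_code p A < rho_code p (mv (t * K + o) 0 A))%R \/
  (rho_code p A < rho_code p (mv (t * K + o) (p * K) A))%R.
Proof.
move=> ok inn oK t0 tp uA; set u := t * K + o in uA *.
have [x P] := code_perron K0 R m0 ok; have mu0 := perron_gt0 P.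
set mu := rho_code p A in P mu0 *.
have up : u <= p * K by case: ok => _; apply.
have lu : lo u = t by exact: lo_inner.
have hu : hi u = t.+1 by exact: hi_inner.
have ne s : u != s * K.
  by apply/negP => /eqP e; move: lu hu; rewrite e lo_mul // hi_mul // => ->; lia.
case: (move_bag ok P uA (leq0n _) (ne 0)) => [|s1]; first by left.
case: (move_bag ok P uA (leqnn _) (ne p)) => [|s2]; first by right.
(* There are [t] path edges before the edge of [u] and [r] after it; crosswise, the sum for the end
   0 gets weight [r] and that for the end [p] gets weight [t]. *)
exfalso; set r := p - t.+1; have pE : p = t + r + 1 by rewrite /r; lia.
have r0 : 0 < r by rewrite /r; lia.
pose S : R := (\sum_z x z)%R.
have xp z : (0 < x z)%R := perron_pos P z.
have spB s : s <= p * K -> vtx s \notin bag p A u by move=> sp; rewrite inE (vtxE ok sp) leafN.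
pose c1 := 1 * K; pose c2 := (t + r) * K.
have c1p : c1 <= p * K by apply: joint_leq; lia.
have c2p : c2 <= p * K by apply: joint_leq; lia.
have coef z : z \notin bag p A u ->
    (r + t) * cd p A (vtx u) z + r * ((z : nat) == c1) + t * ((z : nat) == c2)
      + (2 * r * t + r + t) * ((z : nat) == u) <=
    r * cd p A (vtx 0) z + t * cd p A (vtx (p * K)) z + r * ((z : nat) == 0) + t * ((z : nat) == p * K).
  move=> zB; rewrite -[vtx 0]/(vtx (0 * K)) !cd_joint // cd_spine //.
  have h3 := lo_hi K0 (pos p A z); have h2 := hi_pos z ok.
  have [->|uz] := eqVneq (z : nat) u.
    have -> : u == c1 = false by apply/negbTE; exact: ne.
    have -> : u == c2 = false by apply/negbTE; exact: ne.
    have -> : u == 0 = false by apply/negbTE; exact: (ne 0).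
    have -> : u == p * K = false by apply/negbTE; exact: ne.
    rewrite (posN _ up) leafN // pdii lu hu; rewrite pE.
    have -> : maxn (0 - t) (t.+1 - 0) = t.+1 by lia.
    have -> : maxn (t + r + 1 - t) (t.+1 - (t + r + 1)) = r.+1 by lia.
    nia.
  have pu : pos p A z != u.
    move: zB; rewrite inE negb_and; case: (boolP (leaf p z)) => //= lz _.
    by rewrite /pos (negPf lz).
  have -> : pd u (pos p A z) = maxn (t.+1 - lo (pos p A z)) (hi (pos p A z) - t).
    by rewrite pd_max 1?eq_sym // lu hu.
  have := @inner_coef t r (lo (pos p A z)) (hi (pos p A z)) t0 r0.
  have [hh1 hh2] : lo (pos p A z) <= hi (pos p A z) /\ hi (pos p A z) <= (lo (pos p A z)).+1 by lia.
  rewrite -pE => /(_ hh1 hh2 h2).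
  set l := lo _; set h := hi _; set e := (leaf p z : nat).
  have -> : maxn (0 - l) (h - 0) = h by rewrite /l /h; lia.
  have -> : maxn (p - l) (h - p) = p - l by rewrite /l /h; lia.
  have i1 : r * ((z : nat) == c1) <= r * (l + h == 2).
    rewrite leq_mul2l; apply/orP; right; case: eqP => // zc.
    by rewrite /l /h zc posN // lo_mul // hi_mul.
  have i2 : t * ((z : nat) == c2) <= t * (l + h == 2 * (t + r)).
    rewrite leq_mul2l; apply/orP; right; case: eqP => // zc.
    by rewrite /l /h zc posN // lo_mul // hi_mul // mul2n addnn eqxx.
  (* The normal form enters here: no pendant vertex projects to an end of the path, so the defect
     concerns the end vertex alone. *)
  have i3 : r * (h == 0) <= r * ((z : nat) == 0).
    rewrite leq_mul2l; apply/orP; right; case: (eqVneq h 0) => // h0.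
    have l0 : l = 0 by rewrite /l /h in h0 *; lia.
    have q0 := lohi_joint l0 h0; rewrite mul0n in q0.
    case: (boolP (leaf p z)) => lz.
      by have := inn _ (pos_leaf_mem ok lz); rewrite q0; lia.
    by move: q0; rewrite /pos (negPf lz) => ->.
  have i4 : t * (l == p) <= t * ((z : nat) == p * K).
    rewrite leq_mul2l; apply/orP; right; case: (eqVneq l p) => // lp.
    have hp : h = p by apply/anti_leq/andP; split; [exact: h2 | rewrite -[X in X <= _]lp].
    have q0 := lohi_joint lp hp.
    case: (boolP (leaf p z)) => lz.
      case/andP: (inn _ (pos_leaf_mem ok lz)) => _; rewrite q0 leq_pmul2r // leqNgt ltn_predL.
      by rewrite (leq_ltn_trans (leq0n _) tp).
    by move: q0; rewrite /pos (negPf lz) => ->; rewrite eqxx.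
  rewrite muln0 addn0; exact: combine_leq i1 i2 i3 i4.
pose bs (s : 'I_N) := (\sum_(z : 'I_N | z \notin bag p A u) x z * ((cd p A s z)%:R - (cd p A (vtx u) z)%:R))%R.
have single s : s <= p * K -> (\sum_(z : 'I_N | z \notin bag p A u) x z * ((z : nat) == s)%:R)%R = x (vtx s).
  move=> sp; rewrite (bigD1 (vtx s)) ?spB //= (vtxE ok sp) eqxx mulr1 big1 ?addr0 // => z /andP[_ zs].
  by case: eqP => [e|]; rewrite ?mulr0 //; case/eqP: zs; apply: val_inj; rewrite /= (vtxE ok sp).
have main : (r%:R * x (vtx c1) + t%:R * x (vtx c2) + (2 * r * t + r + t)%N%:R * x (vtx u) <=
   r%:R * bs (vtx 0) + t%:R * bs (vtx (p * K)) + r%:R * x (vtx 0) + t%:R * x (vtx (p * K)))%R.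
  rewrite -(single c1) // -(single c2) // -(single u) // -(single 0) // -(single (p * K)) //.
  rewrite /bs !mulr_sumr -!big_split /=; apply: ler_sum => z zB.
  have := coef z zB; rewrite -(ler_nat R) !natrD !natrM !natrD => h.
  have := ler_wpM2l (ltW (xp z)) h; lra.
have mono (y w : 'I_N) : (forall z, cd p A y z <= (cd p A w z).+1) -> (mu * x y <= mu * x w + S)%R.
  move=> h; rewrite -!(perron_eq P) /app /S -big_split /=; apply: ler_sum => z _.
  rewrite -[X in (_ <= _ + X)%R]mul1r -mulrDl; apply: ler_wpM2r; first exact: ltW.
  by rewrite natr1 ler_nat.
have e0 : (mu * x (vtx 0) <= mu * x (vtx c1) + S)%R.
  apply: mono => z; rewrite -[vtx 0]/(vtx (0 * K)) !cd_joint //; last by lia.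
  by have := lo_hi K0 (pos p A z); lia.
have ep : (mu * x (vtx (p * K)) <= mu * x (vtx c2) + S)%R.
  apply: mono => z; rewrite !cd_joint //; last by lia.
  by have := lo_hi K0 (pos p A z); have := hi_pos z ok; lia.
have [y yB] := bag_nonempty ok uA.
have yu : y != vtx u by apply: contraTN yB => /eqP->; exact: spB.
(* A pendant vertex is at least as far as its anchor from every vertex but itself; the two extra
   terms correct the diagonal entries. *)
have xyu : (x (vtx u) <= x y)%R.
  rewrite leNgt; apply/negP => lt.
  have : (mu * x (vtx u) + x (vtx u) - x y <= mu * x y)%R.
    rewrite -!(perron_eq P) /app -(sum_kron x (vtx u)) -(sum_kron x y) -sumrN -!big_split /=.
    apply: ler_sum => z _; rewrite -mulNr -!mulrDl; apply: ler_wpM2r; first exact: ltW.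
    rewrite /toR /kron lerBlDr -!natrD ler_nat.
    move: yB; rewrite inE => /andP[ly /eqP py].
    have [<-|yz] := eqVneq y z.
      by rewrite [vtx u == y]eq_sym (negPf yu) cd_spine // py pdii ly; exact: (leq_addl _ 1).
    have [<-|uz] := eqVneq (vtx u) z.
      have d0 : cd p A (vtx u) (vtx u) = 0 by rewrite /cd /cdist eqxx.
      have d1 : 0 < cd p A y (vtx u) by rewrite lt0n /cd cdist_eq0.
      by rewrite d0; exact: leq_trans d1 (leq_addr _ _).
    rewrite !addn0 cd_spine // /cd /cdist ly /= py.
    move: yz; rewrite -val_eqE => /negPf->.
    case: ifP => [/andP[lz /eqP e]|_]; last by rewrite leq_add2r leq_addr.
    by rewrite /pos lz -e; move: py; rewrite /pos ly => ->; rewrite pdii.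
  have : (mu * x y < mu * x (vtx u))%R by rewrite ltr_pM2l.
  lra.
have Su : (2 * x (vtx u) <= S)%R.
  have : (x (vtx u) + x y <= S)%R.
    rewrite /S (bigD1 (vtx u)) //= (bigD1 y) //= addrA lerDl; apply: sumr_ge0 => z _; exact: ltW.
  lra.
have eu : (S <= mu * x (vtx u) + x (vtx u))%R.
  rewrite -(perron_eq P) /app -[X in (_ <= _ + X)%R](sum_kron x (vtx u)) -big_split /=; apply: ler_sum => z _.
  rewrite -{1}[x z]mul1r -mulrDl; apply: ler_wpM2r; first exact: ltW.
  rewrite /toR /kron -natrD ler1n addn_gt0; case: (eqVneq (vtx u) z) => [_|ne']; rewrite ?orbT // orbF.
  by rewrite lt0n cdist_eq0.
have := xp (vtx u).
by move: t0 r0 mu0 main e0 ep Su eu s1 s2; exact: inner_arith.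
Qed.
End Moves.

(* A maximum principle: [psi] is convex where it is nonnegative, so a
   nonnegative value at [a] would propagate to [a']. *)
Lemma antisym_sequence_lt0 (R : realType) (psi gam : nat -> R) (kap al : R) (t0 a a' p : nat) :
  (0 <= kap < 1)%R -> (0 <= al)%R -> t0 < a -> a < a' -> a' <= p ->
  psi a' = (- psi a)%R ->
  ((1 + kap + al) * psi t0 < (1 - kap) * psi t0.+1)%R ->
  (forall t, t0 < t -> t < p -> (0 <= gam t)%R) ->
  (forall t, t0 < t -> t < p ->
     ((1 - kap) * (psi t.+1 + psi t.-1) = (2 + 2 * kap + gam t) * psi t)%R) ->
  (psi a < 0)%R.
Proof.
move=> /andP[k0 k1] al0 ta aa' ap anti e0 gam0 rec.
have k1' : (0 < 1 - kap)%R by rewrite subr_gt0.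
(* The increase into [t + 1] comes from the induction hypothesis, or is immediate if [psi t < 0];
   the recurrence passes it on because [kap] and [gam] are nonnegative. *)
have inc t : t0 <= t -> t < p -> (0 <= psi t)%R -> (psi t < psi t.+1)%R.
  elim: t => [|t IH] tt tp h.
    have t00 : t0 = 0 by lia.
    rewrite t00 in e0; rewrite -(ltr_pM2l k1'); apply: le_lt_trans e0.
    by apply: ler_wpM2r => //; lra.
  have [e|ne] := eqVneq t0 t.+1.
    rewrite e in e0; rewrite -(ltr_pM2l k1'); apply: le_lt_trans e0.
    by apply: ler_wpM2r => //; lra.
  have lt : (psi t < psi t.+1)%R.
    have [h'|h'] := leP 0%R (psi t); last exact: lt_le_trans h' h.
    by apply: IH => //; lia.
  rewrite -(ltr_pM2l k1').
  have := rec t.+1; rewrite /= => /(_ ltac:(lia) tp) r1.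
  have r2 : ((2 - 2 * kap) * psi t.+1 <= (2 + 2 * kap + gam t.+1) * psi t.+1)%R.
    by apply: ler_wpM2r => //; have := gam0 t.+1 ltac:(lia) tp; lra.
  have r3 : ((1 - kap) * psi t < (1 - kap) * psi t.+1)%R by rewrite ltr_pM2l.
  lra.
rewrite ltNge; apply/negP => pa.
have up d : a + d <= p -> (psi a <= psi (a + d)%N)%R /\ (0 < d -> (psi a < psi (a + d)%N)%R).
  elim: d => [|d IH] dp; first by rewrite addn0; split.
  have [|i1 _] := IH; first by lia.
  have i2 : (psi (a + d)%N < psi (a + d).+1)%R by apply: inc; [lia|lia|exact: le_trans pa i1].
  have i3 := le_lt_trans i1 i2.
  by rewrite addnS; split=> // ; exact: ltW.
have [_] := up (a' - a) ltac:(lia); rewrite subnKC; last exact: ltnW.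
rewrite subn_gt0 => /(_ aa'); rewrite anti; lra.
Qed.

(** * Balancing the two end groups of stars *)

Section Balance.
Variables (R : realType) (K m : nat).
Hypotheses (K0 : 0 < K) (m0 : 0 < m).
Local Notation N := (m * K).+1.
Local Notation cd := (@cd K m).
Local Notation hi := (hi K).
Local Notation lo := (lo K).
Local Notation pd := (pd K).
Local Notation pos := (pos K).
Local Notation leaf := (leaf K).
Local Notation blk := (blk K).
Local Notation code_ok := (code_ok K m).
Local Notation rho_code p A := (rho R (cgraph K m p A)).
Local Notation vtx := (@vtx K m).

Lemma card_block i : i < m -> #|[set v : 'I_N | in_block K i v]| = K.
Proof.
move=> im; have pok : par_ok K m (fun j => j * K) by [].
have iN : i * K < N by rewrite ltnS leq_mul2r ltnW ?orbT.
have := card_tree_edge K0 pok im.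
have -> : tree_edge K m (fun j => j * K) i = Ordinal iN |: [set v : 'I_N | in_block K i v].
  by apply/setP => v; rewrite !inE /edge_mem.
by rewrite cardsU1 inE /in_block ltnn add1n => -[].
Qed.

Lemma card_leaves p (A : seq nat) q : code_ok p A ->
  #|[set v : 'I_N | leaf p v && (pos p A v == q)]| = K * count_mem q A.
Proof.
move=> ok; have [s h] := ok.
have -> : #|[set v : 'I_N | leaf p v && (pos p A v == q)]| =
    \sum_(v : 'I_N) \sum_(i < m) in_block K i v * ((p <= i) && (nth 0 A (i - p) == q)).
  rewrite -sum1_card big_mkcond; apply: eq_bigr => v _; rewrite inE.
  have [v0|v0] := posnP v.
    by rewrite /leaf v0 /= big1 // => i _; rewrite /in_block v0.
  have bv := blockP K0 v0; have bm := in_block_lt K0 bv (ltn_ord v).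
  rewrite (bigD1 (Ordinal bm)) //= bv mul1n big1 ?addn0; last first.
    move=> i ne; rewrite (_ : in_block K i v = false) //; apply: contraNF ne => /(in_block_eq K0) e.
    by apply/eqP/val_inj; rewrite /= e.
  rewrite /pos /blk; have -> : leaf p v = (p <= (v : nat).-1 %/ K).
    apply/idP/idP => [lv|pv].
      rewrite -ltnS -(ltn_pmul2r K0); apply: leq_trans lv _; by case/andP: bv.
    case/andP: bv => bv _; apply: leq_ltn_trans bv.
    by rewrite leq_mul2r pv orbT.
  by case: (p <= _); case: (_ == q).
rewrite exchange_big /= -sum1_count big_distrr /=.
rewrite (big_nth 0) big_mkord.
have -> : \sum_(j < size A | nth 0 A j == q) K * 1 = \sum_(0 <= j < size A) K * (nth 0 A j == q).
  by rewrite big_mkord big_mkcond /=; apply: eq_bigr => j _; case: eqP; rewrite ?muln0.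
have -> : \sum_(i < m) \sum_(v : 'I_N) in_block K i v * ((p <= i) && (nth 0 A (i - p) == q)) =
   \sum_(i < m) K * ((p <= i) && (nth 0 A (i - p) == q)).
  apply: eq_bigr => i _; rewrite -big_distrl /=; congr (_ * _).
  rewrite -[RHS](card_block (ltn_ord i)) -sum1_card big_mkcond /=.
  by rewrite [RHS]big_mkcond; apply: eq_bigr => v _; rewrite inE; case: in_block.
rewrite -(big_mkord predT (fun i => K * ((p <= i) && (nth 0 A (i - p) == q)))) -s.
rewrite (big_cat_nat (n := p)) //=; last exact: leq_addr.
rewrite big_nat_cond big1 ?add0n; last by move=> i /andP[/andP[_ ip] _]; rewrite leqNgt ip muln0.
rewrite -{1}[p]add0n big_addn addKn; apply: eq_bigr => j _.
by rewrite addnK leq_addl.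
Qed.

Lemma card_inner s : s < m -> #|[set v : 'I_N | (lo v == s) && (hi v == s.+1)]| = K.-1.
Proof.
move=> sm; have sN : s.+1 * K < N by rewrite ltnS leq_mul2r sm orbT.
have := card_block sm; rewrite (cardsD1 (Ordinal sN)) inE /in_block /= leqnn ltn_pmul2r // ltnSn /=.
rewrite add1n => e; rewrite -[in RHS]e /=; apply: eq_card => v; rewrite !inE -val_eqE /=.
apply/andP/and3P => [[/eqP l /eqP h]|[ne h1 h2]].
  split.
  - by apply/eqP => e'; move: l; rewrite e' lo_mul //; lia.
  - rewrite ltnNge; apply/negP => h'; have := hi_leq K0 h'; lia.
  - by rewrite -h; exact: hi_mulr.
have lt : v < s.+1 * K by rewrite ltn_neqAle ne h2.
have := lo_leq K0 lt; have := lo_geq K0 (ltnW h1); have := hi_leq K0 h2; have := hi_geq K0 h1.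
by split; apply/eqP; lia.
Qed.


(** The distance to a fixed position is affine in [s] away from that position: the kink is 2 at a
    joint, and for a position inside an edge it is split evenly between the two joints of the
    edge. *)
Lemma joint_second_diff s l h : 0 < s -> l <= h <= l.+1 ->
  maxn (s.+1 - l) (h - s.+1) + maxn (s.-1 - l) (h - s.-1) =
  2 * maxn (s - l) (h - s) + 2 * ((l == s) && (h == s)) +
    ((l == s.-1) && (h == s.-1.+1)) + ((l == s) && (h == s.+1)).
Proof.
move=> s0 /andP[lh hl].
have [c|[[-> <-]|[[-> ->]|[[-> ->]|c]]]] :
  (h < s) \/ (h = s /\ l.+1 = s) \/ (h = s /\ l = s) \/ (h = s.+1 /\ l = s) \/ s < l by lia.
all: lia.
Qed.

Lemma inner_diff s l h : l <= h <= l.+1 ->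
  2 * maxn (s.+1 - l) (h - s) + ((l == s) && (h == s.+1)) =
  maxn (s - l) (h - s) + maxn (s.+1 - l) (h - s.+1) + 1.
Proof.
move=> /andP[lh hl].
have [c|[[-> ->]|c]] : h <= s \/ (h = s.+1 /\ l = s) \/ s < l by lia.
all: lia.
Qed.

(** A substitute for the second difference at [t], whose mirror image [p] has no joint beyond it.
    Positions left of [t] all help the right-hand side; only those at 0 and [t] are recorded. *)
Lemma end_diff t p l h : 0 < t -> t.+1 < p -> l <= h <= l.+1 -> h <= p ->
  maxn (t - l) (h - t) + maxn (p.-1 - l) (h - p.-1) + 2 * ((l == t) && (h == t))
    + 2 * ((l == 0) && (h == 0)) + ((l == t) && (h == t.+1)) <=
  maxn (t.+1 - l) (h - t.+1) + maxn (p - l) (h - p) + ((l == p.-1) && (h == p))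
    + 2 * ((l == p) && (h == p)).
Proof.
move=> t0 tp /andP[lh hl] hp.
have -> : maxn (p - l) (h - p) = p - l by lia.
have [[c c']|[[-> ->]|[[-> ->]|c]]] :
  (h <= t /\ l < t) \/ (h = t /\ l = t) \/ (h = t.+1 /\ l = t) \/ t < l by lia.
- have -> : maxn (p.-1 - l) (h - p.-1) = p.-1 - l by lia.
  have -> : maxn (t - l) (h - t) = t - l by lia.
  have -> : maxn (t.+1 - l) (h - t.+1) = t.+1 - l by lia.
  rewrite [l == t]ltn_eqF // [l == p.-1]ltn_eqF /=; last by lia.
  by rewrite [l == p]ltn_eqF /=; lia.
- by have -> : maxn (p.-1 - t) (t - p.-1) = p.-1 - t; lia.
- by have -> : maxn (p.-1 - t) (t.+1 - p.-1) = p.-1 - t; lia.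
have -> : maxn (t.+1 - l) (h - t.+1) = h - t.+1 by lia.
have -> : maxn (t - l) (h - t) = h - t by lia.
rewrite [l == t]gtn_eqF // [l == 0]gtn_eqF /=; last by lia.
have [e|e] : (h < p) \/ (h = p) by lia.
  by rewrite [h == p]ltn_eqF // !andbF /=; lia.
rewrite e eqxx !andbT; lia.
Qed.

(** The pattern of stars is symmetric about the middle of the gap, except that the star at [a] faces
    the empty joint [c]. *)
Lemma window_reflect a c r s : r + s = a + c -> s != a -> s != c ->
  ((r <= a) || (c.+1 <= r)) = ((s <= a) || (c.+1 <= s)).
Proof. lia. Qed.

(* [y] is the potential of [relocation_resolvent_lt]; reflecting the path by
   [s -> q - s] exchanges [a] and [a'] and leaves all the excess mass on the
   left of [t0 = a - b - 1], the mirror image of the end [p]. *)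
Section Potential.
Local Notation bag := (@bag K m).
Local Open Scope ring_scope.
Variables (p a b c : nat) (A : seq nat).
Hypothesis ok : code_ok p A.
Hypothesis joints : forall q : nat, q \in A -> exists s, [/\ (0 < s)%N, (s < p)%N & q = (s * K)%N].
Hypothesis counts : forall s, (0 < s < p)%N ->
  count_mem (s * K)%N A = (if (s <= a) || (p - b <= s) then c else 0)%N.
Hypotheses (ab : (b.+1 < a)%N) (abp : (a + b + 1 < p)%N).
Let a' := (p - b.+1)%N.
Local Notation u := (vtx (a * K)%N).
Local Notation w := (vtx (a' * K)%N).
Variables (y : 'I_N -> R) (mu beta : R).
Hypotheses (mu0 : 0 < mu).
Hypothesis yF : forall z, z \in bag p A (a * K) -> y z = 0.
Hypothesis yp : forall z : 'I_N, z \notin bag p A (a * K) -> 0 < y z.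
Hypothesis yeq : forall z : 'I_N, z \notin bag p A (a * K) ->
  mu * y z = \sum_v (cd p A z v)%:R * y v + beta * (2 + (cd p A u z)%:R + (cd p A w z)%:R).

Local Notation J s := (vtx (s * K)%N).
(** By [yeq], [mu * y] at joint [s] is [Psi s + beta * W s]. Since [W] is symmetric under the
    reflection, only [Psi] contributes to antisymmetric parts. *)
Let Psi s := \sum_v (cd p A (J s) v)%:R * y v.
Let W s : R := 2 + (cd p A u (J s))%:R + (cd p A w (J s))%:R.
Let L s := \sum_(v : 'I_N | leaf p v && (pos p A v == s * K)%N) y v.
Let I (s : nat) := \sum_(v : 'I_N | (lo v == s) && (hi v == s.+1)) y v.
Let S := \sum_v y v + 2 * beta.
Let q := (a + a')%N.
(** Summing [inner_eq] over the [K - 1] inner vertices of an edge and solving for their mass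
    produces this constant; it is 0 for ordinary graphs, where [K = 1]. *)
Let kap : R := (K.-1)%:R / (2 * mu + 2 + (K.-1)%:R).

Let y0 z : 0 <= y z.
Proof.
by have [zF|zF] := boolP (z \in bag p A (a * K)); [rewrite yF | apply/ltW/yp].
Qed.

Let sp s : (s <= p)%N -> (s * K <= p * K)%N. Proof. by move=> h; rewrite leq_mul2r h orbT. Qed.

Let J_F s : (s <= p)%N -> J s \notin bag p A (a * K).
Proof. by move=> h; rewrite inE (vtxE ok (sp h)) leafN ?sp. Qed.

Let yJ s : (s <= p)%N -> mu * y (J s) = Psi s + beta * W s.
Proof. by move=> h; rewrite yeq // J_F. Qed.

Let WE s : (s <= p)%N -> W s = 2 + (maxn (a - s) (s - a))%:R + (maxn (a' - s) (s - a'))%:R.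
Proof.
move=> h; have pJ : pos p A (J s) = (s * K)%N by rewrite posN (vtxE ok (sp h)) ?sp.
have lJ : leaf p (J s) = false by rewrite leafN // (vtxE ok (sp h)) sp.
by rewrite /W !cd_joint ?pJ ?lJ ?lo_mul ?hi_mul ?addn0 //; rewrite /a'; lia.
Qed.

Let W_sym s : (s <= p)%N -> (s <= q)%N -> (q - s <= p)%N -> W (q - s) = W s.
Proof.
move=> h1 h2 h3; rewrite !WE // -!addrA -!natrD. congr (1 + (1 + _%:R)).
by rewrite /q in h2 h3 *; clearbody a'; clear -h1 h2 h3; lia.
Qed.

Let joint_pos (z : 'I_N) : leaf p z -> lo (pos p A z) = hi (pos p A z).
Proof.
by move=> lz; have [s [_ _ ->]] := joints (pos_leaf_mem K0 ok lz); rewrite lo_mul // hi_mul.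
Qed.

Let nonleaf_pos (z : 'I_N) : leaf p z = false -> pos p A z = z.
Proof. by rewrite /pos => ->. Qed.

Let sum_ind (Q : pred 'I_N) : \sum_(v | Q v) y v = \sum_v (Q v)%:R * y v.
Proof. by rewrite big_mkcond; apply: eq_bigr => v _; case: (Q v); rewrite ?mul1r ?mul0r. Qed.

Let Psi_second s : (0 < s)%N -> (s < p)%N ->
  Psi s.+1 + Psi s.-1 = 2 * Psi s + 2 * y (J s) + 2 * L s + I s.-1 + I s.
Proof.
move=> s0 s1; rewrite /L /I !sum_ind -(sum_kron y (J s)) /Psi !mulr_sumr.
rewrite -!big_split /=; apply: eq_bigr => v _.
have e : (cd p A (J s.+1) v + cd p A (J s.-1) v = 2 * cd p A (J s) v + 2 * (J s == v)
   + 2 * (leaf p v && (pos p A v == s * K)) + ((lo v == s.-1) && (hi v == s.-1.+1))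
   + ((lo v == s) && (hi v == s.+1)))%N.
  have s2 : (s.-1 <= p)%N by apply: leq_trans (leq_pred s) (ltnW s1).
  rewrite !cd_joint ?(ltnW s1) // -val_eqE /= (vtxE ok (sp (ltnW s1))).
  have lh := lo_hi K0 (pos p A v).
  have pq : (pos p A v == s * K)%N = (lo (pos p A v) == s) && (hi (pos p A v) == s).
    apply/eqP/andP => [->|[/eqP l /eqP h]]; first by rewrite lo_mul // hi_mul.
    exact: lohi_joint.
  rewrite addnACA joint_second_diff //.
  have [lv|lv] := boolP (leaf p v).
    have jl := joint_pos lv; rewrite pq -jl.
    have -> : (s * K == v)%N = false.
      by apply/negbTE; rewrite neq_ltn (leq_ltn_trans (sp (ltnW s1)) lv).
    have h1 : (p <= lo v)%N by apply: lo_geq => //; exact: ltnW.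
    have h2 : (s < lo v)%N by exact: leq_trans s1 h1.
    rewrite (gtn_eqF h2) (gtn_eqF (leq_ltn_trans (leq_pred s) h2)).
    move: (lo (pos p A v)) => l.
    have -> : (l == s.-1) && (l == s.-1.+1) = false by case: eqP => // ->; rewrite eqn_leq ltnn andbF.
    have -> : (l == s) && (l == s.+1) = false by case: eqP => // ->; rewrite eqn_leq ltnn andbF.
    by move: (maxn _ _) ((l == s) && (l == s)) => M bb; clear; lia.
  move/negbTE: lv => lv; rewrite [(s * K)%N == v]eq_sym -pq (nonleaf_pos lv).
  by rewrite andFb /= !addn0 ?muln0 ?addn0.
rewrite !mul2n -!addnn in e; have := congr1 (GRing.natmul (1 : R)) e; rewrite !natrD => e'.
by rewrite -[LHS]mulrDl e' /kron; ring.
Qed.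

(** [v] is one step further than its joint from every vertex outside its block; the correction
    inside the block appears on the left. The same extra step towards both sources accounts for
    [2 * beta] in [S]. *)
Let leaf_eq s (v : 'I_N) : (0 < s)%N -> (s < p)%N -> s != a -> leaf p v -> pos p A v = (s * K)%N ->
  (mu + 1) * y v + \sum_(z : 'I_N | in_block K (blk v) z) y z = mu * y (J s) + S.
Proof.
move=> s0 s1 sa lv pv; have vF : v \notin bag p A (a * K).
  by rewrite inE lv pv eqn_pmul2r.
have spine x : (x <= p)%N -> cd p A (J x) v = (cd p A (J x) (J s)).+1.
  move=> xp; rewrite !cd_spine ?sp // pv lv posN ?(vtxE ok) ?sp ?leafN ?sp 1?ltnW //.
  by rewrite addn0 addn1.
have e z : (cd p A v z + (v == z) + in_block K (blk v) z = cd p A (J s) z + 1)%N.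
  have v0 : (0 < v)%N by apply: leq_ltn_trans lv.
  have bv := blockP K0 v0; rewrite -/(blk v) in bv.
  have bz : in_block K (blk v) z = leaf p z && (blk v == blk z).
    apply/idP/andP => [bz|[lz /eqP->]]; last by apply: blockP => //; apply: leq_ltn_trans lz.
    rewrite /blk (in_block_eq K0 bz) eqxx; split=> //.
    have [pb _] := leaf_index K0 ok lv; case/andP: bz => bz _.
    by apply: leq_ltn_trans bz; rewrite leq_mul2r pb orbT.
  rewrite bz cd_spine ?sp 1?ltnW // /cd /cdist lv /= -val_eqE.
  case: (eqVneq (val v) (val z)) => [e|ne] /=.
    by rewrite -e lv eqxx pv pdii.
  case: ifP => [/andP[lz /eqP bvz]|_]; last by rewrite pv; lia.
  by rewrite /pos lz -bvz; move: pv; rewrite /pos lv => ->; rewrite pdii.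
have sumE : \sum_z (cd p A v z)%:R * y z + (y v + \sum_(z : 'I_N | in_block K (blk v) z) y z) =
    Psi s + \sum_z y z.
  rewrite (sum_ind (fun z : 'I_N => in_block K (blk v) z)) -[X in _ + (X + _)](sum_kron y v).
  rewrite /Psi -!big_split /=; apply: eq_bigr => z _.
  have := congr1 (GRing.natmul (1 : R)) (e z); rewrite !natrD => e'.
  have -> : (cd p A (J s) z)%:R * y z + y z = ((cd p A (J s) z)%:R + 1) * y z by ring.
  by rewrite -e' /kron; ring.
rewrite mulrDl mul1r yeq // yJ ?(ltnW s1) // /S /W !spine //; try by rewrite /a'; lia.
rewrite -!natr1; move: sumE; lra.
Qed.

(** All vertices of a pendant block share the same block sum, so [leaf_eq] makes [y] constant on the
    block. *)
Let leaf_val s (v : 'I_N) : (0 < s)%N -> (s < p)%N -> s != a -> leaf p v -> pos p A v = (s * K)%N ->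
  (mu + 1 + K%:R) * y v = mu * y (J s) + S.
Proof.
move=> s0 s1 sa lv pv; rewrite -(leaf_eq s0 s1 sa lv pv) mulrDl; congr (_ + _).
have v0 : (0 < v)%N by apply: leq_ltn_trans lv.
have bv := blockP K0 v0; have bm := in_block_lt K0 bv (ltn_ord v).
have [pb _] := leaf_index K0 ok lv.
transitivity (\sum_(z in [set z : 'I_N | in_block K (blk v) z]) y v).
  by rewrite sumr_const card_block // mulr_natl.
rewrite big_mkcond [RHS]big_mkcond; apply: eq_bigr => z _; rewrite inE; case: ifP => // bz.
have bvz : blk z = blk v by rewrite /blk (in_block_eq K0 bz).
have lz : leaf p z.
  by case/andP: bz => bz _; apply: leq_ltn_trans bz; rewrite leq_mul2r pb orbT.
have pz : pos p A z = (s * K)%N by rewrite -pv /pos lz lv bvz.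
have := leaf_eq s0 s1 sa lz pz; rewrite bvz -(leaf_eq s0 s1 sa lv pv) => /addIr.
have m1 : mu + 1 != 0 by rewrite gt_eqF // ltr_wpDr.
by move/(mulfI m1) => ->.
Qed.

Let L_eq s : (0 < s)%N -> (s < p)%N -> s != a ->
  L s = (K * count_mem (s * K)%N A)%N%:R / (mu + 1 + K%:R) * (mu * y (J s) + S).
Proof.
move=> s0 s1 sa; have m1 : mu + 1 + K%:R != 0.
  by rewrite gt_eqF // ltr_wpDr ?ler0n // ltr_wpDr.
apply: (mulfI m1); rewrite mulrA [(_ + _) * (_ / _)]mulrC divfK //.
rewrite -(card_leaves _ ok) mulr_natl -sumr_const /L mulr_sumr big_mkcond [RHS]big_mkcond.
apply: eq_bigr => v _; rewrite inE; case: ifP => // /andP[lv /eqP pv].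
exact: leaf_val.
Qed.

Let L_a : L a = 0.
Proof. by rewrite /L big1 // => v vP; apply: yF; rewrite inE. Qed.

Let inner_eq s (v : 'I_N) : (s < p)%N -> lo v = s -> hi v = s.+1 ->
  (2 * mu + 2) * y v + I s = mu * y (J s) + mu * y (J s.+1) + S.
Proof.
move=> s1 lv hv.
have vp : (v <= p * K)%N by apply: leq_trans (hi_mulr K0 v) _; rewrite hv leq_mul2r s1 orbT.
have lf : leaf p v = false by exact: leafN.
have pv := nonleaf_pos lf.
have vF : v \notin bag p A (a * K) by rewrite inE lf.
have vj t : (v : nat) != (t * K)%N.
  apply/eqP => e; move: lv hv; rewrite e lo_mul // hi_mul // => -> /eqP; by rewrite -[X in X == _]addn0 -addn1 eqn_add2l.
have e z : (2 * cd p A v z + 2 * (v == z) + ((lo z == s) && (hi z == s.+1)) =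
    cd p A (J s) z + cd p A (J s.+1) z + 1)%N.
  rewrite !cd_joint ?(ltnW s1) // addnACA -[v == z]val_eqE /=.
  have id := inner_diff s (lo_hi K0 (pos p A z)).
  have [vz|vz] := eqVneq (v : nat) z.
    have d0 : cd p A v z = 0%N by rewrite /cd /cdist vz eqxx.
    move: id; rewrite d0 -(val_inj vz) pv lf lv hv !eqxx /=.
    by move=> _; rewrite !subSnn !subnn.
  have pz : v != pos p A z :> nat.
    rewrite /pos; case: ifP => // lz.
    by have [t [_ _ e]] := joints (pos_leaf_mem K0 ok lz); move: e; rewrite /pos lz => ->.
  rewrite /cd cdist_spine // pd_max // lv hv muln0 addn0 mulnDr -addnA [(_ * leaf p z + _)%N]addnC addnA.
  have ind : ((lo z == s) && (hi z == s.+1)) = ((lo (pos p A z) == s) && (hi (pos p A z) == s.+1)).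
    have [lz|/negbTE lz] := boolP (leaf p z); last by rewrite nonleaf_pos.
    have h1 : (p <= lo z)%N by apply: lo_geq => //; exact: ltnW.
    rewrite (gtn_eqF (leq_trans s1 h1)) -(joint_pos lz).
    by have [->|//] := eqVneq (lo (pos p A z)) s; rewrite [s == s.+1]ltn_eqF.
  by rewrite ind id mul2n -addnn addnAC.
have sumE : 2 * (\sum_z (cd p A v z)%:R * y z) + 2 * y v + I s = Psi s + Psi s.+1 + \sum_z y z.
  rewrite /I (sum_ind (fun z : 'I_N => (lo z == s) && (hi z == s.+1))) -(sum_kron y v) /Psi !mulr_sumr -!big_split /=; apply: eq_bigr => z _.
  have e1 := e z; rewrite !mul2n -!addnn in e1.
  have := congr1 (GRing.natmul (1 : R)) e1; rewrite !natrD => e'.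
  have -> : (cd p A (J s) z)%:R * y z + (cd p A (J s.+1) z)%:R * y z + y z =
    ((cd p A (J s) z)%:R + (cd p A (J s.+1) z)%:R + 1) * y z by ring.
  by rewrite -e' /kron; ring.
have dj t : (t <= p)%N -> 2 * (cd p A (J t) v)%:R =
    (cd p A (J t) (J s))%:R + (cd p A (J t) (J s.+1))%:R + 1 :> R.
  move=> tp; have := e (J t); rewrite -val_eqE /= (vtxE ok (sp tp)) (negPf (vj t)).
  have -> : ((lo (t * K) == s) && (hi (t * K) == s.+1))%N = false.
    by rewrite lo_mul // hi_mul //; have [->|//] := eqVneq t s; rewrite [s == s.+1]ltn_eqF.
  rewrite !addn0 /cd (cdistC _ _ _ v) (cdistC _ _ _ (J s)) (cdistC _ _ _ (J s.+1)) mul2n -addnn => e1.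
  have := congr1 (GRing.natmul (1 : R)) e1; rewrite !natrD => <-; ring.
have du := dj a; have dw := dj a'.
have ap : (a <= p)%N by clear -abp; lia.
have a'p : (a' <= p)%N by rewrite /a' leq_subr.
move: (du ap) (dw a'p) => {}du {}dw.
have yv : 2 * mu * y v = 2 * (\sum_z (cd p A v z)%:R * y z)
    + beta * (4 + 2 * (cd p A u v)%:R + 2 * (cd p A w v)%:R).
  by rewrite -mulrA yeq //; ring.
rewrite mulrDl yv du dw !yJ ?(ltnW s1) // /W /S; move: sumE; lra.
Qed.

Let I_eq s : (s < p)%N -> I s = kap * (mu * y (J s) + mu * y (J s.+1) + S).
Proof.
move=> s1; have sm : (s < m)%N by case: ok => <- _; apply: ltn_addr.
have k0 : 0 <= (K.-1)%:R :> R by exact: ler0n.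
have m1 : 2 * mu + 2 + (K.-1)%:R != 0 by rewrite gt_eqF // ltr_wpDr // addr_gt0 ?mulr_gt0.
apply: (mulfI m1); rewrite /kap mulrA [(_ + _) * (_ / _)]mulrC divfK // mulrDl.
have : (2 * mu + 2) * I s + (K.-1)%:R * I s = (K.-1)%:R * (mu * y (J s) + mu * y (J s.+1) + S).
  rewrite -(card_inner sm) [_%:R * I s]mulr_natl [RHS]mulr_natl -!sumr_const {1}/I mulr_sumr big_mkcond.
  rewrite [X in _ + X]big_mkcond [RHS]big_mkcond -big_split; apply: eq_bigr => v _ /=.
  rewrite inE; case: ifP => [/andP[/eqP l /eqP h]|_]; last by rewrite addr0.
  exact: inner_eq.
by [].
Qed.

Let t0 := (a - b.+1)%N.

Let q_t0 : q = (t0 + p)%N.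
Proof. by rewrite /q /a' /t0; move: ab abp => h1 h2; lia. Qed.

(** Here the imbalance enters: the joint 0 lies strictly left of [t0], and its mass makes the
    boundary inequality strict. *)
Let t0_gt0 : (0 < t0)%N. Proof. by rewrite /t0; move: ab => h1; lia. Qed.
Let t0_ltp : (t0.+1 < p)%N. Proof. by rewrite /t0; move: ab abp => h1 h2; lia. Qed.

Let Psi_end :
  Psi t0 + Psi p.-1 + 2 * y (J t0) + 2 * y (J 0) + I t0 <= Psi t0.+1 + Psi p + I p.-1 + 2 * y (J p).
Proof.
have tp := t0_ltp; have t00 := t0_gt0.
have pp : p.-1.+1 = p by apply: prednK; apply: leq_ltn_trans tp.
rewrite /I !sum_ind -(sum_kron y (J t0)) -(sum_kron y (J 0)) -(sum_kron y (J p)) /Psi !mulr_sumr.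
rewrite -!big_split /=; apply: ler_sum => v _.
have e : (cd p A (J t0) v + cd p A (J p.-1) v + 2 * (J t0 == v) + 2 * (J 0 == v)
    + ((lo v == t0) && (hi v == t0.+1)) <=
  cd p A (J t0.+1) v + cd p A (J p) v + ((lo v == p.-1) && (hi v == p.-1.+1)) + 2 * (J p == v))%N.
  have t0p : (t0 <= p)%N by exact: ltnW (ltnW tp).
  rewrite !cd_joint ?leq_pred ?(ltnW tp) // addnACA [X in (_ <= X + _ + _)%N]addnACA.
  rewrite -!val_eqE /= !(vtxE ok (sp _)) // pp.
  have lh := lo_hi K0 (pos p A v); have hp := hi_pos K0 v ok.
  have := end_diff t00 tp lh hp.
  have [lv|lv] := boolP (leaf p v).
    have [s [s0 s1 pv]] := joints (pos_leaf_mem K0 ok lv).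
    have nj t : (t <= p)%N -> (t * K == v)%N = false.
      by move=> tp'; rewrite ltn_eqF // (leq_ltn_trans (sp tp') lv).
    have h1 : (p <= lo v)%N by apply: lo_geq => //; exact: ltnW.
    rewrite !nj // pv lo_mul // hi_mul //.
    have -> : (lo v == t0) = false by rewrite gtn_eqF // (leq_trans (ltnW tp) h1).
    have pl : (p.-1 < p)%N by rewrite -[X in (_ < X)%N]pp.
    have -> : (lo v == p.-1) = false by rewrite gtn_eqF // (leq_trans pl h1).
    rewrite (ltn_eqF s1) andbF.
    move: (maxn _ _) (maxn _ _) (maxn _ _) (maxn _ _) => M1 M2 M3 M4.
    move: ((s == t0) && (s == t0)) ((s == 0%N) && (s == 0%N)) ((s == t0) && (s == t0.+1)) => b1 b2 b3.
    clear; rewrite /=; lia.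
  move/negbTE: lv => lv; rewrite (nonleaf_pos lv).
  have pq t : (t * K == v)%N = (lo v == t) && (hi v == t).
    rewrite eq_sym; apply/eqP/andP => [->|[/eqP l /eqP h]]; first by rewrite lo_mul // hi_mul.
    exact: lohi_joint.
  by rewrite !pq /= !addn0.
rewrite !mul2n -!addnn -(ler_nat R) !natrD in e; have := ler_wpM2r (y0 v) e.
rewrite /kron; lra.
Qed.

Lemma balance_potential : y u < y w.
Proof.
pose psi s := Psi s - Psi (q - s)%N.
have mu1 : mu != 0 by rewrite gt_eqF.
have tp := t0_ltp; have t00 := t0_gt0.
(* Between [t0] and [p] both [s] and its mirror image are joints, and the source terms cancel. *)
have psiE s : (t0 <= s)%N -> (s <= p)%N -> psi s = mu * y (J s) - mu * y (J (q - s)).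
  move=> h1 h2; have h3 : (q - s <= p)%N by rewrite q_t0 leq_subLR leq_add2r.
  have h4 : (s <= q)%N by rewrite q_t0; apply: leq_trans h2 (leq_addl _ _).
  by rewrite !yJ // W_sym // /psi; ring.
have k0 : 0 <= (K.-1)%:R :> R by exact: ler0n.
have dpos : 0 < 2 * mu + 2 + (K.-1)%:R by rewrite ltr_wpDr // addr_gt0 ?mulr_gt0.
have kap01 : 0 <= kap < 1.
  rewrite /kap; apply/andP; split; first by rewrite divr_ge0 // ltW.
  by rewrite ltr_pdivrMr // mul1r ltrDr addr_gt0 ?mulr_gt0.
(* The part [2 / mu] comes from the joint itself, the rest from its pendant vertices through [L_eq];
   at [a] the star has been deleted and at [a'] there is none. *)
pose gam s : R := 2 / mu + 2 * (if (s == a) || (s == a') then 0 else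
  (K * count_mem (s * K)%N A)%N%:R / (mu + 1 + K%:R)).
have aa' : (a < a')%N by rewrite /a'; move: abp => h; lia.
have a'p : (a' <= p)%N by rewrite /a' leq_subr.
have ta : (t0 < a)%N by rewrite /t0; move: ab => h; lia.
have qa : (q - a = a')%N by rewrite /q addKn.
have qa' : (q - a' = a)%N by rewrite /q addnK.
suff : psi a < 0.
  have ap : (a <= p)%N by exact: ltnW (leq_trans aa' a'p).
  rewrite psiE // 1?ltnW // qa subr_lt0 ltr_pM2l //.
apply: (@antisym_sequence_lt0 R psi gam kap (2 / mu) t0 a a' p) => //.
- by rewrite divr_ge0 // ltW.
- by rewrite /psi qa qa' opprB.
- have := Psi_end.
  have t0p : (t0 < p)%N by exact: ltn_trans (ltnSn _) tp.
  have pp : p.-1.+1 = p by apply: prednK; apply: leq_ltn_trans tp.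
  have pl : (p.-1 < p)%N by rewrite -[X in (_ < X)%N]pp.
  rewrite (I_eq t0p) (I_eq pl) pp.
  have e1 : (q - t0 = p)%N by rewrite q_t0 addKn.
  have e2 : (q - t0.+1 = p.-1)%N by rewrite q_t0 -subn1 -[in RHS](addKn t0 p) -subnDA addn1.
  have := psiE t0 (leqnn _) (ltnW t0p); have := psiE t0.+1 (leqnSn _) (ltnW tp).
  rewrite /psi e1 e2 => h1 h2 h3.
  have y00 : 0 < y (J 0) by apply: yp; exact: J_F.
  have h4 : 2 / mu * (mu * y (J t0) - mu * y (J p)) = 2 * y (J t0) - 2 * y (J p).
    by rewrite mulrBr !mulrA divfK.
  have h5 : kap * (mu * y (J t0) + mu * y (J t0.+1) + S) - kap * (mu * y (J p.-1) + mu * y (J p) + S)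
     = kap * ((Psi t0 - Psi p) + (Psi t0.+1 - Psi p.-1)) by rewrite h1 h2; ring.
  have -> : (1 + kap + 2 / mu) * (Psi t0 - Psi p) = (1 + kap) * (Psi t0 - Psi p) + 2 / mu * (Psi t0 - Psi p) by rewrite mulrDl.
  rewrite {2}h2 h4; move: h3 h5; move: (kap * (_ + _ + S)) (kap * (_ + _ + S)) => X1 X2.
  lra.
- move=> s s0 s1; rewrite /gam; apply: addr_ge0; first by rewrite divr_ge0 // ltW.
  apply: mulr_ge0 => //; case: ifP => // _; apply: divr_ge0; first exact: ler0n.
  by rewrite addr_ge0 ?ler0n // addr_ge0 // ltW.
move=> s ts s1.
have s0 : (0 < s)%N by exact: leq_ltn_trans ts.
pose r := (q - s)%N.
have r0 : (0 < r)%N by rewrite /r q_t0 subn_gt0; apply: leq_trans s1 (leq_addl _ _).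
have rp : (r < p)%N by rewrite /r q_t0 ltn_subLR ?ltn_add2r //; apply: leq_trans (ltnW s1) (leq_addl _ _).
have rs : (q - s.+1 = r.-1)%N by rewrite /r subnS.
have rs' : (q - s.-1 = r.+1)%N.
  rewrite /r -[in RHS](prednK s0) -subSn ?subSS //.
  by rewrite (prednK s0) q_t0; apply: leq_trans (ltnW s1) (leq_addl _ _).
have P1 := Psi_second s0 s1; have P2 := Psi_second r0 rp.
have sm1 : (s.-1 < p)%N by apply: leq_ltn_trans (leq_pred _) s1.
have rm1 : (r.-1 < p)%N by apply: leq_ltn_trans (leq_pred _) rp.
rewrite (I_eq s1) (I_eq sm1) (prednK s0) in P1.
rewrite (I_eq rp) (I_eq rm1) (prednK r0) in P2.
have p0 := psiE s (ltnW ts) (ltnW s1).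
have p1 := psiE s.+1 (leqW (ltnW ts)) s1.
have tsm : (t0 <= s.-1)%N by rewrite -ltnS (prednK s0).
have p2 := psiE s.-1 tsm (ltnW sm1).
rewrite rs in p1; rewrite rs' in p2; rewrite -/r in p0.
have LL : L s - L r = (if (s == a) || (s == a') then 0 else
    (K * count_mem (s * K)%N A)%N%:R / (mu + 1 + K%:R)) * psi s.
  have La' : L a' = 0.
    rewrite L_eq ?(leq_ltn_trans (leq0n a)) //; last by rewrite gtn_eqF.
      rewrite counts; last by rewrite (leq_ltn_trans (leq0n a)) // /a' ltn_subrL; lia.
      have -> : ((a' <= a) || (p - b <= a'))%N = false by rewrite /a'; move: aa'; rewrite /a' => h; lia.
      by rewrite muln0 mul0r mul0r.
    by rewrite /a' ltn_subrL; lia.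
  have [sa|sa] := eqVneq s a; first by rewrite /r sa qa L_a La' subr0 mul0r.
  have [sa'|sa'] := eqVneq s a'; first by rewrite /r sa' qa' L_a La' subr0 mul0r.
  have rsum : (r + s = a + a')%N.
    by rewrite /r subnK // q_t0; apply: leq_trans (ltnW s1) (leq_addl _ _).
  have ra : r != a by apply: contra sa' => /eqP e; move: rsum; rewrite e => /addnI->.
  rewrite /= (L_eq s0 s1 sa) (L_eq r0 rp ra) !counts ?r0 ?s0 ?rp ?s1 //.
  have -> : ((r <= a) || (p - b <= r) = ((s <= a) || (p - b <= s)))%N.
    have pb : (p - b = a'.+1)%N by rewrite /a' subnSK //; move: abp => h; lia.
    by rewrite pb; exact: window_reflect rsum sa sa'.
  by rewrite p0; ring.
have e1 : 2 * (y (J s) - y (J r)) = 2 / mu * psi s.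
  by rewrite p0 mulrBr mulrBr !mulrA !divfK.
have e3 : gam s * psi s = 2 * (y (J s) - y (J r)) + 2 * (L s - L r).
  by rewrite /gam e1 LL mulrDl mulrA.
rewrite [RHS]mulrDl e3.
have e2 : psi s.+1 + psi s.-1 = 2 * psi s + 2 * (y (J s) - y (J r)) + 2 * (L s - L r)
   + kap * ((mu * y (J s.-1) - mu * y (J r.+1)) + 2 * (mu * y (J s) - mu * y (J r)) + (mu * y (J s.+1) - mu * y (J r.-1))).
  have -> : psi s.+1 = Psi s.+1 - Psi r.-1 by rewrite /psi rs.
  have -> : psi s.-1 = Psi s.-1 - Psi r.+1 by rewrite /psi rs'.
  have -> : psi s = Psi s - Psi r by [].
  have -> : Psi s.+1 - Psi r.-1 + (Psi s.-1 - Psi r.+1) = (Psi s.+1 + Psi s.-1) - (Psi r.+1 + Psi r.-1) by ring.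
  by rewrite P1 P2; ring.
move: e2; rewrite -p0 -p1 -p2; move: (y (J s) - y (J r)) (L s - L r) => Y LL' e2.
have -> : (1 - kap) * (psi s.+1 + psi s.-1) = (psi s.+1 + psi s.-1) - kap * (psi s.+1 + psi s.-1) by ring.
rewrite {1}e2; ring.
Qed.

End Potential.

Lemma move_balance p a b c (A : seq nat) : code_ok p A ->
  (forall q : nat, q \in A -> exists s, [/\ 0 < s, s < p & q = s * K]) ->
  (forall s, 0 < s < p -> count_mem (s * K) A = if (s <= a) || (p - b <= s) then c else 0) ->
  0 < c -> b.+1 < a -> a + b + 1 < p ->
  (rho_code p A < rho_code p (mv (a * K)%N ((p - b.+1) * K)%N A))%R.
Proof.
move=> ok joints counts c0 ab abp; have [x P] := code_perron K0 R m0 ok.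
have ap : a < p by lia.
have aA : a * K \in A.
  by rewrite -has_pred1 has_count counts ?leqnn // ap andbT; lia.
have aK : a * K <= p * K by rewrite leq_mul2r ltnW ?orbT.
have wK : (p - b.+1) * K <= p * K by rewrite leq_mul2r leq_subr orbT.
have uw : a * K != (p - b.+1) * K by rewrite eqn_pmul2r // neq_ltn; apply/orP; left; lia.
have rel := bag_relocation K0 ok aK wK uw.
have [x' P'] := code_perron K0 R m0 (code_ok_mv (a * K) ok wK).
have [f0 ff] := bag_nonempty K0 m0 ok aA.
apply: (relocation_resolvent_lt rel (cd_metric K0 _ _ _) (cd_metric K0 _ _ _) P P' ff).
move=> y beta b0 yF yp yeq.
exact: (balance_potential ok joints counts ab abp (perron_gt0 P) yF yp yeq).
Qed.
End Balance.

Lemma hiso_code_lhg K m p (B : seq nat) (V : finType) (E : {set {set V}}) :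
  0 < K -> p + size B = m -> hiso E (cgraph K m p B) <-> hiso E (hg (code_lhg K p B)).
Proof. by move=> K0 <-; rewrite hg_code. Qed.

Lemma card_above_lt (R : realType) (T : finType) (f : T -> R) (G : T) (x : R) :
  (x < f G)%R -> #|[set t | (f G < f t)%R]| < #|[set t | (x < f t)%R]|.
Proof.
move=> lt; apply: proper_card; apply/properP; split.
  by apply/subsetP => t; rewrite !inE; exact: lt_trans.
by exists G; rewrite !inE ?ltxx.
Qed.

(** * Extremal caterpillars *)

Section Extremal.
Variables (R : realType) (K m Delta n : nat).
Hypotheses (K0 : 0 < K) (m0 : 0 < m) (D3 : 2 < Delta) (n2 : 1 < n).
Local Notation N := (m * K).+1.
Local Notation code_ok := (code_ok K m).
Local Notation cgr := (cgraph K m).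
Local Notation rho_code p A := (rho R (cgraph K m p A)).
Local Notation vtx := (@vtx K m).
Local Notation base := (base K).

Definition admissible p (A : seq nat) := code_ok p A /\ deg_profile (cgr p A) Delta n.

Lemma count_mv (u w : nat) (A : seq nat) (x : nat) : u != w -> w \notin A ->
  count_mem x (mv u w A) = if x == u then 0 else if x == w then count_mem u A else count_mem x A.
Proof.
move=> uw wA; rewrite count_map; have [->|xu] := eqVneq x u.
  rewrite (@eq_count _ _ pred0) ?count_pred0 // => a /=.
  by case: (eqVneq a u) => [_|/negPf //]; rewrite eq_sym (negPf uw).
have [->|xw] := eqVneq x w.
  apply: eq_in_count => a aA /=; case: (eqVneq a u) => [_|_]; first by rewrite eqxx.
  by apply: contraNF wA => /eqP<-.
apply: eq_count => a /=; case: (eqVneq a u) => [->|//].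
by rewrite [w == x]eq_sym (negPf xw) eq_sym (negPf xu).
Qed.

(** A whole star goes to an empty vertex of the same path degree, so the degrees are permuted by the
    transposition of [u] and [w]. *)
Lemma admissible_mv p A u w : admissible p A -> u <= p * K -> w <= p * K -> u != w ->
  w \notin A -> base p u = base p w -> admissible p (mv u w A).
Proof.
move=> [ok [h1 h2]] up wp uw wA buw.
have ok' := code_ok_mv u ok wp; split=> //.
pose s : {perm 'I_N} := tperm (vtx u) (vtx w).
have dE x : deg (cgr p (mv u w A)) (s x) = deg (cgr p A) x.
  rewrite !deg_code // !count_mv //; have cw : count_mem w A = 0 by apply/count_memPn.
  rewrite /s; case: tpermP => [->|->|/eqP xu /eqP xw].
  - by rewrite (vtxE ok up) (vtxE ok wp) [w == u]eq_sym (negPf uw) eqxx buw.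
  - by rewrite (vtxE ok up) (vtxE ok wp) eqxx cw buw.
  - rewrite -val_eqE /= (vtxE ok up) in xu; rewrite -val_eqE /= (vtxE ok wp) in xw.
    by rewrite (negPf xu) (negPf xw).
split=> [x|]; first by rewrite -(permKV s x) dE.
rewrite -h2 -[RHS](card_imset _ (@perm_inj _ s)); apply: eq_card => x; rewrite [in LHS]inE.
apply/eqP/imsetP => [e|[y]]; last by rewrite inE => /eqP e ->; rewrite dE.
by exists ((s^-1)%g x); rewrite ?permKV // inE -dE permKV e.
Qed.

Lemma admissible_hiso p A p' A' : admissible p A -> code_ok p' A' ->
  hiso (cgr p A) (cgr p' A') -> admissible p' A'.
Proof. by move=> [_ h] ok' iso; split=> //; exact: hiso_deg_profile iso h. Qed.

(** Neither vertex has degree [Delta] before or after: the joint was below it and drops further, and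
    [w] reaches degree 2. *)
Lemma admissible_single p t w (B : seq nat) : admissible p (t * K :: B) -> 0 < t < p ->
  w <= p * K -> w != t * K -> base p w = 1 -> w \notin B ->
  2 + count_mem (t * K) (t * K :: B) < Delta -> admissible p (w :: B).
Proof.
move=> [ok [h1 h2]] /andP[t0 tp] wp wt bw wB cD; have [s h] := ok.
have ok' : code_ok p (w :: B).
  split=> // a; rewrite inE => /orP[/eqP-> //|aB]; apply: h; by rewrite inE aB orbT.
have bt : base p (t * K) = 2 by rewrite base_mul // t0 tp.
have cw : count_mem w B = 0 by apply/count_memPn.
have dE x : (deg (cgr p (w :: B)) x <= Delta) /\
    ((deg (cgr p (w :: B)) x == Delta) = (deg (cgr p (t * K :: B)) x == Delta)).
  have := h1 x; rewrite !deg_code //=.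
  have [xt|xt] := eqVneq (x : nat) (t * K).
    by rewrite xt (negPf wt) bt; move: cD; rewrite /= eqxx; lia.
  have [xw|xw] := eqVneq (x : nat) w.
    by rewrite xw bw cw; clear -D3; lia.
  by [].
split=> //; split=> [x|]; first by case: (dE x).
by rewrite -h2; apply: eq_card => x; rewrite !inE; case: (dE x).
Qed.

Definition window_code p a b : seq nat :=
  flatten [seq nseq (Delta - 2) (i * K) | i <- iota 1 (p - 1) & (i <= a) || (p - b <= i)].

Lemma Ck_code p a b : Ck K.+1 p Delta a b = code_lhg K p (window_code p a b).
Proof. by rewrite /Ck cat_graphE // -map_comp subSS subn0. Qed.

Lemma count_window p a b : a + b < p ->
  count (fun i => (i <= a) || (p - b <= i)) (iota 1 (p - 1)) = a + b.
Proof.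
move=> abp; have -> : p - 1 = a + ((p - 1 - a - b) + b) by lia.
rewrite !iotaD !count_cat; set f := fun i => _.
have c1 : count f (iota 1 a) = a.
  rewrite -[RHS](size_iota 1); apply/eqP; rewrite -all_count; apply/allP => i.
  by rewrite mem_iota /f; lia.
have c2 : count f (iota (1 + a) (p - 1 - a - b)) = 0.
  rewrite (@eq_in_count _ _ pred0) ?count_pred0 // => i.
  by rewrite mem_iota /f /=; lia.
have c3 : count f (iota (1 + a + (p - 1 - a - b)) b) = b.
  rewrite -[RHS](size_iota (1 + a + (p - 1 - a - b))); apply/eqP; rewrite -all_count; apply/allP => i.
  by rewrite mem_iota /f; lia.
by rewrite c1 c2 c3.
Qed.

Lemma size_window p a b : a + b < p -> size (window_code p a b) = (a + b) * (Delta - 2).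
Proof.
move=> abp; rewrite /window_code -(count_window abp) -size_filter; elim: (filter _ _) => //= i s IH.
by rewrite size_cat size_nseq IH mulSn.
Qed.

Lemma count_window_code p a b s : 0 < s < p ->
  count_mem (s * K) (window_code p a b) = if (s <= a) || (p - b <= s) then Delta - 2 else 0.
Proof.
move=> sp; pose f i := (i <= a) || (p - b <= i).
have e (l : seq nat) : uniq l -> count_mem (s * K) (flatten [seq nseq (Delta - 2) (i * K) | i <- l & f i]) =
    if (s \in l) && f s then Delta - 2 else 0.
  elim: l => //= i l IH /andP[il ul]; rewrite inE.
  move: il; have [<-|si] := eqVneq s i => il.
    case: (f s) => /=; last by rewrite IH // (negPf il).
    by rewrite count_cat count_nseq /= eqxx mul1n IH // (negPf il) addn0.
  case: (f i) => /=; last exact: IH.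
  by rewrite count_cat count_nseq /= eqn_pmul2r // eq_sym (negPf si) mul0n IH.
by rewrite /window_code e ?iota_uniq // mem_iota; have -> : 0 < s < 1 + (p - 1) by lia.
Qed.

Lemma window_code_joint p a b x : x \in window_code p a b ->
  exists s, 0 < s < p /\ x = s * K.
Proof.
case/flatten_mapP => s; rewrite mem_filter mem_iota => /andP[_ h].
by rewrite mem_nseq => /andP[_ /eqP->]; exists s; split=> //; lia.
Qed.

Lemma perm_window p a b (A : seq nat) :
  (forall q : nat, q \in A -> exists s, [/\ 0 < s, s < p & q = s * K]) ->
  (forall s, 0 < s < p -> count_mem (s * K) A = if (s <= a) || (p - b <= s) then Delta - 2 else 0) ->
  perm_eq A (window_code p a b).
Proof.
move=> joints counts; apply/allP => x; rewrite mem_cat => xin /=.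
have [s [sp ->]] : exists s, 0 < s < p /\ x = s * K.
  case/orP: xin; last exact: window_code_joint.
  by move/joints => [s [h1 h2 h3]]; exists s; rewrite h1 h2.
by rewrite counts // count_window_code.
Qed.

Local Notation C := (Ck K.+1 (m - n * (Delta - 2)) Delta n./2 (uphalf n)).

Lemma hiso_extremal p A a b : code_ok p A -> a + b = n -> n < p ->
  (forall q : nat, q \in A -> exists s, [/\ 0 < s, s < p & q = s * K]) ->
  (forall s, 0 < s < p -> count_mem (s * K) A = if (s <= a) || (p - b <= s) then Delta - 2 else 0) ->
  a = n./2 -> b = uphalf n -> hiso (cgr p A) (hg C).
Proof.
move=> ok abn np joints counts ae be.
have pm := perm_window joints counts; have [s _] := ok.
have abp : a + b < p by rewrite abn.
rewrite (perm_size pm) size_window // abn in s.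
(* The origin of [mstar]: the path consists of the edges left over by [n] stars with [Delta - 2]
   edges each. *)
have -> : m - n * (Delta - 2) = p by rewrite -s addnK.
have sm : p + size (window_code p a b) = m by rewrite size_window // abn.
rewrite -ae -be Ck_code; apply: (proj1 (hiso_code_lhg (cgr p A) K0 sm)).
exact: hiso_perm.
Qed.


Lemma rho_code_hiso p A p' A' : code_ok p A -> hiso (cgr p A) (cgr p' A') ->
  rho_code p A = rho_code p' A'.
Proof. exact: rho_hiso_code. Qed.

(** The better code need not be in normal form; it is normalised again in the next round. *)
Definition improvable p (A : seq nat) :=
  exists p' A', admissible p' A' /\ (rho_code p A < rho_code p' A')%R.

Definition joint_anchors p (A : seq nat) :=
  forall q : nat, q \in A -> exists s, [/\ 0 < s, s < p & q = s * K].

(** The ends have path degree 1, like every vertex inside an edge, and are free in normal form, so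
    either destination preserves the degree profile. *)
Lemma improve_inner p A u : admissible p A -> 0 < p -> inner_anchors K p A ->
  u \in A -> ~~ (K %| u) -> improvable p A.
Proof.
move=> adm p0 inn uA Ku; have [ok _] := adm.
have /andP[u1 u2] := inn _ uA.
pose t := u %/ K; pose o := u %% K.
have ue : u = t * K + o by exact: divn_eq.
have oK : 0 < o < K by rewrite /o ltn_pmod // lt0n; move: Ku; rewrite /dvdn => ->.
have t0 : 0 < t by rewrite /t divn_gt0.
have tp : t.+1 < p.
  have : t * K < p.-1 * K by apply: leq_trans u2; rewrite [X in _ < X]ue; case/andP: oK => h _; rewrite -[X in X < _]addn0 ltn_add2l.
  by rewrite ltn_pmul2r //; lia.
have pK : p.-1 * K < p * K by rewrite ltn_pmul2r // prednK.
have z1 : 0 \notin A by apply/negP => /inn; lia.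
have z2 : p * K \notin A by apply/negP => /inn; lia.
have up : u <= p * K by exact: leq_trans u2 (ltnW pK).
have bu : base p u = 1 by rewrite ue base_inner.
rewrite ue in uA; have := move_inner R K0 m0 ok inn oK t0 tp uA; rewrite -ue.
case=> lt; do 2!eexists; (split; last exact: lt); apply: admissible_mv => //.
- by apply: contraNneq Ku => ->; rewrite dvdn0.
- by rewrite bu base0.
- by apply: contraNneq Ku => ->; rewrite dvdn_mull.
- by rewrite bu base_mul // p0 ltnn.
Qed.

Lemma joint_notin p A s : joint_anchors p A -> ~~ (0 < s < p) -> s * K \notin A.
Proof.
move=> joints sp; apply/negP => /joints[s' [h1 h2 /eqP]]; rewrite eqn_pmul2r // => /eqP e.
by move: sp; rewrite e h1 h2.
Qed.

Lemma improve_single p A s : admissible p A -> 0 < p -> joint_anchors p A -> 0 < s < p ->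
  0 < count_mem (s * K) A -> 2 + count_mem (s * K) A < Delta -> improvable p A.
Proof.
move=> adm p0 joints sp c0 cD; have [ok _] := adm.
have sA : s * K \in A by rewrite -has_pred1 has_count.
have pB := perm_to_rem sA; set B := rem _ A in pB.
have okB := code_ok_perm pB ok; have isB := hiso_perm K0 ok pB.
have admB := admissible_hiso adm okB isB.
have nB w : w \notin A -> w \notin B by apply: contra; exact: mem_rem.
have z1 := joint_notin (s := 0) joints isT; rewrite mul0n in z1.
have z2 : p * K \notin A by apply: (joint_notin joints); rewrite ltnn andbF.
have cB : 2 + count_mem (s * K) (s * K :: B) < Delta by rewrite -(seq.permP pB).
rewrite /improvable (rho_code_hiso ok isB).
case: (move_single R K0 m0 okB sp) => lt; do 2!eexists; (split; last exact: lt).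
- apply: (admissible_single admB sp) => //; rewrite ?base0 //; last exact: nB.
  by rewrite eq_sym -lt0n muln_gt0 K0 andbT; case/andP: sp.
- apply: (admissible_single admB sp) => //; rewrite ?base_mul // ?p0 ?ltnn //; last exact: nB.
  by rewrite eqn_pmul2r // gtn_eqF //; case/andP: sp.
Qed.

Lemma improve_joint p A s s' : admissible p A -> joint_anchors p A ->
  0 < s < p -> 0 < s' < p -> s != s' -> s' * K \notin A ->
  (rho_code p A < rho_code p (mv (s * K) (s' * K) A))%R -> improvable p A.
Proof.
move=> adm joints /andP[s0 s1] /andP[s0' s1'] ne nA lt; do 2!eexists; split; last exact: lt.
apply: admissible_mv => //; rewrite ?leq_mul2r ?(ltnW s1) ?(ltnW s1') ?orbT //.
  by rewrite eqn_pmul2r.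
by rewrite !base_mul // s0 s1 s0' s1'.
Qed.

(** Let [s] and [t] be the first and last joints that are not full. A full joint between them gives
    a least full [i] above [s] and a greatest full [j] below [t], with [i - 1] and [j + 1] not full,
    which the hypothesis forbids. If all joints are full the split into [a] and [b] is arbitrary. *)
Lemma window_shape (full : pred nat) p : 0 < p -> ~~ full 0 -> ~~ full p ->
  (forall i j, 1 < i -> i <= j -> j.+1 < p -> full i -> full j -> full i.-1 || full j.+1) ->
  exists a b, (a + b = p - 1 \/ a + b + 1 < p) /\
    forall s, 0 < s < p -> full s = (s <= a) || (p - b <= s).
Proof.
move=> p0 f0 fp ex.
have ex1 : exists s, (0 < s) && ~~ full s by exists p; rewrite p0.
have [s /andP[s0 fs] smin] := ex_minnP ex1.
have sp : s <= p by apply: smin; rewrite p0.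
have below i : 0 < i -> i < s -> full i.
  move=> i0 is_; apply/negPn/negP => nf; have := smin i; rewrite i0 nf => /(_ isT); lia.
have [sp'|ps] := ltnP s p; last first.
  exists (p - 1), 0; split; first by left; rewrite addn0.
  by move=> i /andP[i0 ip]; rewrite below //; lia.
have ex2 : exists t, (t < p) && ~~ full t by exists s; rewrite sp'.
have [t /andP[tp ft] tmax] := ex_maxnP ex2 (m := p) (fun i h => ltac:(lia)).
have st : s <= t by apply: tmax; rewrite sp'.
have above i : t < i -> i < p -> full i.
  move=> i0 ip; apply/negPn/negP => nf; have := tmax i; rewrite ip nf => /(_ isT); lia.
exists (s - 1), (p - 1 - t); split; first by right; lia.
move=> r /andP[r0 rp]; have -> : p - (p - 1 - t) = t.+1 by lia.
have [rs|sr] := ltnP r s; first by rewrite below //; lia.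
have [tr|rt] := ltnP t r; first by rewrite above // orbT.
have -> : (r <= s - 1) = false by lia.
rewrite /=; apply/negP => fr.
have rs' : s < r by rewrite ltn_neqAle sr andbT; apply: contraNneq fs => ->.
have rt' : r < t by rewrite ltn_neqAle rt andbT; apply: contraNneq ft => <-.
have ex3 : exists i, (s < i) && full i by exists r; rewrite rs'.
have [i /andP[si fi] imin] := ex_minnP ex3.
have ex4 : exists j, (j < t) && full j by exists r; rewrite rt'.
have [j /andP[jt fj] jmax] := ex_maxnP ex4 (m := p) (fun i h => ltac:(lia)).
have ir : i <= r by apply: imin; rewrite rs'.
have rj : r <= j by apply: jmax; rewrite rt'.
case/orP: (ex i j (leq_ltn_trans s0 si) (leq_trans ir rj) (leq_ltn_trans jt tp) fi fj) => h.
  have [e|ne] := eqVneq i.-1 s; first by rewrite e (negPf fs) in h.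
  by have := imin i.-1; rewrite h andbT; lia.
have [e|ne] := eqVneq j.+1 t; first by rewrite e (negPf ft) in h.
by have := jmax j.+1; rewrite h andbT; lia.
Qed.

(** Degrees in the bare path are at most 2, so a vertex of degree [Delta] carries pendant edges and
    is therefore one of the joints counted. *)
Lemma count_full p A : admissible p A -> joint_anchors p A ->
  (forall s, 0 < s < p -> count_mem (s * K) A = if s * K \in A then Delta - 2 else 0) ->
  n = count (fun s => s * K \in A) (iota 1 (p - 1)).
Proof.
move=> [ok [h1 h2]] joints counts.
pose l := [seq vtx (s * K) | s <- iota 1 (p - 1) & s * K \in A].
have sv s : s < p -> vtx (s * K) = s * K :> nat.
  by move=> sp; rewrite (vtxE ok) // leq_mul2r ltnW ?orbT.
have ul : uniq l.
  rewrite map_inj_in_uniq ?filter_uniq ?iota_uniq // => s t.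
  rewrite !mem_filter !mem_iota => /andP[_ hs] /andP[_ ht] /(congr1 val) /=.
  rewrite !sv; try lia; move/eqP; rewrite eqn_pmul2r // => /eqP //.
rewrite -size_filter -(size_map (fun s => vtx (s * K))) -/l -(card_uniqP ul) -h2.
apply: eq_card => x; rewrite inE deg_code //; apply/eqP/mapP => [e|[s]]; last first.
  rewrite mem_filter mem_iota => /andP[sA hs] ->; have sp : 0 < s < p by lia.
  by rewrite sv ?counts ?sA ?base_mul //; [case/andP: sp => -> ->; lia | case/andP: sp].
have xA : (x : nat) \in A.
  rewrite -has_pred1 has_count lt0n; apply/eqP => c0; move: e; rewrite c0 addn0 /base.
  have := count_size (fun i => i * K == x) (iota 0 p).
  have : count (fun i => i * K == x) (iota 0 p) <= 1.
    have [/hasP[t tp /eqP tx]|] := boolP (has (fun i => i * K == x) (iota 0 p)).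
      by rewrite -tx count_mulK // leq_b1.
    by rewrite has_count -leqNgt => h; apply: leq_trans h _.
  by case: (0 < x); lia.
have [s [s0 s1 xe]] := joints _ xA; exists s.
  by rewrite mem_filter -xe xA mem_iota s0; lia.
by apply: val_inj; rewrite /= sv.
Qed.

Lemma reflect_counts p A s : code_ok p A -> s <= p ->
  count_mem (s * K) [seq p * K - a | a <- A] = count_mem ((p - s) * K) A.
Proof.
move=> [_ h] sp; rewrite count_map; apply: eq_in_count => a aA /=.
have := h a aA; have : s * K <= p * K by rewrite leq_mul2r sp orbT.
rewrite mulnBl; lia.
Qed.

Lemma joint_anchors_reflect p A : joint_anchors p A -> joint_anchors p [seq p * K - a | a <- A].
Proof.
move=> joints q /mapP[a /joints[s [s0 s1 ->]] ->]; exists (p - s).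
by rewrite -mulnBl; split=> //; lia.
Qed.

Lemma extremal_or_improvable_joint p A : admissible p A -> 0 < p -> joint_anchors p A ->
  hiso (cgr p A) (hg C) \/ improvable p A.
Proof.
move=> adm p0 joints; have [ok [h1 h2]] := adm.
have sv s : s < p -> vtx (s * K) = s * K :> nat.
  by move=> sp; rewrite (vtxE ok) // leq_mul2r ltnW ?orbT.
pose bad s := (0 < count_mem (s * K) A) && (2 + count_mem (s * K) A < Delta).
have [/hasP[s]|/hasPn nobad] := boolP (has bad (iota 1 (p - 1))).
  rewrite mem_iota => hs /andP[c1 c2]; right; apply: (improve_single adm p0 joints _ c1 c2); lia.
have counts s : 0 < s < p -> count_mem (s * K) A = if s * K \in A then Delta - 2 else 0.
  move=> sp; have := nobad s; rewrite mem_iota /bad => /(_ ltac:(lia)).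
  have := h1 (vtx (s * K)); case/andP: (sp) => s0 s1.
  rewrite deg_code // sv // base_mul // s0 s1 -has_pred1 has_count.
  by case: (posnP (count_mem _ A)) => [-> //|c0] /=; lia.
pose full s := s * K \in A.
pose P i j := [&& 1 < i, i <= j, j.+1 < p, full i, full j, ~~ full i.-1 & ~~ full j.+1].
have [/hasP[i _ /hasP[j _ /and5P[i1 ij jp fi /and3P[fj f1 f2]]]]|/hasPn noP] :=
    boolP (has (fun i => has (P i) (iota 0 p)) (iota 0 p)).
  right; case: (move_outward R K0 m0 ok i1 ij jp fi fj) => lt.
    by apply: (improve_joint adm joints _ _ _ f1 lt); lia.
  by apply: (improve_joint adm joints _ _ _ f2 lt); lia.
have fp : ~~ full p by apply: (joint_notin joints); rewrite ltnn andbF.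
have [|a [b [ab shape]]] := @window_shape full p p0 (joint_notin (s := 0) joints isT) fp.
  move=> i j i1 ij jp fi fj; apply/negPn/negP; rewrite negb_or => /andP[f1 f2].
  have := noP i; rewrite mem_iota => /(_ ltac:(lia)) /hasPn /(_ j).
  by rewrite mem_iota /P i1 ij jp fi fj f1 f2 => /(_ ltac:(lia)).
have nE : n = a + b.
  rewrite (count_full adm joints counts) -(@count_window p a b); last by lia.
  by apply: eq_in_count => s; rewrite mem_iota => hs; apply: shape; lia.
have counts' s : 0 < s < p -> count_mem (s * K) A = if (s <= a) || (p - b <= s) then Delta - 2 else 0.
  by move=> sp; rewrite counts // -shape.
have D2 : 0 < Delta - 2 by lia.
have halves : n./2 + uphalf n = n by rewrite uphalf_half addnA -[RHS]odd_double_half -addnn; lia.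
(* If every joint is full, [a] and [b] carry no information and may be replaced by the two halves of
   [n]. *)
case: ab => ab.
  left; apply: (hiso_extremal ok halves _ joints) => //; first by lia.
  by move=> s sp; rewrite counts' //; congr (if _ then _ else _); lia.
have [okr isr] := hiso_reflect K0 ok; have jr := joint_anchors_reflect joints.
have countr s : 0 < s < p -> count_mem (s * K) [seq p * K - x | x <- A] =
    if (s <= b) || (p - a <= s) then Delta - 2 else 0.
  move=> sp; rewrite reflect_counts //; last by lia.
  rewrite counts'; last by lia.
  by congr (if _ then _ else _); lia.
have notin B a' b' : joint_anchors p B -> a' + b' + 1 < p ->
   (forall s, 0 < s < p -> count_mem (s * K) B = if (s <= a') || (p - b' <= s) then Delta - 2 else 0) ->
   (p - b'.+1) * K \notin B.
  move=> jB h cB; rewrite -has_pred1 has_count cB; last by lia.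
  by have -> : (p - b'.+1 <= a') || (p - b' <= p - b'.+1) = false by lia.
have [big|small] := ltnP b.+1 a.
  right; have lt := move_balance R K0 m0 ok joints counts' D2 big ab.
  by apply: (improve_joint adm joints _ _ _ _ lt); rewrite ?(notin A a b) //; lia.
have [big'|small'] := ltnP a.+1 b.
  right; rewrite /improvable (rho_code_hiso ok isr).
  have ba : b + a + 1 < p by lia.
  have lt := move_balance R K0 m0 okr jr countr D2 big' ba.
  apply: (improve_joint (admissible_hiso adm okr isr) jr _ _ _ _ lt); rewrite ?(notin _ b a) //; lia.
(* The groups now differ by at most one; if the larger one is on the left, the reflected code has
   the required order. *)
left; have [ae|ae] := eqVneq a n./2.
  apply: (hiso_extremal ok (esym nE) _ joints counts' ae); lia.
apply: hiso_trans isr _.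
have ba : b + a = n by lia.
have up : uphalf n = n - n./2 by lia.
have [be ae'] : b = n./2 /\ a = uphalf n by move: (uphalf_half n) (odd_double_half n); rewrite -addnn; lia.
by apply: (hiso_extremal okr ba _ jr countr be ae'); lia.
Qed.

Lemma extremal_or_improvable p A : admissible p A -> hiso (cgr p A) (hg C) \/ improvable p A.
Proof.
move=> adm; have [ok _] := adm.
have [p1 [A1 [ok1 p10 is1 inn]]] := normal_form K0 ok m0.
have adm1 := admissible_hiso adm ok1 is1.
rewrite /improvable (rho_code_hiso ok is1).
suff [h|h] : hiso (cgr p1 A1) (hg C) \/ improvable p1 A1.
- by left; exact: hiso_trans is1 h.
- by right.
have [/hasP[u uA Ku]|/hasPn joints] := boolP (has (fun u => ~~ (K %| u)) A1).
  by right; exact: improve_inner inn uA Ku.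
apply: extremal_or_improvable_joint => // q qA.
have := joints q qA; rewrite negbK => /dvdnP[s qs]; exists s; move: (inn q qA); rewrite qs.
case/andP => q1 q2; split=> //.
  by rewrite lt0n; apply: contraTneq q1 => ->; rewrite mul0n -ltnNge.
by rewrite leq_pmul2r // in q2; apply: leq_ltn_trans q2 _; rewrite prednK.
Qed.

Lemma extremal_or_less p A : admissible p A ->
  hiso (cgr p A) (hg C) \/ (rho_code p A < rho R (hg C))%R.
Proof.
have [k] := ubnP #|[set G : {set {set 'I_N}} | (rho_code p A < rho R G)%R]|.
elim: k p A => // k IH p A hk adm.
case: (extremal_or_improvable adm) => [|[p' [A' [adm' lt]]]]; first by left.
right; have : #|[set G : {set {set 'I_N}} | (rho_code p' A' < rho R G)%R]| < k.
  rewrite -ltnS; apply: leq_trans hk; rewrite ltnS.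
  exact: (card_above_lt (f := fun G => rho R G) (G := cgr p' A') lt).
move=> /IH /(_ adm')[iso|]; last exact: lt_trans.
by rewrite -(rho_hiso_code K0 R m0 (proj1 adm') iso).
Qed.

End Extremal.

Lemma caterpillar_code (k m Delta n : nat) (V : finType) (E : {set {set V}}) :
  2 <= k -> in_Tk k m Delta n E -> caterpillar k E ->
  exists p A, hiso E (cgraph k.-1 m p A) /\ admissible k.-1 m Delta n p A.
Proof.
case: k => [|[|K]] // _ [_ _ Em Emax En] [p [att [_ hatt iso]]].
have K0 : 0 < K.+1 by [].
rewrite cat_graphE // in iso; move: iso; set A := flatten _ => iso; rewrite hg_code // in iso.
have ok : code_ok K.+1 (p + size A) p A.
  split=> // a /flatten_mapP[c cin]; rewrite mem_nseq => /andP[_ /eqP->].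
  by move/allP: hatt => /(_ c cin) /andP[]; rewrite subSS subn0.
(* Both sides count edges; hence all caterpillars of the class are coded on the same vertex set. *)
have sm : p + size A = m.
  rewrite -Em -(@card_tree K.+1 (p + size A) (cpar K.+1 p A)) //; last exact: cpar_ok.
  case: iso => f [[g fK gK]]; rewrite -/(cgraph _ _ _ _) => <-.
  by rewrite card_imset //; exact/imset_inj/(can_inj fK).
rewrite sm in ok; exists p, A; rewrite -sm in ok *.
split=> //; split=> //; apply: hiso_deg_profile iso _; split=> // v.
by rewrite -Emax /maxdeg; exact: (@leq_bigmax_cond _ predT (deg E) v isT).
Qed.

Unset Implicit Arguments.

Theorem theorem1 (R : realType) (k m Delta n : nat)
    (V : finType) (E : {set {set V}}) :
  2 <= k -> 1 <= m -> 3 <= Delta -> 2 <= n ->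
  in_Tk k m Delta n E -> caterpillar k E ->
  let mstar := m - n * (Delta - 2) in
  let C := Ck k mstar Delta n./2 (uphalf n) in
  (rho R E <= rho R (hg C))%R /\
  (rho R E = rho R (hg C) <-> hiso E (hg C)).
Proof.
move=> k2 m1 D3 n2 ET Ecat mstar C.
have [p [A [iso adm]]] := caterpillar_code k2 ET Ecat.
have K0 : 0 < k.-1 by case: k k2 {ET Ecat C iso adm} => [|[]].
have CE : C = Ck k.-1.+1 mstar Delta n./2 (uphalf n) by rewrite /C prednK // ltnW.
have osi := hiso_sym iso; have ok := proj1 adm.
have rE : rho R E = rho R (cgraph k.-1 m p A) by rewrite (rho_hiso_code K0 R m1 ok osi).
have eqC : hiso E (hg C) -> rho R E = rho R (hg C).
  by move=> EC; rewrite rE; apply: rho_hiso_code => //; exact: hiso_trans osi EC.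
have := extremal_or_less R K0 m1 D3 n2 adm; rewrite -CE -rE => -[AC|lt].
  have EC := hiso_trans iso AC; by rewrite (eqC EC); split.
split; first exact: ltW.
by split=> [e|/eqC //]; rewrite e ltxx in lt.
Qed.
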